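(* If $A$ is a $C^*$-algebra and $T$ is a quasi-centralizer of $K(A)$, then there is a direct sum decomposition $A=A_0\oplus A_1$ such that $A_1$ is a dual $C^*$-algebra and $T_{|K(A_0)\times K(A_0)}$ is locally bounded.
   Context: $K(A)$ denotes the Pedersen ideal of $A$, i.e. the smallest dense two-sided ideal of $A$. If $A=A_0\oplus A_1$ then $K(A)=K(A_0)\oplus K(A_1)$, and a quasi-centralizer of $K(A)$ restricts to a quasi-centralizer of $K(A_0)$. A quasi-centralizer of an algebra $B$ is a bilinear map $T:B\times B\to B$ (not assumed bounded) such that $T(b_1b_2,b_3)=b_1T(b_2,b_3)$ and $T(b_1,b_2b_3)=T(b_1,b_2)b_3$ for all $b_1,b_2,b_3\in B$. A quasi-centralizer $T$ of $K(A)$ is locally bounded if there is a family $\{I_j\}$ of closed two-sided ideals of $A$ such that $A$ is the norm closure of $\sum_j I_j$ and the restriction of $T$ to $[K(A)\cap I_j]\times[K(A)\cap I_j]$ is bounded for each $j$ (for $T_{|K(A_0)\times K(A_0)}$ this is applied with $A_0$ in place of $A$). An elementary $C^*$-algebra is one isomorphic to the algebra $\mathcal K(H)$ of compact operators on a Hilbert space $H$; a dual $C^*$-algebra is a $c_0$ direct sum of elementary $C^*$-algebras. In direct sum decompositions the summands are closed two-sided ideals and are allowed to be $\{0\}$. *)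

(* Defs.v *)
From HB Require Import structures.
From mathcomp Require Import all_boot all_order all_algebra complex.
From mathcomp Require Import all_classical all_reals all_analysis.

Set Implicit Arguments.
Unset Strict Implicit.
Unset Printing Implicit Defensive.

Import Order.TTheory GRing.Theory Num.Theory.
Import numFieldNormedType.Exports.

Local Open Scope classical_set_scope.
Local Open Scope ring_scope.

(* The complex field is R[i] with R : realType. Norms take their values in R[i],
   where [0 <= z] implies that z is real. *)

(* C*-algebras need not have a unit, so the product is not a MathComp ring
   product. *)
HB.mixin Record isCStarAlgebra (R : realType) A
    of CompleteNormedModule R[i] A := {
  cstar_mul : A -> A -> A ;
  cstar_adj : A -> A ;
  cstar_mulA : associative cstar_mul ;
  cstar_mulDl : left_distributive cstar_mul +%R ;
  cstar_mulDr : right_distributive cstar_mul +%R ;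
  cstar_scaleAl : forall (c : R[i]) (x y : A),
    c *: cstar_mul x y = cstar_mul (c *: x) y ;
  cstar_scaleAr : forall (c : R[i]) (x y : A),
    c *: cstar_mul x y = cstar_mul x (c *: y) ;
  cstar_adjK : involutive cstar_adj ;
  cstar_adjD : {morph cstar_adj : x y / x + y} ;
  cstar_adjZ : forall (c : R[i]) (x : A),
    cstar_adj (c *: x) = Num.conj c *: cstar_adj x ;
  cstar_adjM : forall x y : A,
    cstar_adj (cstar_mul x y) = cstar_mul (cstar_adj y) (cstar_adj x) ;
  cstar_normM : forall x y : A, `|cstar_mul x y| <= `|x| * `|y| ;
  cstar_norm : forall x : A, `|cstar_mul (cstar_adj x) x| = `|x| ^+ 2
}.

#[short(type="cstarAlgType")]
HB.structure Definition CStarAlgebra (R : realType) :=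
  {A of isCStarAlgebra R A & CompleteNormedModule R[i] A}.

HB.mixin Record isHilbert (R : realType) H
    of CompleteNormedModule R[i] H := {
  inner : {dot H for (@Num.conj R[i])} ;
  inner_norm : forall x : H, inner x x = `|x| ^+ 2
}.

#[short(type="hilbertType")]
HB.structure Definition Hilbert (R : realType) :=
  {H of isHilbert R H & CompleteNormedModule R[i] H}.

Definition compact_operators (R : realType) (H : hilbertType R) :
    set (H -> H) :=
  [set f | linear f /\ precompact (f @` [set x | `|x| <= 1])].
Arguments compact_operators {R} H.

(* E is *-isomorphic to K(H): phi is a bijection of E onto K(H) which carries
   the product to composition and the involution to the Hilbert adjoint. *)
Definition elementary (R : realType) (E : cstarAlgType R) : Prop :=
  exists (H : hilbertType R) (phi : E -> (H -> H)),
    [/\ forall (c : R[i]) (a b : E) (v : H),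
          phi (c *: a + b) v = c *: phi a v + phi b v,
        forall (a b : E) (v : H), phi (cstar_mul a b) v = phi a (phi b v),
        forall (a : E) (v w : H),
          inner (phi (cstar_adj a) v) w = inner v (phi a w),
        injective phi &
        range phi = compact_operators H].

Definition c0_sum (R : realType) (I : Type) (E : I -> cstarAlgType R) :
    set (forall i, E i) :=
  [set x | forall e : R[i], 0 < e -> finite_set [set i | e <= `|x i|]].
Arguments c0_sum {R I} E.

Section Subsets.
Variables (R : realType) (A : cstarAlgType R).

(* Ideals, K(B) and local boundedness are relative to B, which is a closed
   two-sided ideal of A (setT for A itself). As B is closed, closedness and
   closures of subsets of B are the same in B as in A. *)
Implicit Types (B J : set A) (T : A -> A -> A).

Definition two_sided_ideal B J : Prop :=
  [/\ J `<=` B,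
      J 0,
      forall (c : R[i]) (x y : A), J x -> J y -> J (c *: x + y) &
      forall b x : A, B b -> J x -> J (cstar_mul b x) /\ J (cstar_mul x b)].

Definition closed_two_sided_ideal B J : Prop :=
  two_sided_ideal B J /\ closed J.

Definition dense_two_sided_ideal B J : Prop :=
  two_sided_ideal B J /\ B `<=` closure J.

(* By Pedersen's theorem this intersection of all dense two-sided ideals of B is
   itself dense, hence the smallest dense two-sided ideal. *)
Definition pedersen_ideal B : set A := smallest (dense_two_sided_ideal B) set0.

(* Here B is any subalgebra, such as K(A). A map B x B -> B is represented by a
   map on A x A, whose values outside B x B are irrelevant. *)
Definition quasi_centralizer B T : Prop :=
  [/\ forall x y, B x -> B y -> B (T x y),
      forall (c : R[i]) x x' y, B x -> B x' -> B y ->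
        T (c *: x + x') y = c *: T x y + T x' y,
      forall (c : R[i]) x y y', B x -> B y -> B y' ->
        T x (c *: y + y') = c *: T x y + T x y',
      forall x y z, B x -> B y -> B z ->
        T (cstar_mul x y) z = cstar_mul x (T y z) &
      forall x y z, B x -> B y -> B z ->
        T x (cstar_mul y z) = cstar_mul (T x y) z].

Definition bounded_on B T : Prop :=
  exists M : R[i], forall x y, B x -> B y -> `|T x y| <= M * `|x| * `|y|.

Definition sum_of (J : Type) (I : J -> set A) : set A :=
  [set x | exists (n : nat) (j : 'I_n -> J) (f : 'I_n -> A),
     (forall k, I (j k) (f k)) /\ x = \sum_(k < n) f k].

Definition locally_bounded B T : Prop :=
  exists (J : Type) (I : J -> set A),
    [/\ forall j, closed_two_sided_ideal B (I j),
        closure (sum_of I) = B &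
        forall j, bounded_on (pedersen_ideal B `&` I j) T].

Definition direct_sum_decomposition (A0 A1 : set A) : Prop :=
  [/\ closed_two_sided_ideal setT A0,
      closed_two_sided_ideal setT A1,
      A0 `&` A1 = [set 0] &
      forall x, exists x0 x1, [/\ A0 x0, A1 x1 & x = x0 + x1]].

Definition star_morphism_on B (E : cstarAlgType R) (phi : A -> E) : Prop :=
  [/\ forall (c : R[i]) (x y : A), B x -> B y ->
        phi (c *: x + y) = c *: phi x + phi y,
      forall x y, B x -> B y ->
        phi (cstar_mul x y) = cstar_mul (phi x) (phi y) &
      forall x, B x -> phi (cstar_adj x) = cstar_adj (phi x)].

(* B is *-isomorphic to the c_0 direct sum of elementary C*-algebras E_i, whose
   operations are componentwise. *)
Definition dual_cstar_algebra B : Prop :=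
  exists (I : Type) (E : I -> cstarAlgType R) (phi : A -> forall i, E i),
    [/\ forall i, elementary (E i),
        forall i, star_morphism_on B (fun x => phi x i),
        forall x y, B x -> B y -> phi x = phi y -> x = y &
        phi @` B = c0_sum E].

End Subsets.

(* Main.v *)
(* Let A0 be the closure of the sum of all closed *-ideals I such that
   |s T(x, y)| <= M |s| |x| |y| for s in I and x, y in K(A), and let A1 be the
   annihilator of A0. A gliding hump argument shows that an algebra of elements
   with a common unit in K(A) cannot contain orthogonal elements g_n with
   g_n T g_n more and more unbounded, since two convergent series
   x = sum 2^-n g_n x_n and y = sum 2^-n y_n g_n would give an element T(x, y)
   of infinite norm. A hereditary algebra in which humps cannot be split off has
   no orthogonal pairs, so it is spanned by a minimal projection; hence every
   nonzero hereditary subalgebra of A1 contains a minimal projection, A1 is the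
   closed ideal which these generate, and A = A0 + A1. The ideal generated by a
   minimal projection p is K(A p), where A p is a Hilbert space for
   <x, y> p = y^* x, and two such ideals are equal or orthogonal, so that A1 is
   the c_0-sum of the distinct ones. *)

From HB Require Import structures.
From mathcomp Require Import all_boot all_order all_algebra complex.
From mathcomp Require Import all_classical all_reals all_analysis.
From mathcomp Require Import ring lra.
Require Import Defs.

Set Implicit Arguments.
Unset Strict Implicit.
Unset Printing Implicit Defensive.

Import Order.TTheory GRing.Theory Num.Theory.
Import numFieldNormedType.Exports.

Local Open Scope classical_set_scope.
Local Open Scope complex_scope.
Local Open Scope ring_scope.

(** * The real-valued norm *)

(** [T] is unbounded and lives only on K(A), which is not closed. Every hump is therefore placed
    under a fixed [e] in K(A): a limit [x] with [e x = x] is again in K(A). The ideals I are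
    described by bounds on [s T(x, y)] because this can be tested from both sides by elements which
    move inside [T]. Boundedness of [T] itself on K(A0) then rests on a separate fact: [T(x, y)]
    lies in I when [x] does, by continuity of [s T(., y)]. That A is the sum of A0 and its
    annihilator is not automatic, since such a sum is in general only an essential ideal. The humps
    are run a second time, on hereditary algebras outside the sum. If such an algebra does not meet
    A1, the hump has to be found inside A0; its unit then lies in the sum, and what is orthogonal to
    the hump is still outside. No unit and no spectrum are available at the start. Functions of a
    self-adjoint element act on A as limits of Bernstein polynomials, and every comparison of norms
    goes through the one lemma [norm_test]. *)

Definition nr (R : realType) (V : normedModType R[i]) (x : V) : R :=
  complex.Re `|x|.

Lemma gt0c (R : realType) (e : R) : (0 < e%:C) = (0 < e).
Proof. exact: (ltcR 0 e). Qed.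

Section RealNorm.
Variables (R : realType) (V : normedModType R[i]).
Implicit Types (x y z : V) (S : set V).

Lemma nrE x : `|x| = (nr x)%:C.
Proof. by rewrite /nr RRe_real// ger0_real. Qed.

Lemma nr_ge0 x : 0 <= nr x.
Proof. by rewrite -ler0c -nrE. Qed.

Lemma nr0 : nr (0 : V) = 0.
Proof. by rewrite /nr normr0. Qed.

Lemma nr_eq0 x : nr x = 0 -> x = 0.
Proof. by move=> h; apply/normr0_eq0; rewrite nrE h. Qed.

Lemma nrN x : nr (- x) = nr x.
Proof. by rewrite /nr normrN. Qed.

Lemma nrBC x y : nr (x - y) = nr (y - x).
Proof. by rewrite -nrN opprB. Qed.

Lemma nrD x y : nr (x + y) <= nr x + nr y.
Proof. by have := ler_normD x y; rewrite !nrE -rmorphD lecR. Qed.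

Lemma nrB x y : nr (x - y) <= nr x + nr y.
Proof. by rewrite -(nrN y) nrD. Qed.

Lemma nr_dist x y z : nr (x - z) <= nr (x - y) + nr (y - z).
Proof. by apply: le_trans (nrD _ _); rewrite addrA subrK. Qed.

Lemma nrZc (c : R[i]) x : nr (c *: x) = complex.Re `|c| * nr x.
Proof.
have cE : `|c| = (complex.Re `|c|)%:C by rewrite RRe_real// ger0_real.
by rewrite {1}/nr normrZ (nrE x) {1}cE -rmorphM.
Qed.

Lemma nrZ (a : R) x : nr (a%:C *: x) = `|a| * nr x.
Proof. by rewrite nrZc normc_def /= expr0n addr0 sqrtr_sqr. Qed.

Lemma nrZ_ge0 (a : R) x : 0 <= a -> nr (a%:C *: x) = a * nr x.
Proof. by move=> a0; rewrite nrZ ger0_norm. Qed.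

Lemma nr_small x : (forall e : R, 0 < e -> nr x <= e) -> x = 0.
Proof.
move=> h; apply/nr_eq0/le_anti; rewrite nr_ge0 andbT.
by apply/ler_addgt0Pl => e e0; rewrite addr0 h.
Qed.

Lemma nr_gt0 x : x <> 0 -> 0 < nr x.
Proof.
move=> x0; rewrite lt_neqAle nr_ge0 andbT eq_sym.
by apply/eqP => /nr_eq0.
Qed.

Lemma closureP S x :
  closure S x <-> (forall e : R, 0 < e -> exists2 y, S y & nr (x - y) < e).
Proof.
split=> [cS e e0|h].
  have [] := cS (ball x e%:C); first by apply: nbhsx_ballx; rewrite gt0c.
  by move=> y [Sy]; rewrite -ball_normE /ball_/= nrE ltcR => yx; exists y.
move=> B /nbhs_ballP[e /= e0 eB].
have eE : e = (complex.Re e)%:C by rewrite RRe_real// gtr0_real.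
have {}e0 : 0 < complex.Re e by rewrite -gt0c -eE.
have [y Sy xy] := h _ e0; exists y; split=> //; apply: eB.
by rewrite -ball_normE /ball_/= nrE eE ltcR.
Qed.

Lemma closedP S : closed S <->
  (forall x, (forall e : R, 0 < e -> exists2 y, S y & nr (x - y) < e) -> S x).
Proof.
split=> [cS x h|h x /closureP]; last exact: h.
by apply: cS; apply/closureP.
Qed.

End RealNorm.

Definition nlim (R : realType) (V : normedModType R[i]) (u : nat -> V) (l : V) :=
  forall e : R, 0 < e -> exists N, forall n, (N <= n)%N -> nr (u n - l) < e.

Section Limits.
Variables (R : realType) (V : normedModType R[i]).
Implicit Types (u v : nat -> V) (l : V).

Lemma nlimP u l : nlim u l <-> u @ \oo --> l.
Proof.
split=> [h|/cvgrPdist_lt h e e0].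
  apply/cvgrPdist_lt => e e0.
  have eE : e = (complex.Re e)%:C by rewrite RRe_real// gtr0_real.
  have {}e0 : 0 < complex.Re e by rewrite -gt0c -eE.
  have [N hN] := h _ e0; exists N => // n /hN.
  by rewrite nrE eE ltcR nrBC.
move: e0; rewrite -gt0c => /h[N _ hN]; exists N => n /hN.
by rewrite nrE ltcR nrBC.
Qed.

Lemma nlim_uniq u l l' : nlim u l -> nlim u l' -> l = l'.
Proof.
move=> h h'; apply/subr0_eq/nr_small => e e0.
have e20 : 0 < e / 2 by rewrite divr_gt0.
have [N hN] := h _ e20; have [N' hN'] := h' _ e20.
have := hN _ (leq_maxl N N'); have := hN' _ (leq_maxr N N').
set n := maxn N N' => a b.
apply: le_trans (nr_dist _ (u n) _) _; rewrite (nrBC l); lra.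
Qed.

Lemma nlimD u v l l' : nlim u l -> nlim v l' -> nlim (fun n => u n + v n) (l + l').
Proof. by move=> /nlimP h /nlimP h'; apply/nlimP; exact: cvgD. Qed.

Lemma nlim_cst l : nlim (fun=> l) l.
Proof. by move=> e e0; exists 0%N => n _; rewrite subrr nr0. Qed.

Lemma nlim_le u l (M : R) : nlim u l -> (forall n, nr (u n) <= M) -> nr l <= M.
Proof.
move=> h b; apply/ler_addgt0Pr => e e0; have [N hN] := h _ e0.
have := hN N (leqnn _); have := b N; rewrite nrBC.
have := nrD (l - u N) (u N); rewrite subrK; lra.
Qed.

Lemma nlim_map (W : normedModType R[i]) (f : V -> W) (M : R) u l :
  (forall x y, nr (f x - f y) <= M * nr (x - y)) ->
  nlim u l -> nlim (fun n => f (u n)) (f l).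
Proof.
move=> hf h e e0.
have M0 : 0 < `|M| + 1 by rewrite ltr_wpDl.
have [N hN] := h _ (divr_gt0 e0 M0); exists N => n /hN.
rewrite ltr_pdivlMr// => h1; apply: le_lt_trans h1.
apply: le_trans (hf _ _) _; rewrite mulrC ler_wpM2l ?nr_ge0//.
by rewrite (le_trans (ler_norm _))// lerDl.
Qed.

Lemma nlim_closed (S : set V) u l : closed S -> (forall n, S (u n)) -> nlim u l -> S l.
Proof.
move=> /closedP cS Su h; apply: cS => e /h[N /(_ N (leqnn _)) hN].
by exists (u N) => //; rewrite nrBC.
Qed.

End Limits.

Lemma nlim_cauchy (R : realType) (V : completeNormedModType R[i]) (u : nat -> V) :
  (forall e : R, 0 < e -> exists N, forall m n, (N <= m)%N -> (N <= n)%N ->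
     nr (u m - u n) < e) -> exists l, nlim u l.
Proof.
move=> h; suff /cvg_ex[l /nlimP ul] : cvg (u @ \oo) by exists l.
apply: cauchy_cvg; apply/cauchy_ballP => e e0.
have eE : e = (complex.Re e)%:C by rewrite RRe_real// gtr0_real.
have {}e0 : 0 < complex.Re e by rewrite -gt0c -eE.
have [N hN] := h _ e0.
exists (u @` [set n | (N <= n)%N], u @` [set n | (N <= n)%N]).
  by split; exists N => // n /= Nn; exists n.
by case=> x y /= [[m Nm <-] [n Nn <-]]; rewrite -ball_normE /ball_/= nrE eE ltcR hN.
Qed.

Declare Scope cstar_scope.
Delimit Scope cstar_scope with cstar.
Notation "x ** y" := (cstar_mul x y) (at level 40, left associativity) : cstar_scope.
Notation "x ^#" := (cstar_adj x) (at level 3, format "x ^#") : cstar_scope.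
Local Open Scope cstar_scope.

Section Basics.
Variables (R : realType) (A : cstarAlgType R).
Implicit Types (x y z : A).

Lemma mul0x x : 0 ** x = 0.
Proof. by have := cstar_mulDl 0 0 x; rewrite addr0 -[X in X = _]addr0 => /addrI. Qed.

Lemma mulx0 x : x ** 0 = 0.
Proof. by have := cstar_mulDr x 0 0; rewrite addr0 -[X in X = _]addr0 => /addrI. Qed.

Lemma mulNx x y : (- x) ** y = - (x ** y).
Proof. by apply/eqP; rewrite -addr_eq0 -cstar_mulDl addNr mul0x. Qed.

Lemma mulxN x y : x ** (- y) = - (x ** y).
Proof. by apply/eqP; rewrite -addr_eq0 -cstar_mulDr addNr mulx0. Qed.

Lemma mulBx x y z : (x - y) ** z = x ** z - y ** z.
Proof. by rewrite cstar_mulDl mulNx. Qed.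

Lemma mulxB x y z : x ** (y - z) = x ** y - x ** z.
Proof. by rewrite cstar_mulDr mulxN. Qed.

Lemma mulZx (c : R[i]) x y : (c *: x) ** y = c *: (x ** y).
Proof. by rewrite cstar_scaleAl. Qed.

Lemma mulxZ (c : R[i]) x y : x ** (c *: y) = c *: (x ** y).
Proof. by rewrite cstar_scaleAr. Qed.

Lemma adj0 : (0 : A)^# = 0.
Proof. by have := cstar_adjD (0:A) 0; rewrite addr0 -[X in X = _]addr0 => /addrI. Qed.

Lemma adjN x : (- x)^# = - x^#.
Proof. by apply/eqP; rewrite -addr_eq0 -cstar_adjD addNr adj0. Qed.

Lemma adjB x y : (x - y)^# = x^# - y^#.
Proof. by rewrite cstar_adjD adjN. Qed.

Lemma adjZr (a : R) x : (a%:C *: x)^# = a%:C *: x^#.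
Proof. by rewrite cstar_adjZ; congr (_ *: _); apply/CrealP/complex_realP; exists a. Qed.

Lemma nrM x y : nr (x ** y) <= nr x * nr y.
Proof. by have := cstar_normM x y; rewrite !nrE -rmorphM lecR. Qed.

Lemma nr_cstar x : nr (x^# ** x) = nr x ^+ 2.
Proof. by have := cstar_norm x; rewrite !nrE -rmorphXn => /complexI. Qed.

Lemma nr_adj x : nr x^# = nr x.
Proof.
have h y : nr y <= nr y^#.
  have [->|/eqP/nr_gt0 y0] := eqVneq y 0; first by rewrite adj0.
  by rewrite -(ler_pM2r y0) -expr2 -nr_cstar nrM.
by apply/le_anti; rewrite h -[in X in _ <= X](cstar_adjK x) h.
Qed.

Lemma nr_cstarr x : nr (x ** x^#) = nr x ^+ 2.
Proof. by rewrite -{1}(cstar_adjK x) nr_cstar nr_adj. Qed.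

Lemma adj_mul_eq0 x : x^# ** x = 0 -> x = 0.
Proof.
by move=> h; apply/nr_eq0/eqP; rewrite -sqrf_eq0 -nr_cstar h nr0.
Qed.

Lemma mul_adj_eq0 x : x ** x^# = 0 -> x = 0.
Proof.
by move=> h; apply/nr_eq0/eqP; rewrite -sqrf_eq0 -nr_cstarr h nr0.
Qed.

(** Take [y = x^#]: left multiplication represents [A] faithfully on itself even when there is no
    unit. *)
Lemma right_faithful x : (forall y, x ** y = 0) -> x = 0.
Proof. by move=> h; apply: mul_adj_eq0. Qed.

End Basics.

(** * Self-adjoint operators on A *)

Section Operators.
Variables (R : realType) (A : cstarAlgType R).
Implicit Types (u v w r s : A -> A) (x y z : A) (p q : {poly R}).

(* Operators on [A] replace the unitization of [A]: the unit is the identity map,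
   and adjoints are taken for the [A]-valued inner product [x^# ** y]. *)
Definition opb u (M : R) := forall x, nr (u x) <= M * nr x.
Definition sa u := forall x y, (u x)^# ** y = x^# ** u y.
Definition bsa u := sa u /\ exists M, opb u M.
Definition opcomm u v := forall x, u (v x) = v (u x).

Lemma adj_faithful x y : (forall z, x^# ** z = y^# ** z) -> x = y.
Proof.
move=> h; apply/subr0_eq/adj_mul_eq0; rewrite -{1}(cstar_adjK (x - y)) cstar_adjK.
by rewrite adjB mulBx h subrr.
Qed.

(** Both sides have the same [A]-valued inner product with every [z], so an adjointable map is
    automatically linear, and by the same argument a right module map ([sa_mulr]). Hence [sa]
    carries no linearity clause. *)
Lemma sa_lin u : sa u -> forall (c : R[i]) x y, u (c *: x + y) = c *: u x + u y.
Proof.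
move=> su c x y; apply: adj_faithful => z.
by rewrite su !cstar_adjD !cstar_adjZ !cstar_mulDl !mulZx !su.
Qed.

Lemma saD u : sa u -> forall x y, u (x + y) = u x + u y.
Proof. by move=> su x y; rewrite -{1}[x]scale1r sa_lin// scale1r. Qed.

Lemma sa0 u : sa u -> u 0 = 0.
Proof. by move=> su; have := saD su 0 0; rewrite addr0 -[X in X = _]addr0 => /addrI. Qed.

Lemma saZ u : sa u -> forall (c : R[i]) x, u (c *: x) = c *: u x.
Proof. by move=> su c x; rewrite -[c *: x]addr0 sa_lin// sa0// addr0. Qed.

Lemma saN u : sa u -> forall x, u (- x) = - u x.
Proof. by move=> su x; rewrite -scaleN1r saZ// scaleN1r. Qed.

Lemma saB u : sa u -> forall x y, u (x - y) = u x - u y.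
Proof. by move=> su x y; rewrite saD// saN. Qed.

Lemma sa_mulr u : sa u -> forall x y, u (x ** y) = u x ** y.
Proof.
move=> su x y; apply: adj_faithful => z.
by rewrite su !cstar_adjM -!cstar_mulA su.
Qed.

Lemma sa_id : sa id. Proof. by []. Qed.

Lemma sa_add u v : sa u -> sa v -> sa (fun x => u x + v x).
Proof. by move=> su sv x y; rewrite cstar_adjD cstar_mulDl su sv cstar_mulDr. Qed.

Lemma sa_scale (a : R) u : sa u -> sa (fun x => a%:C *: u x).
Proof. by move=> su x y; rewrite adjZr mulZx su mulxZ. Qed.

Lemma sa_sub u v : sa u -> sa v -> sa (fun x => u x - v x).
Proof. by move=> su sv x y; rewrite adjB mulBx su sv mulxB. Qed.

Lemma sa_comp u v : sa u -> sa v -> opcomm u v -> sa (u \o v).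
Proof. by move=> su sv uv x y; rewrite /= su sv -uv. Qed.

Lemma sa_lim (un : nat -> A -> A) u : (forall n, sa (un n)) ->
  (forall x, nlim (fun n => un n x) (u x)) -> sa u.
Proof.
move=> sn lu x y.
have h1 : nlim (fun n => (un n x)^# ** y) ((u x)^# ** y).
  apply: (nlim_map (f := fun a => a^# ** y) (M := nr y)) (lu x) => a b.
  by rewrite -mulBx -adjB (le_trans (nrM _ _))// nr_adj mulrC.
have h2 : nlim (fun n => x^# ** un n y) (x^# ** u y).
  apply: (nlim_map (f := fun a => x^# ** a) (M := nr x)) (lu y) => a b.
  by rewrite -mulxB (le_trans (nrM _ _))// nr_adj.
by apply: nlim_uniq h1 _; rewrite (_ : (fun n => _) = (fun n => x^# ** un n y))//; apply/funext => n; rewrite sn.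
Qed.

Lemma opb_lip u M : sa u -> opb u M -> forall x y, nr (u x - u y) <= M * nr (x - y).
Proof. by move=> su bu x y; rewrite -saB. Qed.

Lemma opb_ge u M M' : M <= M' -> opb u M -> opb u M'.
Proof. by move=> MM bu x; rewrite (le_trans (bu x))// ler_wpM2r// nr_ge0. Qed.

Lemma bsa_pos u : bsa u -> exists2 M, 0 < M & opb u M.
Proof.
move=> [_ [M bM]]; exists (`|M| + 1); first by rewrite ltr_wpDl.
by apply: opb_ge bM; rewrite (le_trans (ler_norm _))// lerDl.
Qed.

Lemma bsa_id : bsa id.
Proof. by split; [exact: sa_id | exists 1 => x; rewrite mul1r]. Qed.

Lemma bsa_add u v : bsa u -> bsa v -> bsa (fun x => u x + v x).
Proof.
move=> [su [M uM]] [sv [N vN]]; split; first exact: sa_add.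
by exists (M + N) => x; rewrite (le_trans (nrD _ _))// mulrDl lerD.
Qed.

Lemma bsa_scale (a : R) u : bsa u -> bsa (fun x => a%:C *: u x).
Proof.
move=> [su [M uM]]; split; first exact: sa_scale.
by exists (`|a| * M) => x; rewrite nrZ -mulrA ler_wpM2l.
Qed.

Lemma bsa_sub u v : bsa u -> bsa v -> bsa (fun x => u x - v x).
Proof.
move=> bu /(bsa_scale (-1)) bv; have := bsa_add bu bv.
by under eq_fun do rewrite rmorphN1 scaleN1r.
Qed.

Lemma bsa_comp u v : bsa u -> bsa v -> opcomm u v -> bsa (u \o v).
Proof.
move=> bu bv uv; have [M M0 uM] := bsa_pos bu; case: bu bv => su _ [sv [N vN]].
split; first exact: sa_comp.
by exists (M * N) => x /=; rewrite (le_trans (uM _))// -mulrA ler_wpM2l// ltW.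
Qed.

(** The operator [p(u)]; real coefficients keep it self-adjoint. *)
Definition act p u x : A := \sum_(i < size p) (p`_i)%:C *: iter i u x.

Lemma act_widen n p u x : (size p <= n)%N ->
  act p u x = \sum_(i < n) (p`_i)%:C *: iter i u x.
Proof.
move=> pn; rewrite /act (big_ord_widen n (fun i => (p`_i)%:C *: iter i u x))//.
rewrite big_mkcond /=; apply: eq_bigr => i _; case: ltnP => // ?.
by rewrite nth_default// scale0r.
Qed.

Lemma actD p q u x : act (p + q) u x = act p u x + act q u x.
Proof.
rewrite !(@act_widen (maxn (size p) (size q))) ?leq_maxl ?leq_maxr ?size_polyD//.
by rewrite -big_split; apply: eq_bigr => i _; rewrite coefD rmorphD scalerDl.
Qed.

Lemma actZ (a : R) p u x : act (a *: p) u x = a%:C *: act p u x.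
Proof.
rewrite (@act_widen (size p)) ?size_scale_leq// scaler_sumr.
by apply: eq_bigr => i _; rewrite coefZ rmorphM scalerA.
Qed.

Lemma act0 u x : act 0 u x = 0.
Proof. by rewrite /act size_poly0 big_ord0. Qed.

Lemma actB p q u x : act (p - q) u x = act p u x - act q u x.
Proof. by rewrite -scaleN1r actD actZ rmorphN1 scaleN1r. Qed.

Lemma actC (a : R) u x : act a%:P u x = a%:C *: x.
Proof. by rewrite (@act_widen 1) ?size_polyC_leq1// big_ord1 coefC. Qed.

Lemma act1 u x : act 1 u x = x.
Proof. by rewrite actC scale1r. Qed.

Lemma actMX p u x : sa u -> act (p * 'X) u x = u (act p u x).
Proof.
move=> su; rewrite (@act_widen (size p).+1); last first.
  by rewrite (leq_trans (size_polyMleq _ _))// size_polyX addn2.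
rewrite big_ord_recl coefMX /= scale0r add0r.
have -> : u (act p u x) = \sum_(i < size p) u ((p`_i)%:C *: iter i u x).
  by rewrite /act; elim/big_rec2: _ => [|i y1 y2 _ <-]; rewrite ?sa0 ?saD.
by apply: eq_bigr => i _; rewrite coefMX /= saZ.
Qed.

Lemma actM p q u x : sa u -> act (p * q) u x = act p u (act q u x).
Proof.
move=> su; elim/poly_ind: p => [|p c IH]; first by rewrite mul0r !act0.
rewrite mulrDl mulrAC !actD !actMX// IH; congr (_ + _).
by rewrite mul_polyC actZ actC.
Qed.

Lemma actX u x : sa u -> act 'X u x = u x.
Proof. by move=> su; rewrite -['X]mul1r actMX// act1. Qed.

Lemma act_bsa p u : bsa u -> bsa (act p u).
Proof.
move=> bu; elim/poly_ind: p => [|p c IH].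
  rewrite (_ : act 0 u = fun=> 0); last by apply/funext => x; rewrite act0.
  split; first by move=> x y; rewrite adj0 mul0x mulx0.
  by exists 0 => x; rewrite nr0 mul0r.
rewrite (_ : act _ u = fun x => (u \o act p u) x + c%:C *: x); last first.
  by apply/funext => x; rewrite actD actMX ?actC//; case: bu.
apply: (bsa_add _ (bsa_scale c bsa_id)); apply: bsa_comp => // x.
by case: bu => su _; rewrite -(actMX p x su) actM// actX.
Qed.

Lemma opcommC u v : opcomm u v -> opcomm v u.
Proof. by move=> h x; rewrite h. Qed.

Lemma act_comm p u v : sa u -> sa v -> opcomm v u -> opcomm v (act p u).
Proof.
move=> su sv vu x; elim/poly_ind: p x => [|p c IH] x; first by rewrite !act0 sa0.
by rewrite !actD !actMX// !actC saD// vu IH saZ.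
Qed.

Definition nonneg_poly p := forall i, 0 <= p`_i.

Lemma nonneg_polyD p q : nonneg_poly p -> nonneg_poly q -> nonneg_poly (p + q).
Proof. by move=> hp hq i; rewrite coefD addr_ge0. Qed.

Lemma nonneg_polyM p q : nonneg_poly p -> nonneg_poly q -> nonneg_poly (p * q).
Proof. by move=> hp hq i; rewrite coefM sumr_ge0// => j _; rewrite mulr_ge0. Qed.

Lemma nonneg_polyZ (a : R) p : 0 <= a -> nonneg_poly p -> nonneg_poly (a *: p).
Proof. by move=> a0 hp i; rewrite coefZ mulr_ge0. Qed.

Lemma act_nonneg_bound p u : nonneg_poly p -> opb u 1 -> opb (act p u) p.[1].
Proof.
move=> hp bu x; rewrite horner_coef mulr_suml /act.
have h i : nr (iter i u x) <= nr x.
  by elim: i => // i /(le_trans _)-> //=; rewrite -[leRHS]mul1r.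
elim/big_rec2: _ => [|i y1 y2 _ hy]; first by rewrite nr0.
rewrite (le_trans (nrD _ _))// lerD//.
by rewrite nrZ_ge0// expr1n mulr1 ler_wpM2l.
Qed.

(* [sqrt_poly n] increases to [1 - sqrt (1 - X)]: Picard iteration of
   [e = (X + e ^ 2) / 2]. *)
Fixpoint sqrt_poly (n : nat) : {poly R} :=
  if n is n'.+1 then 2^-1 *: ('X + sqrt_poly n' ^+ 2) else 0.

Lemma sqrt_poly_nonneg n : nonneg_poly (sqrt_poly n).
Proof.
elim: n => [|n IH] /=; first by move=> i; rewrite coef0.
apply: nonneg_polyZ; first by rewrite invr_ge0 ler0n.
apply: nonneg_polyD; first by move=> i; rewrite coefX; case: eqP.
by rewrite expr2; apply: nonneg_polyM.
Qed.

(** The recursion gives [e_(n+2) - e_(n+1) = (e_(n+1) - e_n) (e_(n+1) + e_n) / 2], a product of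
    polynomials with nonnegative coefficients. *)
Lemma sqrt_poly_incr n : nonneg_poly (sqrt_poly n.+1 - sqrt_poly n).
Proof.
elim: n => [|n IH]; first by rewrite subr0; exact: sqrt_poly_nonneg.
rewrite (_ : _ - _ = 2^-1 *: ((sqrt_poly n.+1 - sqrt_poly n) *
  (sqrt_poly n.+1 + sqrt_poly n))); last first.
  rewrite [sqrt_poly n.+2]/= [in X in _ - X]/=.
  rewrite -scalerBr; congr (_ *: _); rewrite -subr_sqr.
  by rewrite opprD addrACA subrr add0r.
apply: nonneg_polyZ; first by rewrite invr_ge0 ler0n.
by apply: nonneg_polyM => //; apply: nonneg_polyD; exact: sqrt_poly_nonneg.
Qed.

Lemma sqrt_poly_le m n : (m <= n)%N -> nonneg_poly (sqrt_poly n - sqrt_poly m).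
Proof.
move=> /subnK <-; elim: (n - m)%N => [|k IH] i; first by rewrite add0n subrr coef0.
rewrite addSn -[sqrt_poly _.+1](subrK (sqrt_poly (k + m))) -addrA coefD addr_ge0//.
exact: sqrt_poly_incr.
Qed.

Lemma sqrt_poly1_le1 n : (sqrt_poly n).[1] <= 1.
Proof.
elim: n => [|n IH] /=; first by rewrite horner0.
rewrite hornerZ hornerD hornerX horner_exp.
have h0 : 0 <= (sqrt_poly n).[1].
  rewrite horner_coef sumr_ge0// => i _; rewrite mulr_ge0 ?exprn_ge0//.
  exact: sqrt_poly_nonneg.
nra.
Qed.

Lemma sqrt_poly1_cauchy (e : R) : 0 < e -> exists N, forall m n,
  (N <= m <= n)%N -> (sqrt_poly n - sqrt_poly m).[1] < e.
Proof.
move=> e0; pose a n := (sqrt_poly n).[1].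
have a_incr : {homo a : n m / (n <= m)%N >-> n <= m}.
  move=> m n /sqrt_poly_le h; rewrite -subr_ge0 -hornerN -hornerD horner_coef.
  by rewrite sumr_ge0// => i _; rewrite expr1n mulr1.
have /cvg_ex[l /cvgrPdist_lt/(_ (e / 2)) hl] : cvgn a.
  apply: nondecreasing_is_cvgn => //; exists 1 => _ [n _ <-].
  exact: sqrt_poly1_le1.
have [|N _ hN] := hl; first by rewrite divr_gt0.
exists N => m n /andP[Nm mn]; rewrite hornerD hornerN.
have := hN _ Nm; have := hN _ (leq_trans Nm mn); rewrite /a !ltr_norml.
by move=> /andP[? ?] /andP[? ?]; lra.
Qed.

(** The strong limit [E] of the [sqrt_poly n] at [z] satisfies [E = (z + E^2) / 2], so
    [(1 - E)^2 = 1 - z]. Commutation with [z] survives the limit; the last clause makes square roots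
    of commuting operators commute. *)
Lemma op_sqrt (z : A -> A) : sa z -> opb z 1 -> exists r, [/\ bsa r,
  forall x, r (r x) = x - z x &
  forall v, bsa v -> opcomm v z -> opcomm v r].
Proof.
move=> sz bz; have bsz : bsa z by split; [|exists 1].
pose e n := act (sqrt_poly n) z.
have be n : opb (e n) 1.
  apply: opb_ge (sqrt_poly1_le1 n) _; apply: act_nonneg_bound => //.
  exact: sqrt_poly_nonneg.
have se n : sa (e n) by have [] := act_bsa (sqrt_poly n) bsz.
have /choice[E hE] : forall x, exists l, nlim (fun n => e n x) l.
  move=> x; apply: nlim_cauchy => d d0.
  have M0 : 0 < nr x + 1 by rewrite ltr_wpDl// nr_ge0.
  have [N hN] := sqrt_poly1_cauchy (divr_gt0 d0 M0); exists N.
  have H m n : (N <= m)%N -> (m <= n)%N -> nr (e m x - e n x) < d.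
    move=> Nm mn; rewrite nrBC -actB.
    have := act_nonneg_bound (sqrt_poly_le mn) bz x; move/le_lt_trans; apply.
    have h1 := hN m n; rewrite Nm mn in h1.
    apply: le_lt_trans (_ : _ <= (sqrt_poly n - sqrt_poly m).[1] * (nr x + 1)) _.
      rewrite ler_wpM2l ?lerDl// horner_coef sumr_ge0// => i _.
      by rewrite expr1n mulr1; exact: sqrt_poly_le.
    by rewrite -ltr_pdivlMr//; exact: h1.
  by move=> m n Nm Nn; case: (leqP m n) => [/H|/ltnW/H]; [apply|rewrite nrBC; apply].
have sE : sa E by apply: sa_lim se hE.
have bE : opb E 1 by move=> x; apply: nlim_le (hE x) _ => n; exact: be.
have EE x : E x = 2^-1%:C *: (z x + E (E x)).
  apply: (nlim_uniq (u := fun n => e n.+1 x)).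
    by move=> d /(hE x)[N hN]; exists N => n /leqW; exact: hN.
  rewrite (_ : (fun n => _) = (fun n => 2^-1%:C *: (z x + e n (e n x)))); last first.
    by apply/funext => n; rewrite /e /= actZ actD actX// expr2 actM.
  apply: (nlim_map (f := fun a => 2^-1%:C *: (z x + a)) (M := 2^-1)).
    move=> a b; rewrite -scalerBr nrZ_ge0 ?invr_ge0 ?ler0n// ler_wpM2l ?invr_ge0 ?ler0n//.
    by rewrite opprD addrACA subrr add0r.
  have h1 := hE (E x).
  move=> d d0; have d20 : 0 < d / 2 by rewrite divr_gt0.
  have [N1 hN1] := h1 _ d20; have [N2 hN2] := hE x _ d20.
  exists (maxn N1 N2) => n; rewrite geq_max => /andP[/hN1 a1 /hN2 a2].
  apply: le_lt_trans (nr_dist _ (e n (E x)) _) _.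
  have := opb_lip (se n) (be n) (e n x) (E x); lra.
exists (fun x => x - E x); split.
- by apply: (bsa_sub bsa_id); split; [|exists 1].
- move=> x; rewrite saB// opprB [E (E x)](_ : _ = 2%:C *: E x - z x); last first.
    rewrite [in X in _ *: X]EE scalerA -rmorphM divff ?pnatr_eq0// scale1r.
    by rewrite addrC addKr.
  rewrite -[2%:C]/((1 + 1)%:C) rmorphD scalerDl scale1r.
  by rewrite [_ - z x - E x]addrAC addrK addrA subrK.
- move=> v [sv [M bM]] vz x; rewrite saB//; congr (_ - _).
  apply: (nlim_uniq (u := fun n => v (e n x))).
    by apply: nlim_map (hE x); exact: (opb_lip sv bM).
  rewrite (_ : (fun n => _) = (fun n => e n (v x))); first exact: hE.
  by apply/funext => n; rewrite (act_comm (sqrt_poly n) sz sv vz).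
Qed.

End Operators.

(** * Positive operators and their square roots *)

Section Positive.
Variables (R : realType) (A : cstarAlgType R).
Implicit Types (u v w r s : A -> A) (x y z : A) (p q : {poly R}).

(* [r + i s] is then unitary. *)
Lemma sum_sqr_contract r s : sa r -> sa s -> opcomm r s ->
  (forall x, r (r x) + s (s x) = x) -> opb r 1.
Proof.
move=> sr ss rs h x.
have iso (c : R[i]) : Num.conj c = - c -> Num.conj c * c = 1 ->
    nr (r x + c *: s x) = nr x.
  move=> cN c1; apply/eqP; rewrite -(eqrXn2 (n := 2)) ?nr_ge0// -!nr_cstar; apply/eqP.
  congr nr; rewrite cstar_adjD cstar_adjZ cstar_mulDl !cstar_mulDr !mulZx !mulxZ.
  rewrite !sr !ss scalerA c1 scale1r cN rs scaleNr addrA addrK -cstar_mulDr.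
  by rewrite h.
have [c cN c1] : exists2 c : R[i], Num.conj c = - c & Num.conj c * c = 1.
  by exists 'i%R; rewrite ?mulNr conjCi ?mulNr -?expr2 ?sqrCi ?opprK.
have h1 := iso c cN c1.
have h2 : nr (r x + - c *: s x) = nr x.
  by rewrite -cN; apply: iso; rewrite conjCK ?cN ?opprK// -cN mulrC.
(* [r] is the mean of the isometries [r + i s] and [r - i s]. *)
have : r x = 2^-1%:C *: ((r x + c *: s x) + (r x + - c *: s x)).
  rewrite scaleNr addrACA subrr addr0 -[X in X + _]scale1r -[X in _ + X]scale1r -scalerDl scalerA.
  by rewrite -(rmorphD (real_complex R) 1 1) -rmorphM mulVf ?pnatr_eq0// scale1r.
move=> ->; rewrite nrZ_ge0 ?invr_ge0 ?ler0n//.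
by have := nrD (r x + c *: s x) (r x + - c *: s x); rewrite h1 h2; lra.
Qed.

(* [||M - u|| <= M] for some [M] is positivity, phrased without the spectrum. *)
Definition pos u := sa u /\ exists2 M, 0 < M & opb (fun x => M%:C *: x - u x) M.

Lemma pos_bsa u : pos u -> bsa u.
Proof.
move=> [su [M M0 hM]]; split=> //; exists (M + M) => x.
rewrite -[u x](subKr (M%:C *: x)) (le_trans (nrB _ _))// mulrDl lerD//.
by rewrite (nrZ_ge0 _ (ltW M0)).
Qed.

(** With [r] a square root of [1 - w^2], the equation [r^2 + w^2 = 1] makes [r] a contraction, hence
    also [r^2]. *)
Lemma opb1_sub_sqr w : bsa w -> opb w 1 -> opb (fun x => x - w (w x)) 1.
Proof.
move=> bw w1; have sw := bw.1.
have ww : bsa (w \o w) by apply: bsa_comp.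
have [|r [[sr _] rr rc]] := op_sqrt ww.1.
  by move=> x /=; rewrite mul1r (le_trans (w1 _))// mul1r -[leRHS]mul1r.
have rw : opcomm w r by apply: rc.
have r1 : opb r 1.
  by apply: (sum_sqr_contract sr sw (opcommC rw)) => x; rewrite rr subrK.
by move=> x; rewrite -rr mul1r (le_trans (r1 _))// mul1r -[leRHS]mul1r.
Qed.

Lemma pos_scale (a : R) u : 0 < a -> pos u -> pos (fun x => a%:C *: u x).
Proof.
move=> a0 [su [M M0 hM]]; split; first exact: sa_scale.
exists (a * M) => [|x]; first by rewrite mulr_gt0.
by rewrite rmorphM -scalerA -scalerBr (nrZ_ge0 _ (ltW a0)) -mulrA ler_pM2l.
Qed.

Lemma pos_scaled (a : R) u : 0 < a -> pos (fun x => a%:C *: u x) -> pos u.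
Proof.
move=> a0 h; rewrite (_ : u = fun x => a^-1%:C *: (a%:C *: u x)).
  by apply: pos_scale => //; rewrite invr_gt0.
by apply/funext => x; rewrite scalerA -rmorphM mulVf ?gt_eqF// scale1r.
Qed.

Lemma pos_sqr w : bsa w -> pos (w \o w).
Proof.
move=> bw; have [M M0 wM] := bsa_pos bw.
have bw1 : bsa (fun x => M^-1%:C *: w x) by apply: bsa_scale.
have h : opb (fun x => x - M^-1%:C *: w (M^-1%:C *: w x)) 1.
  apply: (opb1_sub_sqr bw1) => x; rewrite nrZ_ge0 ?invr_ge0 ?(ltW M0)//.
  by rewrite mul1r ler_pdivrMl.
apply: (@pos_scaled (M^-1 * M^-1)); first by rewrite mulr_gt0// invr_gt0.
split; first by apply/sa_scale/sa_comp => //; exact: bw.1.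
by exists 1 => // x; have := h x; rewrite scale1r (saZ bw.1) scalerA -rmorphM.
Qed.

Lemma pos_sqrt u : pos u -> exists r, [/\ bsa r, forall x, r (r x) = u x &
  forall v, bsa v -> opcomm v u -> opcomm v r].
Proof.
move=> [su [M M0 hM]].
pose z x := x - M^-1%:C *: u x.
have sz : sa z by apply: sa_sub => //; exact: sa_scale.
have bz : opb z 1.
  move=> x; rewrite mul1r -(ler_pM2l M0) -(nrZ_ge0 _ (ltW M0)).
  by rewrite scalerBr scalerA -rmorphM mulfV ?gt_eqF// scale1r.
have [r [br rr rc]] := op_sqrt sz bz.
exists (fun x => (Num.sqrt M)%:C *: r x); split.
- exact: bsa_scale.
- move=> x; rewrite (saZ br.1) scalerA -rmorphM -expr2 sqr_sqrtr ?ltW// rr /z.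
  by rewrite opprB addrC subrK scalerA -rmorphM mulfV ?gt_eqF// scale1r.
- move=> v bv vu x; rewrite (saZ bv.1) rc// => y.
  by rewrite /z (saB bv.1) (saZ bv.1) vu.
Qed.

Lemma pos_add u v : pos u -> pos v -> pos (fun x => u x + v x).
Proof.
move=> [su [M M0 hM]] [sv [N N0 hN]]; split; first exact: sa_add.
exists (M + N) => [|x]; first by rewrite addr_gt0.
by rewrite rmorphD scalerDl opprD addrACA (le_trans (nrD _ _))// mulrDl lerD.
Qed.

Lemma pos_zero : pos (fun=> 0).
Proof.
split; first by move=> x y; rewrite adj0 mul0x mulx0.
by exists 1 => // x; rewrite subr0 scale1r mul1r.
Qed.

Lemma pos_id : pos id.
Proof. exact: (pos_sqr (@bsa_id R A)). Qed.

(** The square roots [r] and [s] commute, so [u v = (r s)^2]. *)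
Lemma pos_mul u v : pos u -> pos v -> opcomm u v -> pos (u \o v).
Proof.
move=> pu pv uv; have bu := pos_bsa pu; have bv := pos_bsa pv.
have [r [br rr rc]] := pos_sqrt pu; have [s [bs ss sc]] := pos_sqrt pv.
have vr : opcomm v r by apply: rc => // x; rewrite uv.
have rs : opcomm r s by apply: sc => // x; rewrite vr.
rewrite (_ : u \o v = (r \o s) \o (r \o s)).
  by apply: pos_sqr; apply: bsa_comp.
by apply/funext => x /=; rewrite -rr -ss -rs.
Qed.

(** Order bounds become norm bounds: for [w = u / D] the product [(1 - w) (1 + w) = 1 - w^2] is
    positive, its square root [s] commutes with [w], and [w^2 + s^2 = 1] makes [w] a contraction. *)
Lemma pos_opb (D : R) u : 0 < D -> pos (fun x => D%:C *: x - u x) ->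
  pos (fun x => D%:C *: x + u x) -> sa u -> opb u D.
Proof.
move=> D0 h1 h2 su.
pose w x := D^-1%:C *: u x.
have sw : sa w by exact: sa_scale.
have D'0 : 0 < D^-1 by rewrite invr_gt0.
have bu : bsa u.
  have := bsa_sub (pos_bsa h2) (bsa_scale D (@bsa_id R A)).
  by congr bsa; apply/funext => x; rewrite addrAC subrr add0r.
have bw : bsa w by exact: bsa_scale.
have eqw (e : R) x : D^-1%:C *: (D%:C *: x + e%:C *: u x) = x + e%:C *: w x.
  rewrite scalerDr scalerA -rmorphM mulVf ?gt_eqF// scale1r /w !scalerA -!rmorphM.
  by rewrite mulrC.
have p1 : pos (fun x => x - w x).
  have := pos_scale D'0 h1; congr pos; apply/funext => x.
  by have := eqw (-1) x; rewrite rmorphN1 !scaleN1r.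
have p2 : pos (fun x => x + w x).
  have := pos_scale D'0 h2; congr pos; apply/funext => x.
  by have := eqw 1 x; rewrite !scale1r.
have p12 : pos (fun x => x - w (w x)).
  have -> : (fun x => x - w (w x)) = (fun x => x - w x) \o (fun x => x + w x).
    apply/funext => x /=; rewrite (saD sw) opprD addrA [x + w x - w x]addrK.
    by [].
  apply: pos_mul => // x; rewrite (saD sw) (saB sw) opprD !addrA.
  by rewrite addrK subrK.
have [s [bs ss sc]] := pos_sqrt p12.
have ws : opcomm w s.
  by apply: sc => // x; rewrite (saB sw).
have w1 : opb w 1.
  by apply: (sum_sqr_contract sw bs.1 ws) => x; rewrite ss addrC subrK.
move=> x; rewrite -ler_pdivrMl//.
by have := w1 x; rewrite mul1r /w (nrZ_ge0 _ (ltW D'0)).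
Qed.

End Positive.

(** * Bernstein polynomials and functional calculus *)

Section Bernstein.
Variables (R : realType).
Implicit Types (n m k l : nat).

Definition bern n k : {poly R} := 'C(n, k)%:R *: ('X^k * (1 - 'X) ^+ (n - k)).

(** The grid point [k / n] of [0, 1] moved to [-1, 1] by [t = 2 s - 1]: functions live on [-1, 1],
    while the Bernstein weights are evaluated at [(1 + h) / 2]. *)
Definition node n k : R := k%:R / n%:R *+ 2 - 1.

Lemma bern_sum n : \sum_(k < n.+1) bern n k = 1.
Proof.
have := exprDn (1 - 'X : {poly R}) 'X n; rewrite subrK expr1n => ->.
by apply: eq_bigr => i _; rewrite /bern scaler_nat mulrC.
Qed.

(** From [k C(n + 1, k) = (n + 1) C(n, k - 1)]; the choices [f k = 1] and [f k = k] give the first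
    two moments. *)
Lemma bern_shift n (f : nat -> R) :
  \sum_(k < n.+2) (f k * k%:R) *: bern n.+1 k =
  n.+1%:R *: ('X * \sum_(k < n.+1) f k.+1 *: bern n k).
Proof.
rewrite big_ord_recl mulr0 scale0r add0r mulr_sumr scaler_sumr.
apply: eq_bigr => i _; rewrite /bern /= /bump leq0n add1n subSS.
rewrite exprS -!scalerAr !scalerA -!mulrA; congr (_ *: _).
by rewrite [RHS]mulrCA -!natrM -mul_bin_diag.
Qed.

Definition dbl : {poly R} := 'X *+ 2 - 1.

Lemma bern_moment1 n :
  \sum_(k < n.+2) k%:R *: bern n.+1 k = n.+1%:R *: 'X.
Proof.
have := bern_shift n (fun=> 1).
under eq_bigr do rewrite mul1r.
by under [X in _ = _ *: (_ * X)]eq_bigr do rewrite scale1r; rewrite bern_sum mulr1.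
Qed.

Lemma bern_moment2 n : \sum_(k < n.+2) k%:R ^+ 2 *: bern n.+1 k =
  n.+1%:R *: ('X * (n%:R *: 'X + 1)).
Proof.
have := bern_shift n (fun k => k%:R).
under eq_bigr do rewrite -expr2.
move=> ->; congr (_ *: (_ * _)).
under eq_bigr do rewrite -natr1 scalerDl scale1r.
rewrite big_split /= bern_sum; congr (_ + _).
case: n => [|n]; last by rewrite bern_moment1.
by rewrite big_ord1 !scale0r.
Qed.

Lemma bern_mean n : \sum_(k < n.+2) node n.+1 k *: bern n.+1 k = dbl.
Proof.
under eq_bigr => k _ do rewrite /node scalerBl scale1r -mulrnAr mulrC -scalerA.
rewrite sumrB bern_sum; congr (_ - _); rewrite -scaler_sumr.
rewrite bern_moment1 scalerA.
by rewrite mulrnAl mulVf ?pnatr_eq0// scaler_nat.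
Qed.

(** The square of the mean [dbl] plus the variance of the nodes, which is
    [4 x (1 - x) = 1 - (2 x - 1)^2] divided by the degree. *)
Lemma bern_var n : \sum_(k < n.+2) node n.+1 k ^+ 2 *: bern n.+1 k =
  dbl ^+ 2 + n.+1%:R^-1 *: (1 - dbl ^+ 2).
Proof.
pose c : R := n.+1%:R^-1.
have nc : n.+1%:R * c = 1 by rewrite mulfV// pnatr_eq0.
have -> : \sum_(k < n.+2) node n.+1 k ^+ 2 *: bern n.+1 k =
    \sum_(k < n.+2) ((c ^+ 2 *+ 4) *: (k%:R ^+ 2 *: bern n.+1 k)
     - (c *+ 4) *: (k%:R *: bern n.+1 k) + bern n.+1 k).
  apply: eq_bigr => k _; move: (bern _ _) => B; rewrite !scalerA -scalerBl.
  rewrite -[X in _ = _ + X]scale1r -scalerDl.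
  by congr (_ *: _); rewrite /node -/c; ring.
rewrite big_split sumrB /= -!scaler_sumr bern_sum bern_moment1 bern_moment2 /dbl.
have NC : (n%:R + 1) * c%:P = 1 :> {poly R}.
  by rewrite natr1 -(rmorph_nat (polyC : {rmorphism R -> {poly R}})) -rmorphM nc.
rewrite -!mul_polyC !polyCMn !rmorphXn /= polyC1 -/c -natr1.
move: NC; move: (n%:R) (c%:P) => N C NC; apply/subr0_eq.
transitivity (((N + 1) * C - 1) *
  (C *+ 4 * 'X * (N * 'X + 1) - 'X *+ 4 + 'X ^+ 2 *+ 4)); first by ring.
by rewrite NC subrr mul0r.
Qed.

Lemma node_itv n k : (k <= n.+1)%N -> `|node n.+1 k| <= 1.
Proof.
move=> kn; have : 0 <= (k%:R / n.+1%:R : R) <= 1.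
  by rewrite divr_ge0// ler_pdivrMr ?ltr0n// mul1r ler_nat.
rewrite /node ler_norml; move: (_ / _) => t /andP[t0 t1].
by apply/andP; split; rewrite mulr2n; lra.
Qed.

(** Two independent nodes with the same mean [dbl]: the variances add up. *)
Lemma bern2_var n m : \sum_(k < n.+2) \sum_(l < m.+2)
    (node n.+1 k - node m.+1 l) ^+ 2 *: (bern n.+1 k * bern m.+1 l) =
  (n.+1%:R^-1 + m.+1%:R^-1) *: (1 - dbl ^+ 2).
Proof.
pose x k := node n.+1 k; pose y l := node m.+1 l.
transitivity (\sum_(k < n.+2) \sum_(l < m.+2)
   ((x k ^+ 2 *: bern n.+1 k) * bern m.+1 l
    + bern n.+1 k * (y l ^+ 2 *: bern m.+1 l)
    - ((x k *: bern n.+1 k) * (y l *: bern m.+1 l)) *+ 2)).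
  apply: eq_bigr => k _; apply: eq_bigr => l _.
  rewrite -/(x k) -/(y l); move: (bern _ _) (bern _ _) => B B'.
  by rewrite -!mul_polyC !rmorphXn /= rmorphB /=; ring.
have prodE (F : 'I_n.+2 -> {poly R}) (G : 'I_m.+2 -> {poly R}) : \sum_(k < n.+2) \sum_(l < m.+2) F k * G l =
    (\sum_(k < n.+2) F k) * \sum_(l < m.+2) G l.
  by rewrite mulr_suml; apply: eq_bigr => k _; rewrite mulr_sumr.
under eq_bigr do rewrite sumrB big_split /=.
rewrite sumrB big_split /=.
under [X in _ - X]eq_bigr do rewrite sumrMnl.
rewrite sumrMnl !prodE !bern_sum !bern_var !bern_mean.
rewrite mulr1 mul1r scalerDl mulr2n -expr2.
by rewrite addrACA [LHS]addrAC subrr add0r.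
Qed.

Lemma bern2_sum n m : \sum_(k < n.+2) \sum_(l < m.+2) (bern n.+1 k * bern m.+1 l) = 1.
Proof.
under eq_bigr do rewrite -mulr_sumr bern_sum mulr1.
exact: bern_sum.
Qed.

End Bernstein.

Section BernsteinBound.
Variables (R : realType) (A : cstarAlgType R) (h : A).
Hypotheses (hadj : h^# = h) (hle : nr h <= 1).
Implicit Types (p q : {poly R}).

(** The operator [(1 + h) / 2]. For self-adjoint [h] with [|h| <= 1] it lies between 0 and 1, where
    the Bernstein weights are positive. *)
Definition half x : A := 2^-1%:C *: (x + h ** x).

Lemma half_sa : sa half.
Proof.
by apply: sa_scale; apply: sa_add; [exact: sa_id|move=> x y; rewrite cstar_adjM hadj cstar_mulA].
Qed.

Lemma lmul_opb : opb (cstar_mul h) 1.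
Proof. by move=> x; rewrite (le_trans (nrM _ _))// ler_wpM2r ?nr_ge0. Qed.

Lemma half_opb : opb half 1.
Proof.
move=> x; rewrite nrZ_ge0 ?invr_ge0// mul1r ler_pdivrMl//.
have := lmul_opb x; have := nrD x (h ** x); lra.
Qed.

Lemma half_bsa : bsa half.
Proof. by split; [exact: half_sa | exists 1; exact: half_opb]. Qed.

Definition posp p := pos (act p half).

Lemma pospD p q : posp p -> posp q -> posp (p + q).
Proof.
move=> hp hq; have := pos_add hp hq; congr pos.
by apply/funext => x; rewrite actD.
Qed.

Lemma posp0 : posp 0.
Proof.
by rewrite /posp (_ : act 0 _ = fun=> 0) //; [exact: pos_zero|apply/funext => x; rewrite act0].
Qed.

Lemma pospZ (a : R) p : 0 <= a -> posp p -> posp (a *: p).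
Proof.
rewrite le_eqVlt => /predU1P[<- _|a0 hp]; first by rewrite scale0r; exact: posp0.
have := pos_scale a0 hp; congr pos; apply/funext => x; exact/esym/actZ.
Qed.

Lemma posp_comm p q : opcomm (act p half) (act q half).
Proof. by move=> x; rewrite -(actM p q x half_sa) -(actM q p x half_sa) mulrC. Qed.

Lemma pospM p q : posp p -> posp q -> posp (p * q).
Proof.
move=> hp hq; have := pos_mul hp hq (posp_comm p q); congr pos.
by apply/funext => x /=; exact/esym/actM/half_sa.
Qed.

Lemma posp_sqr p : posp (p ^+ 2).
Proof.
have := pos_sqr (act_bsa p half_bsa); congr pos.
by apply/funext => x /=; rewrite expr2; exact/esym/actM/half_sa.
Qed.

Lemma posp1 : posp 1.
Proof. by rewrite -(expr1n _ 2); exact: posp_sqr. Qed.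

Lemma posp_exp p n : posp p -> posp (p ^+ n).
Proof.
by move=> hp; elim: n => [|n IH]; [exact: posp1|rewrite exprS; exact: pospM].
Qed.

Lemma posp_sum (I : Type) (r : seq I) (F : I -> {poly R}) :
  (forall i, posp (F i)) -> posp (\sum_(i <- r) F i).
Proof. by move=> hF; elim/big_ind: _ => //; [exact: posp0 | exact: pospD]. Qed.

Lemma pospX : posp 'X.
Proof.
split; first exact: (act_bsa _ half_bsa).1.
exists 1 => // x; rewrite actX; last exact: half_sa.
have -> : 1%:C *: x - half x = 2^-1%:C *: (x - h ** x).
  rewrite /half -[x in 1%:C *: x]scale1r; rewrite scalerBr scalerDr opprD addrA; congr (_ - _).
  rewrite scalerA -scalerBl; congr (_ *: _).
  by rewrite -rmorphM -rmorphB; congr _%:C; lra.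
rewrite nrZ_ge0 ?invr_ge0// mul1r ler_pdivrMl//.
have := lmul_opb x; have := nrB x (h ** x); lra.
Qed.

Lemma posp1X : posp (1 - 'X).
Proof.
split; first exact: (act_bsa _ half_bsa).1.
exists 1 => // x; rewrite actB act1 actX; last exact: half_sa.
by rewrite scale1r subKr; exact: half_opb.
Qed.

Lemma posp_bern n k : posp (bern R n k).
Proof.
apply: pospZ; first exact: ler0n.
by apply: pospM; apply: posp_exp; [exact: pospX|exact: posp1X].
Qed.

(* The products [bern n k * bern m l] are positive and sum to [1], and the nodes
   have variance at most [1/n] and [1/m] for these weights. *)
Lemma bern2_bound n m (c : nat -> nat -> R) (al be : R) : 0 <= al -> 0 <= be ->
  (forall k l, (k < n.+2)%N -> (l < m.+2)%N ->
    `|c k l| <= al + be * (node R n.+1 k - node R m.+1 l) ^+ 2) ->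
  opb (act (\sum_(k < n.+2) \sum_(l < m.+2) c k l *: (bern R n.+1 k * bern R m.+1 l)) half)
    (al + 2 * be * (n.+1%:R^-1 + m.+1%:R^-1)).
Proof.
move=> al0 be0 hc x; set S := \sum_(k < _) _.
pose D := al + 2 * be * (n.+1%:R^-1 + m.+1%:R^-1).
pose d : R := n.+1%:R^-1 + m.+1%:R^-1.
have d0 : 0 <= d by rewrite addr_ge0// invr_ge0.
(* [D] may be 0, whereas [pos_opb] asks for a positive bound; the slack [e] is sent to 0. *)
suff H (e : R) : 0 < e -> opb (act S half) (D + e).
  apply/ler_addgt0Pr => e e0; have M0 : 0 < nr x + 1 by rewrite ltr_wpDl// nr_ge0.
  have := H _ (divr_gt0 e0 M0) x; move/le_trans; apply.
  by rewrite -/D mulrDl lerD2l mulrAC ler_pdivrMr// ler_wpM2l ?(ltW e0)// lerDl.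
move=> e0.
have key (c' : nat -> nat -> R) : (forall k l, (k < n.+2)%N -> (l < m.+2)%N ->
    c' k l <= al + be * (node R n.+1 k - node R m.+1 l) ^+ 2) ->
    posp ((D + e)%:P - \sum_(k < n.+2) \sum_(l < m.+2) c' k l *: (bern R n.+1 k * bern R m.+1 l)).
  move=> hc'; pose B k l := bern R n.+1 k * bern R m.+1 l.
  (* The variance uses up [be d (1 - dbl^2)] of the [2 be d] in [D]; what remains is
     [be d (1 + dbl^2)], which is positive. *)
  have -> : (D + e)%:P - \sum_(k < n.+2) \sum_(l < m.+2) c' k l *: (bern R n.+1 k * bern R m.+1 l) =
     \sum_(k < n.+2) \sum_(l < m.+2)
       (al + be * (node R n.+1 k - node R m.+1 l) ^+ 2 - c' k l) *: B k l
     + ((be * d) *: (1 + dbl R ^+ 2) + e *: 1).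
    under [X in _ = X + _]eq_bigr do
      (under eq_bigr do rewrite scalerBl scalerDl -scalerA; rewrite sumrB big_split /= -!scaler_sumr).
    rewrite sumrB big_split /= -!scaler_sumr bern2_sum bern2_var -/d.
    rewrite [RHS]addrAC; congr (_ - _).
    rewrite /D /d mulr_natl -!mul_polyC !(polyCD, polyCM); ring.
  apply: pospD.
    apply: posp_sum => k; apply: posp_sum => l; apply: pospZ.
      by rewrite subr_ge0 hc'.
    by apply: pospM; exact: posp_bern.
  apply: pospD; last by apply: pospZ; [exact: ltW|exact: posp1].
  apply: pospZ; first by rewrite mulr_ge0.
  by apply: pospD; [exact: posp1|exact: posp_sqr].
have D0 : 0 < D + e by rewrite ltr_wpDl// addr_ge0// !mulr_ge0.
apply: (pos_opb D0); last exact: (act_bsa _ half_bsa).1.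
  have := key c (fun k l kn lm => le_trans (ler_norm _) (hc k l kn lm)).
  by congr pos; apply/funext => y; rewrite actB actC.
have := key (fun k l => - c k l) _; rewrite /posp.
have -> : \sum_(k < n.+2) \sum_(l < m.+2) - c k l *: (bern R n.+1 k * bern R m.+1 l) = - S.
  rewrite /S -sumrN; apply: eq_bigr => k _; rewrite -sumrN; apply: eq_bigr => l _.
  by rewrite scaleNr.
rewrite opprK => H; have : pos (act ((D + e)%:P + S) half).
  apply: H => k l kn lm; apply: le_trans (hc k l kn lm).
  by rewrite -normrN ler_norm.
by congr pos; apply/funext => y; rewrite actD actC.
Qed.

End BernsteinBound.

(** * Lipschitz functions on [-1, 1] *)

Section LipschitzFunctions.
Variable R : realType.
Implicit Types f g : R -> R.

(** Lipschitz functions have explicit Bernstein error bounds and are stable under products, [max]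
    and [min], from which all cutoffs below are built. *)
Definition lip f := exists2 L, 0 <= L & forall s t, `|s| <= 1 -> `|t| <= 1 ->
  `|f s - f t| <= L * `|s - t|.

Lemma lip_cst (c : R) : lip (fun=> c).
Proof. by exists 0 => // s t _ _; rewrite subrr normr0 mul0r. Qed.

Lemma lip_id : lip id.
Proof. by exists 1 => // s t _ _; rewrite mul1r. Qed.

Lemma lip_abs f : lip f -> lip (fun t => `|f t|).
Proof.
move=> [L L0 h]; exists L => // s t s1 t1; apply: le_trans (h s t s1 t1).
exact: ler_dist_dist.
Qed.

Lemma lipD f g : lip f -> lip g -> lip (fun t => f t + g t).
Proof.
move=> [L L0 h] [M M0 k]; exists (L + M); first exact: addr_ge0.
move=> s t s1 t1; rewrite opprD addrACA (le_trans (ler_normD _ _))// mulrDl.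
by rewrite lerD ?h ?k.
Qed.

Lemma lip_bounded f : lip f -> exists2 M, 0 < M & forall t, `|t| <= 1 -> `|f t| <= M.
Proof.
move=> [L L0 h]; exists (L + `|f 0| + 1).
  by rewrite ltr_wpDl// addr_ge0.
move=> t t1; have := h t 0 t1; rewrite normr0 subr0 => /(_ ler01) h1.
have : L * `|t| <= L by rewrite ler_piMr.
have := ler_normD (f t - f 0) (f 0); rewrite subrK; lra.
Qed.

Lemma lipM f g : lip f -> lip g -> lip (fun t => f t * g t).
Proof.
move=> lf lg; have [M M0 hM] := lip_bounded lf; have [N N0 hN] := lip_bounded lg.
case: lf lg => [L L0 h] [K K0 k]; exists (L * N + M * K).
  by rewrite addr_ge0// mulr_ge0// ltW.
move=> s t s1 t1.
have -> : f s * g s - f t * g t = (f s - f t) * g s + f t * (g s - g t) by ring.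
rewrite (le_trans (ler_normD _ _))// !normrM mulrDl lerD//.
  by rewrite mulrAC ler_pM// ?h ?hN.
by rewrite -mulrA ler_pM// ?k ?hM.
Qed.

Lemma lipN f : lip f -> lip (fun t => - f t).
Proof.
move=> [L L0 h]; exists L => // s t s1 t1.
by rewrite -opprD normrN h.
Qed.

Lemma lipB f g : lip f -> lip g -> lip (fun t => f t - g t).
Proof. by move=> lf lg; apply: lipD => //; exact: lipN. Qed.

Lemma lip_ext f g : (forall t, `|t| <= 1 -> f t = g t) -> lip f -> lip g.
Proof.
by move=> e [L L0 h]; exists L => // s t s1 t1; rewrite -!e// h.
Qed.

Lemma maxE (a b : R) : Num.max a b = (a + b + `|a - b|) / 2.
Proof.
case: (leP b a) => h.
  by rewrite ger0_norm ?subr_ge0//; lra.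
by rewrite ltr0_norm ?subr_lt0//; lra.
Qed.

Lemma lip_max f g : lip f -> lip g -> lip (fun t => Num.max (f t) (g t)).
Proof.
move=> lf lg; apply: (@lip_ext (fun t => (f t + g t + `|f t - g t|) * 2^-1)).
  by move=> t _; rewrite maxE.
by apply: lipM (lip_cst _); apply: lipD; [exact: lipD|apply: lip_abs; exact: lipB].
Qed.

Lemma lip_min f g : lip f -> lip g -> lip (fun t => Num.min (f t) (g t)).
Proof.
move=> lf lg; apply: (@lip_ext (fun t => - Num.max (- f t) (- g t))).
  by move=> t _; rewrite oppr_max !opprK.
by apply: lipN; apply: lip_max; exact: lipN.
Qed.

Lemma lip_inv f (d : R) : 0 < d -> lip f -> (forall t, d <= f t) -> lip (fun t => (f t)^-1).
Proof.
move=> d0 [L L0 h] fd; have f0 t : 0 < f t by apply: lt_le_trans (fd t).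
exists (L / d ^+ 2) => [|s t s1 t1]; first by rewrite divr_ge0// exprn_ge0// ltW.
have -> : (f s)^-1 - (f t)^-1 = (f t - f s) * (f s * f t)^-1.
  by field; rewrite !gt_eqF.
rewrite normrM distrC mulrAC ler_pM// ?h//.
have d2 : 0 < f s * f t by rewrite mulr_gt0.
rewrite ger0_norm ?invr_ge0 ?(ltW d2)//.
by rewrite lef_pV2 ?posrE ?exprn_gt0// expr2 ler_pM// (ltW d0).
Qed.

End LipschitzFunctions.

Lemma scaleMM (R : realType) (a b : R) (p q : {poly R}) :
  (a *: p) * (b *: q) = (a * b) *: (p * q).
Proof. by rewrite -scalerAl -scalerAr scalerA. Qed.

Lemma natSinv_small (R : realType) (e : R) : 0 < e ->
  exists N, forall n, (N <= n)%N -> n.+1%:R^-1 < e.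
Proof.
move=> e0; exists (Num.trunc e^-1) => n Nn.
rewrite invf_plt ?posrE ?ltr0n//; apply: lt_le_trans (truncnS_gt _) _.
by rewrite ler_nat.
Qed.

(** * Functional calculus for Lipschitz functions *)

Section FunctionalCalculus.
Variables (R : realType) (A : cstarAlgType R).
Implicit Types (f g : R -> R) (x y : A) (n m : nat).

Definition bernop (h : A) f n : A -> A :=
  act (\sum_(k < n.+2) f (node R n.+1 k) *: bern R n.+1 k) (half h).

(* The operator of left multiplication by [f(h)], a strong limit of Bernstein
   polynomials on [[-1, 1]]. *)
Definition fcalc (h : A) f x : A := xget 0 [set l | nlim (fun n => bernop h f n x) l].

Variable h : A.
Hypotheses (hadj : h^# = h) (hle : nr h <= 1).

Lemma bernop_bsa f n : bsa (bernop h f n).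
Proof. by apply: act_bsa; exact: half_bsa. Qed.

(** Written over the product weights, here and in [bern_extendr], Bernstein sums of different
    degrees can be subtracted coefficient by coefficient. *)
Lemma bern_extend f n m : \sum_(k < n.+2) f (node R n.+1 k) *: bern R n.+1 k =
  \sum_(k < n.+2) \sum_(l < m.+2)
    f (node R n.+1 k) *: (bern R n.+1 k * bern R m.+1 l).
Proof.
by apply: eq_bigr => k _; rewrite -scaler_sumr -mulr_sumr bern_sum mulr1.
Qed.

Lemma bern_extendr f n m : \sum_(l < m.+2) f (node R m.+1 l) *: bern R m.+1 l =
  \sum_(k < n.+2) \sum_(l < m.+2)
    f (node R m.+1 l) *: (bern R n.+1 k * bern R m.+1 l).
Proof.
rewrite (bern_extend f m n) exchange_big.
by apply: eq_bigr => k _; apply: eq_bigr => l _; rewrite mulrC.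
Qed.

Lemma bernop_bound f n (M : R) : (forall t, `|t| <= 1 -> `|f t| <= M) ->
  opb (bernop h f n) M.
Proof.
move=> fM; have M0 : 0 <= M by apply: le_trans (fM 0 _); rewrite ?normr0.
have := bern2_bound hadj hle (n := n) (m := n) (c := fun k l => f (node R n.+1 k)) M0 (lexx 0).
rewrite mulr0 mul0r addr0 -bern_extend; apply => k l kn ln.
by rewrite mul0r addr0 fM// node_itv.
Qed.

(** The linear modulus is turned into the quadratic one of [bern2_bound] by [a <= d + a^2 / d]. *)
Lemma bern2_lip n m (c : nat -> nat -> R) (K d : R) : 0 <= K -> 0 < d ->
  (forall k l, (k < n.+2)%N -> (l < m.+2)%N ->
    `|c k l| <= K * `|node R n.+1 k - node R m.+1 l|) ->
  opb (act (\sum_(k < n.+2) \sum_(l < m.+2) c k l *: (bern R n.+1 k * bern R m.+1 l)) (half h))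
    (K * (d + 2 / d * (n.+1%:R^-1 + m.+1%:R^-1))).
Proof.
move=> K0 d0 hc.
have -> : K * (d + 2 / d * (n.+1%:R^-1 + m.+1%:R^-1)) =
   K * d + 2 * (K / d) * (n.+1%:R^-1 + m.+1%:R^-1) by ring.
apply: bern2_bound => //; rewrite ?mulr_ge0 ?invr_ge0 ?(ltW d0)// => k l kn lm.
apply: le_trans (hc k l kn lm) _.
rewrite -mulrA -mulrDr ler_wpM2l// -real_normK ?num_real//.
move: `|_| (normr_ge0 (node R n.+1 k - node R m.+1 l)) => a a0.
have [ad|da] := leP a d.
  by rewrite (le_trans ad)// lerDl mulr_ge0 ?invr_ge0 ?(ltW d0) ?exprn_ge0//.
rewrite ler_wpDl ?(ltW d0)// ler_pdivlMl// expr2 ler_wpM2r// ltW//.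
Qed.

Lemma lip_small (K e : R) : 0 <= K -> 0 < e -> exists2 d, 0 < d & exists N, forall n m,
  (N <= n)%N -> (N <= m)%N -> K * (d + 2 / d * (n.+1%:R^-1 + m.+1%:R^-1)) < e.
Proof.
(* With this choice [(K + 1) (d + d) = e], and for large degrees the second summand is below [d]. *)
move=> K0 e0; pose d := e / (2 * (K + 1)).
have d0 : 0 < d by rewrite divr_gt0// mulr_gt0// ltr_wpDl.
exists d => //; have [|N hN] := @natSinv_small _ (d ^+ 2 / 4); first by rewrite divr_gt0// exprn_gt0.
exists N => n m /hN a /hN b.
have : 2 / d * (n.+1%:R^-1 + m.+1%:R^-1) < d.
  rewrite mulrAC ltr_pdivrMr// -expr2.
  by move: (n.+1%:R^-1) (m.+1%:R^-1) a b => p q a b; lra.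
move=> c; have : K * (d + 2 / d * (n.+1%:R^-1 + m.+1%:R^-1)) <= K * (d + d).
  by rewrite ler_wpM2l// lerD2l ltW.
move/le_lt_trans; apply.
have -> : e = (K + 1) * (d + d).
  rewrite /d; have K1 : K + 1 != 0 by rewrite gt_eqF// ltr_wpDl.
  by field.
rewrite ltr_pM2r ?addr_gt0//; lra.
Qed.

Lemma fcalc_lim f : lip f -> forall x, nlim (fun n => bernop h f n x) (fcalc h f x).
Proof.
move=> [L L0 hf] x; apply: (xgetPex 0); apply: nlim_cauchy => e e0.
have M0 : 0 < nr x + 1 by rewrite ltr_wpDl// nr_ge0.
have [d d0 [N hN]] := lip_small (mulr_ge0 L0 (ltW M0)) e0.
exists N => m n Nm Nn; rewrite -actB (bern_extend f m n) (bern_extendr f m n) -sumrB.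
under eq_bigr do (rewrite -sumrB; under eq_bigr do rewrite -scalerBl).
have H := @bern2_lip m n (fun k l => f (node R m.+1 k) - f (node R n.+1 l)) L d L0 d0.
apply: le_lt_trans (hN m n Nm Nn); apply: le_trans (H _ x) _.
  by move=> k l kn lm; rewrite hf ?node_itv.
rewrite mulrAC ler_wpM2r ?ler_wpM2l ?lerDl//.
by rewrite addr_ge0// ?(ltW d0)// mulr_ge0 ?divr_ge0 ?(ltW d0)// addr_ge0.
Qed.

Lemma fcalc_sa f : lip f -> sa (fcalc h f).
Proof.
move=> lf; apply: (sa_lim (un := bernop h f)); last exact: fcalc_lim.
by move=> n; have [] := bernop_bsa f n.
Qed.

Lemma fcalc_bound f (M : R) : lip f -> (forall t, `|t| <= 1 -> `|f t| <= M) ->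
  opb (fcalc h f) M.
Proof.
move=> lf fM x; apply: nlim_le (fcalc_lim lf x) _ => n; exact: bernop_bound.
Qed.

Lemma fcalc_ext f g : lip f -> (forall t, `|t| <= 1 -> f t = g t) ->
  fcalc h f =1 fcalc h g.
Proof.
move=> lf fg x; apply: nlim_uniq (fcalc_lim lf x) _.
have := fcalc_lim (lip_ext fg lf) x; congr nlim; apply/funext => n.
rewrite /bernop; congr act; apply: eq_bigr => k _.
by rewrite fg// node_itv// -ltnS.
Qed.

Lemma fcalcD f g x : lip f -> lip g ->
  fcalc h (fun t => f t + g t) x = fcalc h f x + fcalc h g x.
Proof.
move=> lf lg; apply: nlim_uniq (fcalc_lim (lipD lf lg) x) _.
have := nlimD (fcalc_lim lf x) (fcalc_lim lg x); congr nlim; apply/funext => n.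
rewrite /bernop -actD; congr act; rewrite -big_split; apply: eq_bigr => k _.
by rewrite scalerDl.
Qed.

Lemma fcalc_cst (c : R) x : fcalc h (fun=> c) x = c%:C *: x.
Proof.
apply: nlim_uniq (fcalc_lim (lip_cst c) x) _.
have := nlim_cst (c%:C *: x); congr nlim; apply/funext => n.
by rewrite /bernop -scaler_sumr bern_sum actZ act1.
Qed.

Lemma fcalc_id x : fcalc h id x = h ** x.
Proof.
apply: nlim_uniq (fcalc_lim (@lip_id R) x) _.
have := nlim_cst (h ** x); congr nlim; apply/funext => n.
rewrite /bernop bern_mean /dbl actB act1 mulr2n actD actX; last exact: half_sa.
rewrite /half -scalerDl -rmorphD [2^-1 + 2^-1](_ : _ = 1 :> R); last by lra.
by rewrite scale1r addrC addKr.
Qed.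

(** Bernstein polynomials are not multiplicative, but over the product weights the defect has the
    coefficients [f(s) (g(s) - g(t))], which [bern2_lip] makes small because [g] is Lipschitz. *)
Lemma fcalcM f g x : lip f -> lip g ->
  fcalc h (fun t => f t * g t) x = fcalc h f (fcalc h g x).
Proof.
move=> lf lg; have [M M0 fM] := lip_bounded lf.
have lfg := lipM lf lg.
have h1 : nlim (fun n => bernop h f n (bernop h g n x)) (fcalc h f (fcalc h g x)).
  move=> e e0; have e20 : 0 < e / 2 by rewrite divr_gt0.
  have [N1 hN1] := fcalc_lim lf (fcalc h g x) e20.
  have [N2 hN2] := fcalc_lim lg x (divr_gt0 e20 M0).
  exists (maxn N1 N2) => n; rewrite geq_max => /andP[/hN1 a1 /hN2].
  rewrite ltr_pdivlMr// => a2.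
  apply: le_lt_trans (nr_dist _ (bernop h f n (fcalc h g x)) _) _.
  have := opb_lip (bernop_bsa f n).1 (bernop_bound n fM) (bernop h g n x) (fcalc h g x).
  by rewrite [M * _]mulrC; lra.
apply: nlim_uniq h1 => e e0; case: lg => L L0 hg.
have N0 : 0 < nr x + 1 by rewrite ltr_wpDl// nr_ge0.
have ML0 : 0 <= M * L by rewrite mulr_ge0// ltW.
have [d d0 [N hN]] := lip_small (mulr_ge0 ML0 (ltW N0)) (divr_gt0 e0 (ltr0Sn R 1)).
have [N' hN'] := fcalc_lim lfg x (divr_gt0 e0 (ltr0Sn R 1)).
exists (maxn N N') => n; rewrite geq_max => /andP[Nn /hN' b].
apply: le_lt_trans (nr_dist _ (bernop h (fun t => f t * g t) n x) _) _.
suff a : nr (bernop h f n (bernop h g n x) - bernop h (fun t => f t * g t) n x) < e / 2.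
  by rewrite (splitr e) ltrD.
rewrite nrBC /bernop -actM; last exact: half_sa.
rewrite -actB; set p := _ - _.
have {p}-> : p = \sum_(k < n.+2) \sum_(l < n.+2)
    (f (node R n.+1 k) * (g (node R n.+1 k) - g (node R n.+1 l))) *:
    (bern R n.+1 k * bern R n.+1 l).
  rewrite /p (bern_extend (fun t => f t * g t) n n) mulr_suml -sumrB.
  apply: eq_bigr => k _; rewrite mulr_sumr -sumrB; apply: eq_bigr => l _.
  move: (bern R n.+1 k) (bern R n.+1 l) => B B'.
  by rewrite scaleMM mulrBr scalerBl.
have := @bern2_lip n n (fun k l => f (node R n.+1 k) * (g (node R n.+1 k) - g (node R n.+1 l))) (M * L) d ML0 d0.
move=> H; apply: le_lt_trans (hN n n Nn Nn).
apply: le_trans (H _ x) _.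
  by move=> k l kn ln; rewrite normrM -mulrA ler_pM// ?fM ?hg ?node_itv.
rewrite mulrAC ler_wpM2r ?ler_wpM2l ?lerDl//.
by rewrite addr_ge0// ?(ltW d0)// mulr_ge0 ?divr_ge0 ?(ltW d0)// addr_ge0.
Qed.

(** This keeps functions of [h] inside ideals and hereditary subalgebras. *)
Lemma fcalc_mem (V : set A) f x : lip f -> closed V -> V 0 ->
  (forall (c : R[i]) x y, V x -> V y -> V (c *: x + y)) ->
  (forall x, V x -> V (h ** x)) -> V x -> V (fcalc h f x).
Proof.
move=> lf cV V0 lV hV Vx; apply: (nlim_closed cV _ (fcalc_lim lf x)) => n.
have VD a b : V a -> V b -> V (a + b) by move=> Va; rewrite -[a]scale1r; apply: lV.
have VZ (c : R[i]) a : V a -> V (c *: a).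
  by move=> Va; rewrite -[c *: a]addr0; apply: lV.
rewrite /bernop; elim/poly_ind: (\sum_(k < _) _) x Vx => [|p c IH] y Vy.
  by rewrite act0.
rewrite actD actMX; last exact: half_sa.
rewrite actC; apply: (VD _ _ _ (VZ _ _ Vy)); rewrite /half; apply: VZ; apply: VD; first exact: IH.
by apply: hV; exact: IH.
Qed.

End FunctionalCalculus.

(** * Local units and norms *)

Section Elements.
Variables (R : realType) (A : cstarAlgType R).
Implicit Types (f g : R -> R) (x y : A).

Definition closed_subspace (V : set A) : Prop :=
  [/\ closed V, V 0 & forall (c : R[i]) x y, V x -> V y -> V (c *: x + y)].

Lemma csubD V x y : closed_subspace V -> V x -> V y -> V (x + y).
Proof. by move=> [_ _ lV] Vx; rewrite -[x]scale1r; apply: lV. Qed.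

Lemma csubZ V (c : R[i]) x : closed_subspace V -> V x -> V (c *: x).
Proof. by move=> [_ V0 lV] Vx; rewrite -[c *: x]addr0; apply: lV. Qed.

Lemma csubN V x : closed_subspace V -> V x -> V (- x).
Proof. by move=> cV Vx; rewrite -scaleN1r; apply: csubZ. Qed.

Lemma csubB V x y : closed_subspace V -> V x -> V y -> V (x - y).
Proof. by move=> cV Vx Vy; apply: csubD => //; apply: csubN. Qed.

Lemma left_faithful x y : (forall z, x ** z = y ** z) -> x = y.
Proof.
by move=> h; apply/subr0_eq/right_faithful => z; rewrite mulBx h subrr.
Qed.

Section Elem.
Variable h : A.
Hypotheses (hadj : h^# = h) (hle : nr h <= 1).

(* [elem h g] is the element [f(h)] of [A] for [f(t) = g(t) t]. *)
Definition elem g : A := fcalc h g h.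

Lemma elemE g y : lip g -> elem g ** y = fcalc h (fun t => g t * t) y.
Proof.
move=> lg; rewrite /elem -sa_mulr; last exact: fcalc_sa.
by rewrite -(fcalc_id hadj hle) fcalcM//; exact: lip_id.
Qed.

Lemma lip_mulid g : lip g -> lip (fun t => g t * t).
Proof. by move=> lg; apply: lipM => //; exact: lip_id. Qed.

Lemma elem_adj g : lip g -> (elem g)^# = elem g.
Proof.
move=> lg; apply: left_faithful => y; rewrite elemE//.
rewrite /elem fcalc_sa// hadj -(fcalc_id hadj hle) -fcalcM//; last exact: lip_id.
apply: fcalc_ext => //; first by apply: lipM => //; exact: lip_id.
by move=> t _; rewrite mulrC.
Qed.

Lemma elem_eq f g : lip f -> lip g -> (forall t, `|t| <= 1 -> f t * t = g t * t) ->
  elem f = elem g.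
Proof.
move=> lf lg fg; apply: left_faithful => y; rewrite !elemE//.
by apply: fcalc_ext => //; exact: lip_mulid.
Qed.

Lemma elemM f g : lip f -> lip g -> elem f ** elem g = elem (fun t => f t * t * g t).
Proof.
move=> lf lg; apply: left_faithful => y.
have lfg : lip (fun t => f t * t * g t) by apply: lipM => //; exact: lip_mulid.
rewrite -cstar_mulA !elemE// -fcalcM//; try exact: lip_mulid.
apply: fcalc_ext => //; first by apply: lipM; exact: lip_mulid.
by move=> t _; rewrite mulrA.
Qed.

Lemma elemB f g : lip f -> lip g -> elem (fun t => f t - g t) = elem f - elem g.
Proof.
move=> lf lg; rewrite -[LHS](addrK (elem g)); congr (_ - _).
rewrite /elem -fcalcD//; last exact: lipB.
by apply: fcalc_ext => //; [apply: lipD => //; exact: lipB|move=> t _; rewrite subrK].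
Qed.

Lemma elem1 : elem (fun=> 1) = h.
Proof. by rewrite /elem fcalc_cst// scale1r. Qed.

(** For [a = elem g] the product [a a^#] is [fcalc] of [g(t) t] applied to [a], so
    [|a|^2 <= M |a|]. *)
Lemma nr_elem g (M : R) : lip g -> (forall t, `|t| <= 1 -> `|g t * t| <= M) ->
  nr (elem g) <= M.
Proof.
move=> lg gM; have M0 : 0 <= M by apply: le_trans (gM 0 _); rewrite ?normr0.
have [->|/eqP/nr_gt0 e0] := eqVneq (elem g) 0; first by rewrite nr0.
rewrite -(ler_pM2r e0) -expr2 -nr_cstarr elem_adj// elemE//.
by apply: fcalc_bound gM _ => //; exact: lip_mulid.
Qed.

Lemma elem_mem V g : lip g -> closed_subspace V -> V h ->
  (forall y, V y -> V (h ** y)) -> V (elem g).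
Proof. by move=> lg [cV V0 lV] Vh hV; apply: fcalc_mem. Qed.

End Elem.

(* [cutoff d] vanishes on [[-d, d]] and is [1] outside [[-2d, 2d]]; [cutg d] is
   [cutoff d t / t]. *)
Definition cutoff (d t : R) : R := Num.min 1 (Num.max 0 (`|t| / d - 1)).
Definition cutg (d t : R) : R := cutoff d t * t / Num.max `|t| d ^+ 2.

Lemma lip_cutoff d : lip (cutoff d).
Proof.
apply: lip_min (lip_cst _) _; apply: lip_max (lip_cst _) _.
by apply: lipB (lip_cst _); apply: lipM (lip_cst _); apply: lip_abs (@lip_id R).
Qed.

(** The denominator stays above [d^2], so that [lip_inv] applies. *)
Lemma lip_cutg d : 0 < d -> lip (cutg d).
Proof.
move=> d0; have ld : lip (fun t : R => Num.max `|t| d).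
  by apply: lip_max (lip_cst _); apply: lip_abs (@lip_id R).
apply: lipM; first by apply: lipM (lip_cutoff d) (@lip_id R).
apply: (@lip_inv _ _ (d ^+ 2)); first by rewrite exprn_gt0.
  by apply: (@lip_ext _ (fun t => Num.max `|t| d * Num.max `|t| d)) => [//|]; apply: lipM.
by move=> t; rewrite ler_pXn2r ?nnegrE ?(ltW d0)// le_max ?lexx ?orbT// normr_ge0.
Qed.

Lemma cutoff_itv d t : 0 <= cutoff d t <= 1.
Proof. by rewrite /cutoff le_min ge_min le_max lexx ler01 lexx. Qed.

Lemma cutoff_eq0 d t : 0 < d -> `|t| <= d -> cutoff d t = 0.
Proof.
move=> d0 td; rewrite /cutoff.
have -> : Num.max 0 (`|t| / d - 1) = 0.
  by apply/max_idPl; rewrite subr_le0 ler_pdivrMr// mul1r.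
by apply/min_idPr; exact: ler01.
Qed.

Lemma cutoff_eq1 d t : 0 < d -> d *+ 2 <= `|t| -> cutoff d t = 1.
Proof.
move=> d0 td; apply/min_idPl; rewrite le_max; apply/orP; right.
by rewrite lerBrDr ler_pdivlMr// -[1 + 1]/(2%:R) mulr_natl.
Qed.

Lemma cutgE d t : 0 < d -> cutg d t * t = cutoff d t.
Proof.
move=> d0; rewrite /cutg; have [td|td] := leP `|t| d.
  by rewrite cutoff_eq0// !mul0r.
have t0 : t != 0 by rewrite -normr_gt0 (lt_trans d0).
by rewrite -[`|t| ^+ 2]real_normK ?num_real// normr_id real_normK ?num_real//; field.
Qed.

(** [cutoff d] lives on [|t| > d], where [cutoff (d / 2)] has already reached 1. Halving [d] thus
    produces a unit for the previous cutoff. *)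
Lemma cutoffM d t : 0 < d -> cutoff (d / 2) t * cutoff d t = cutoff d t.
Proof.
move=> d0; have [td|/ltW td] := leP `|t| d; first by rewrite [cutoff d t]cutoff_eq0// mulr0.
by rewrite [cutoff (d / 2) t]cutoff_eq1 ?mul1r ?divr_gt0// mulr2n -splitr.
Qed.

Lemma cutoff_rem d t : 0 < d -> `|(1 - cutoff d t) * t| <= d *+ 2.
Proof.
move=> d0; have /andP[c0 c1] := cutoff_itv d t.
have [td|/ltW td] := leP `|t| (d *+ 2); last first.
  by rewrite cutoff_eq1// subrr mul0r normr0 mulrn_wge0// ltW.
rewrite normrM -[leRHS]mul1r ler_pM// ger0_norm ?subr_ge0//.
by rewrite lerBlDr lerDl.
Qed.

(** The elements are cutoffs of the normalized [x ** x^#] at [d], [d / 2] and [d / 4]. The chain of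
    three gives both [a] and [b] a unit, which places them in K(A); the last clause keeps all three
    in any ideal or hereditary subalgebra that contains [x]. *)
Lemma local_unit (x : A) (e : R) : 0 < e -> exists a b c : A,
  [/\ a^# = a, b^# = b & c^# = c] /\
  [/\ nr a <= 1, nr b <= 1, nr (x - a ** x) < e & nr (x - a ** (a ** x)) < e] /\
  [/\ b ** a = a, a ** b = a, c ** b = b & b ** c = b] /\
  forall V, closed_subspace V -> V (x ** x^#) ->
    (forall y, V y -> V (x ** x^# ** y)) -> [/\ V a, V b & V c].
Proof.
move=> e0; have [->|/eqP x0] := eqVneq x 0.
  by exists 0, 0, 0; rewrite adj0 !mulx0 subrr nr0; do !split=> //; case: H.
have nx0 := nr_gt0 x0; pose w := x ** x^#.
have wadj : w^# = w by rewrite /w cstar_adjM cstar_adjK.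
have nw : nr w = nr x ^+ 2 by rewrite nr_cstarr.
have k0 : 0 < nr w by rewrite nw exprn_gt0.
pose h := (nr w)^-1%:C *: w.
have wh : w = (nr w)%:C *: h by rewrite scalerA -rmorphM mulfV ?gt_eqF// scale1r.
have hadj : h^# = h by rewrite adjZr wadj.
have nh : nr h <= 1 by rewrite nrZ_ge0 ?invr_ge0 ?(ltW k0)// mulVf// gt_eqF.
(* [|x - E d x|^2] will be at most [|w| 2 d <= e^2 / 8], below [(e / 2)^2]; aiming at [e / 2] leaves
   room for multiplying by [a] twice. *)
pose d := Num.min (e ^+ 2 / (nr w * 16)) 1.
have d0 : 0 < d by rewrite lt_min ltr01 divr_gt0 ?exprn_gt0// mulr_gt0.
pose E d := elem h (cutg d).
have El (d' : R) : 0 < d' -> lip (cutg d') by exact: lip_cutg.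
have Eadj d' : 0 < d' -> (E d')^# = E d' by move=> d'0; apply: elem_adj => //; exact: El.
have En d' : 0 < d' -> nr (E d') <= 1.
  move=> d'0; apply: nr_elem => //; first exact: El.
  by move=> t _; rewrite cutgE//; have /andP[c0 c1] := cutoff_itv d' t; rewrite ger0_norm.
have EM d' : 0 < d' -> E (d' / 2) ** E d' = E d'.
  move=> d'0; have d2 : 0 < d' / 2 by rewrite divr_gt0.
  have l1 := El _ d'0; have l2 := El _ d2.
  rewrite /E elemM//; apply: elem_eq => //.
    by apply: lipM => //; exact: lip_mulid.
  by move=> t _; rewrite -mulrA !cutgE// cutoffM.
have EM' d' : 0 < d' -> E d' ** E (d' / 2) = E d'.
  move=> d'0; have d2 : 0 < d' / 2 by rewrite divr_gt0.
  by rewrite -[LHS]cstar_adjK cstar_adjM !Eadj// EM// Eadj.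
have d2 : 0 < d / 2 by rewrite divr_gt0.
have d4 : 0 < d / 2 / 2 by rewrite divr_gt0.
have nxa : nr (x - E d ** x) < e / 2.
  have l1 : lip (fun t => 1 - cutoff d t) by apply: lipB (lip_cst _) (lip_cutoff d).
  have lE := El d d0.
  rewrite -(ltr_pXn2r (n := 2)) ?nnegrE ?nr_ge0// ?divr_ge0 ?(ltW e0)//.
  rewrite -nr_cstarr adjB cstar_adjM Eadj//.
  have u1 : h - E d ** h = elem h (fun t => 1 - cutoff d t).
    rewrite -[in X in X - _](elem1 hadj nh) -[in X in _ ** X](elem1 hadj nh).
    rewrite /E elemM//; last exact: lip_cst.
    rewrite -elemB//; [|exact: lip_cst|by apply: lipM (lip_cst _); exact: lip_mulid].
    apply: elem_eq => //.
      by apply: lipB (lip_cst _) _; apply: lipM (lip_cst _); exact: lip_mulid.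
    by move=> t _; rewrite mulr1 cutgE.
  have -> : (x - E d ** x) ** (x^# - x^# ** E d) =
      (nr w)%:C *: elem h (fun t => (1 - cutoff d t) * (1 - cutoff d t)).
    have key (W : A) (k : R[i]) (H D : A) : W = k *: H -> W - D ** W - (W ** D - D ** W ** D) =
        k *: ((H - D ** H) - (H - D ** H) ** D).
      by move=> ->; rewrite !mulxZ !mulZx mulBx -!scalerBr.
    rewrite mulxB !mulBx !cstar_mulA -[E d ** x ** x^#]cstar_mulA -/w (key w (nr w)%:C h (E d) wh).
    congr (_ *: _); rewrite u1 /E elemM// -elemB//; last by apply: lipM lE; exact: lip_mulid.
    apply: elem_eq => //.
    - by apply: lipB => //; apply: lipM lE; exact: lip_mulid.
    - exact: lipM.
    - by move=> t _; rewrite -(cutgE t d0); ring.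
  rewrite nrZ_ge0 ?(ltW k0)//.
  have : nr (elem h (fun t => (1 - cutoff d t) * (1 - cutoff d t))) <= d *+ 2.
    apply: nr_elem => //; first exact: lipM.
    move=> t _; rewrite -mulrA normrM -[leRHS]mul1r ler_pM// ?cutoff_rem//.
    by have /andP[c0 c1] := cutoff_itv d t; rewrite ger0_norm ?subr_ge0// lerBlDr lerDl.
  rewrite -(ler_pM2l k0) => /le_lt_trans; apply.
  have : d <= e ^+ 2 / (nr w * 16) by rewrite ge_min lexx.
  rewrite ler_pdivlMr ?mulr_gt0// => H.
  have := exprn_gt0 2 e0; rewrite expr_div_n; move: (e ^+ 2) H => E2 H E20.
  by rewrite -mulr_natr; lra.
exists (E d), (E (d / 2)), (E (d / 2 / 2)); split; first by rewrite !Eadj.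
split.
  split; rewrite ?En//; first by apply: lt_trans nxa _; lra.
  apply: le_lt_trans (nr_dist _ (E d ** x) _) _; rewrite -mulxB.
  rewrite (splitr e) ltrD//; apply: le_lt_trans nxa.
  by rewrite (le_trans (nrM _ _))// ler_piMl ?nr_ge0// En.
split; first by split; [exact: EM | exact: EM' | exact: EM | exact: EM'].
move=> V cV Vw wV.
have Vh : V h by apply: csubZ.
have hV y : V y -> V (h ** y) by move=> Vy; rewrite mulZx; apply: csubZ => //; exact: wV.
by split; apply: elem_mem => //; exact: El.
Qed.

Definition bump (si s : R) : R := Num.max 0 ((`|s| - si) / (1 - si)).

Lemma lip_bump si : lip (bump si).
Proof.
apply: lip_max (lip_cst _) _; apply: lipM (lip_cst _).
by apply: lipB (lip_cst _); apply: lip_abs (@lip_id R).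
Qed.

Lemma bump_eq0 si s : si < 1 -> `|s| <= si -> bump si s = 0.
Proof.
move=> s1 ss; apply/max_idPl.
by rewrite pmulr_lle0 ?invr_gt0 ?subr_gt0// subr_le0.
Qed.

(** If it vanished, [h] would equal [(1 - h^2 f(h)) h] for [f = bump si], a function bounded by [si]
    on [-1, 1], against [|h| = 1]. The bound holds since [1 - si <= 1/4 <= (3/4)^3 <= |s|^3]
    whenever [|s| > si]. *)
Lemma bump_neq0 (h : A) (si : R) : h^# = h -> nr h = 1 -> 3 / 4 <= si < 1 ->
  elem h (bump si) <> 0.
Proof.
move=> hadj nh /andP[si2 si1] a0; have nh1 : nr h <= 1 by rewrite nh.
have lf := lip_bump si.
have l1 : lip (fun=> 1 : R) by exact: lip_cst.
have l2 : lip (fun s => 1 * s * bump si s) by apply: lipM => //; exact: lip_mulid.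
have l3 : lip (fun s => 1 * s * (1 * s * bump si s)) by apply: lipM => //; exact: lip_mulid.
have hE : elem h (fun s => 1 - 1 * s * (1 * s * bump si s)) = h.
  rewrite elemB// -elemM// -(elemM hadj nh1 l1 lf) a0 !mulx0 subr0.
  exact: elem1.
suff : nr h <= si by rewrite nh leNgt si1.
rewrite -hE; apply: nr_elem => //; first exact: lipB.
move=> s s1; rewrite !mul1r.
have [ss|ss] := leP `|s| si; first by rewrite bump_eq0// !mulr0 subr0 mul1r.
have fE : bump si s = (`|s| - si) / (1 - si).
  by apply/max_idPr; rewrite divr_ge0// subr_ge0 ltW.
have -> : s * (s * bump si s) = `|s| ^+ 2 * bump si s by rewrite real_normK ?num_real// mulrA.
rewrite fE normrM; move: `|s| ss s1 => u su u1.
have d0 : 0 < 1 - si by rewrite subr_gt0.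
have [q0 q1] : 0 <= (u - si) / (1 - si) /\ (u - si) / (1 - si) <= 1.
  by rewrite divr_ge0 ?(ltW d0) ?subr_ge0 ?(ltW su)// ler_pdivrMr// mul1r lerB.
have qE : (u - si) / (1 - si) * (1 - si) = u - si by rewrite divfK// gt_eqF.
move: (_ / _) q0 q1 qE => q q0 q1 qE.
have u0 : 0 < u by apply: lt_trans su; apply: lt_le_trans si2; rewrite divr_gt0.
have uu : u ^+ 2 * q <= 1 by rewrite -[leRHS]mul1r ler_pM ?exprn_ge0 ?(ltW u0)// exprn_ile1// ltW.
rewrite ger0_norm ?subr_ge0// mulrBl mul1r.
suff : u - si <= u ^+ 2 * q * u by lra.
rewrite -qE mulrC [leRHS]mulrAC ler_wpM2r//.
have h1 : 3 / 4 <= u by apply: le_trans si2 (ltW su).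
have h2 : (3 / 4) ^+ 2 <= u ^+ 2 by rewrite ler_pXn2r ?nnegrE ?(ltW u0)// divr_ge0.
have h3 : (3 / 4) ^+ 2 * (3 / 4) <= u ^+ 2 * u.
  by apply: ler_pM => //; rewrite ?exprn_ge0 ?divr_ge0.
lra.
Qed.

(* A C*-norm on a closed *-subalgebra which is dominated by the norm coincides
   with it. Here the norm is the supremum of [|t z|] over the unit ball of [Z]. *)
Lemma norm_test (C Z : set A) (M : R) (t : A) :
  closed_subspace C -> (forall x y, C x -> C y -> C (x ** y)) ->
  (forall x, C x -> C x^#) ->
  (forall c z, C c -> Z z -> Z (c ** z)) -> (forall (c : R) z, Z z -> Z (c%:C *: z)) ->
  (forall c, C c -> (forall z, Z z -> c ** z = 0) -> c = 0) ->
  C t -> 0 <= M -> (forall z, Z z -> nr z <= 1 -> nr (t ** z) <= M) -> nr t <= M.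
Proof.
move=> cC CM Ca CZ ZZ faith Ct M0 bound.
have {}bound z : Z z -> nr (t ** z) <= M * nr z.
  move=> Zz; have [->|/eqP/nr_gt0 z0] := eqVneq z 0; first by rewrite mulx0 nr0 mulr0.
  have := bound ((nr z)^-1%:C *: z) (ZZ _ _ Zz).
  rewrite mulxZ !nrZ_ge0 ?invr_ge0 ?(ltW z0)// mulVf ?gt_eqF// => /(_ (lexx _)).
  by rewrite ler_pdivrMl// mulrC.
rewrite leNgt; apply/negP => Mt.
have t0 : 0 < nr t by apply: le_lt_trans Mt.
pose w := t^# ** t; have nw : nr w = nr t ^+ 2 by rewrite nr_cstar.
have k0 : 0 < nr w by rewrite nw exprn_gt0.
pose h := (nr w)^-1%:C *: w.
have hadj : h^# = h by rewrite adjZr /w cstar_adjM cstar_adjK.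
have nh : nr h = 1 by rewrite nrZ_ge0 ?invr_ge0 ?(ltW k0)// mulVf// gt_eqF.
have nh1 : nr h <= 1 by rewrite nh.
have Ch : C h by apply: csubZ => //; apply: CM => //; exact: Ca.
pose rho := M / nr t.
have rho0 : 0 <= rho by rewrite divr_ge0// ltW.
have rho1 : rho < 1 by rewrite ltr_pdivrMr// mul1r.
have hbound z : Z z -> nr (h ** z) <= rho * nr z.
  move=> Zz; rewrite mulZx nrZ_ge0 ?invr_ge0 ?(ltW k0)// ler_pdivrMl//.
  have -> : nr w * (rho * nr z) = nr t * (M * nr z).
    by rewrite nw /rho; field; rewrite gt_eqF.
  rewrite -cstar_mulA (le_trans (nrM _ _))// nr_adj ler_wpM2l ?(ltW t0)//.
  exact: bound.
(* [h] shrinks [Z] by the factor [rho], but the element [a] below is cut off so that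
   [|h a z| >= si |a z|] with [si > rho]; this forces [a z = 0]. The [3 / 4] serves [bump_neq0]. *)
pose sg := (rho + 1) / 2; pose si : R := Num.max sg (3 / 4).
have si1 : si < 1 by rewrite gt_max; apply/andP; split; rewrite /sg; lra.
have si2 : 3 / 4 <= si by rewrite le_max lexx orbT.
have rsi : rho < si by rewrite lt_max /sg; apply/orP; left; lra.
have si0 : 0 < si by apply: lt_le_trans si2; rewrite divr_gt0.
pose f := bump si; have lf : lip f by exact: lip_bump.
have f_eq0 s : `|s| <= si -> f s = 0 by exact: bump_eq0.
(* [r(s) = si / s] where [bump si] lives, so [r(h)] is a contraction that undoes [h] there up to the
   factor [si]. *)
pose r (s : R) := s * si / Num.max `|s| si ^+ 2.
have lr : lip r.
  apply: lipM; first by apply: lipM (@lip_id R) (lip_cst _).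
  have lm : lip (fun s : R => Num.max `|s| si).
    by apply: lip_max (lip_cst _); apply: lip_abs (@lip_id R).
  apply: (@lip_inv _ _ (si ^+ 2)); first by rewrite exprn_gt0.
    by apply: (@lip_ext _ (fun t => Num.max `|t| si * Num.max `|t| si)) => [//|]; apply: lipM.
  by move=> s; rewrite ler_pXn2r ?nnegrE ?(ltW si0)// le_max ?lexx ?orbT// normr_ge0.
have r1 s : `|s| <= 1 -> `|r s| <= 1.
  move=> s1; rewrite /r; have m0 : 0 < Num.max `|s| si by rewrite lt_max si0 orbT.
  rewrite !normrM normfV [`|_ ^+ 2|]ger0_norm ?exprn_ge0 ?(ltW m0)//.
  rewrite ler_pdivrMr ?exprn_gt0// mul1r expr2 (ger0_norm (ltW si0)).
  by apply: ler_pM => //; [exact: ltW | rewrite le_max lexx | rewrite le_max lexx orbT].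
have rs s : f s * (s * r s) = si * f s.
  have [ss|ss] := leP `|s| si; first by rewrite f_eq0// mul0r mulr0.
  have s0 : s != 0 by rewrite -normr_gt0 (lt_trans si0).
  rewrite /r; have -> : Num.max `|s| si = `|s| by apply/max_idPl/ltW.
  by rewrite real_normK ?num_real//; field.
have lg : lip (fun s => f s * s) by apply: lip_mulid.
pose a := elem h f.
have Ca' : C a by apply: elem_mem => // y Cy; exact: CM.
have a0 : a = 0.
  apply: faith => // z Zz; apply: nr_eq0; apply/le_anti; rewrite nr_ge0 andbT.
  have Zaz : Z (a ** z) by exact: CZ.
  have e1 : si%:C *: (a ** z) = fcalc h r (h ** (a ** z)).
    have l1 := lipM (@lip_id R) lg.
    rewrite /a elemE// -(fcalc_id hadj nh1) -(fcalc_cst hadj nh1).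
    rewrite -(fcalcM hadj nh1 z (@lip_id R) lg) -(fcalcM hadj nh1 z lr l1).
    rewrite -(fcalcM hadj nh1 z (lip_cst si) lg).
    apply: fcalc_ext => //; first exact: (lipM (lip_cst si) lg).
    move=> s _ /=; transitivity (si * f s * s); first by rewrite mulrA.
    by rewrite -rs; ring.
  have := fcalc_bound hadj nh1 lr r1 (h ** (a ** z)).
  rewrite -e1 nrZ_ge0 ?(ltW si0)// mul1r => H.
  have := le_trans H (hbound _ Zaz); have := nr_ge0 (a ** z).
  move: (nr (a ** z)) => n n0 H2; nra.
by apply: (bump_neq0 hadj nh) a0; rewrite si2.
Qed.

(* In an algebra without orthogonal pairs, the spectrum of a nonzero
   self-adjoint element is contained in [{-1, 0, 1}] up to scaling. *)
Lemma atom_cube (C : set A) (h : A) :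
  closed_subspace C -> (forall x y, C x -> C y -> C (x ** y)) ->
  (forall x y, C x -> C y -> x^# = x -> y^# = y -> x ** y = 0 -> x = 0 \/ y = 0) ->
  C h -> h^# = h -> nr h = 1 -> h ** h ** h = h.
Proof.
move=> cC CM atom Ch hadj nh; have nh1 : nr h <= 1 by rewrite nh.
have memC g : lip g -> C (elem h g).
  by move=> lg; apply: elem_mem => // y Cy; exact: CM.
have labs : lip (fun t : R => `|t|) by apply: lip_abs (@lip_id R).
have l1 : lip (fun=> 1 : R) by exact: lip_cst.
(* [lo si] and [bump si] live on disjoint sets, so one of the two elements vanishes, and [bump_neq0]
   tells which. For [si] tending to 1 this gives [(1 - |h|) h = 0], and
   [h - h^3 = (1 + |h|) (1 - |h|) h]. *)
pose lo (si t : R) := Num.max 0 (si - `|t|).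
have llo si : lip (lo si) by apply: lip_max (lip_cst _) _; apply: lipB (lip_cst _) _.
have lo0 si : 3 / 4 <= si < 1 -> elem h (lo si) = 0.
  move=> si12; have /andP[_ si1] := si12; have lb := lip_bump si.
  have [|||||//|/(bump_neq0 hadj nh si12)//] := atom (elem h (lo si)) (elem h (bump si)).
  - exact: memC.
  - exact: memC.
  - exact: elem_adj.
  - exact: elem_adj.
  rewrite elemM//; have l0 : lip (fun=> 0 : R) by exact: lip_cst.
  transitivity (elem h (fun=> 0)); last by rewrite /elem fcalc_cst// scale0r.
  apply: elem_eq => //; first by apply: lipM => //; exact: lip_mulid.
  move=> t _; rewrite mul0r; have [ts|/ltW ts] := leP `|t| si.
    by rewrite bump_eq0// mulr0 mul0r.
  by rewrite (_ : lo si t = 0) ?mul0r//; apply/max_idPl; rewrite subr_le0.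
pose lo1 (t : R) := 1 - `|t|; have llo1 : lip lo1 by exact: lipB.
have e0 : elem h lo1 = 0.
  apply: nr_small => e e0; pose si := Num.max (3 / 4) (1 - Num.min e 2^-1).
  have m0 : 0 < Num.min e 2^-1 by rewrite lt_min e0 invr_gt0 ltr0n.
  have si12 : 3 / 4 <= si < 1 by rewrite le_max lexx /= gt_max; apply/andP; split; lra.
  rewrite -[elem h lo1]subr0 -(lo0 si si12) -elemB//.
  have /andP[_ si1] := si12.
  have esi : 1 - si <= e.
    have : 1 - Num.min e 2^-1 <= si by rewrite le_max lexx orbT.
    have : Num.min e 2^-1 <= e by rewrite ge_min lexx.
    lra.
  apply: nr_elem => //; first exact: lipB.
  move=> t t1; rewrite normrM -[leRHS]mulr1; apply: ler_pM => //.
  apply: le_trans esi; rewrite /lo1 /lo; have [ts|/ltW ts] := leP `|t| si.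
    rewrite (_ : Num.max _ _ = si - `|t|); last by apply/max_idPr; rewrite subr_ge0.
    by rewrite ger0_norm; lra.
  rewrite (_ : Num.max _ _ = 0); last by apply/max_idPl; rewrite subr_le0.
  by rewrite subr0 ger0_norm; lra.
have lp : lip (fun t : R => 1 + `|t|) by exact: lipD.
have l11 : lip (fun t : R => 1 * t * 1) by apply: lipM => //; exact: lip_mulid.
have h3 : elem h (fun t => (1 * t * 1) * t * 1) = h ** h ** h.
  by rewrite -(elemM hadj nh1 l11 l1) -(elemM hadj nh1 l1 l1) !elem1.
have l2 : lip (fun t : R => (1 * t * 1) * t * 1).
  by apply: lipM => //; exact: lip_mulid.
apply/esym/subr0_eq; rewrite -h3 -[X in X - _](elem1 hadj nh1) -elemB//.
transitivity (fcalc h (fun t => 1 + `|t|) (elem h lo1)); last first.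
  by rewrite e0 sa0//; exact: fcalc_sa.
rewrite /elem -fcalcM//; apply: fcalc_ext => //; first exact: lipB.
move=> t _; rewrite /lo1 !mul1r !mulr1 -[t * t]/(t ^+ 2) -real_normK ?num_real//; ring.
Qed.

End Elements.

(** * Closed ideals and the Pedersen ideal *)

Section Ideals.
Variables (R : realType) (A : cstarAlgType R).
Implicit Types (a b q s x y z : A) (I J V : set A).

Definition cideal : set A -> Prop := closed_two_sided_ideal [set: A].
Definition star_closed J := forall x, J x -> J x^#.

Lemma cidealP J : cideal J <->
  closed_subspace J /\ forall b x, J x -> J (b ** x) /\ J (x ** b).
Proof.
split=> [[[_ J0 lJ mJ] cJ]|[[cJ J0 lJ] mJ]].
  by split=> // b x; exact: mJ.
by split=> //; split=> // b x _; exact: mJ.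
Qed.

Lemma cideal_sub J : cideal J -> closed_subspace J.
Proof. by move=> /cidealP[]. Qed.

Lemma cidealMl J b x : cideal J -> J x -> J (b ** x).
Proof. by move=> /cidealP[_ h] /(h b)[]. Qed.

Lemma cidealMr J b x : cideal J -> J x -> J (x ** b).
Proof. by move=> /cidealP[_ h] /(h b)[]. Qed.

Lemma closed_adj V : closed V -> closed [set x : A | V x^#].
Proof.
move=> /closedP cV; apply/closedP => x h; apply: cV => e /h[y Vy xy].
by exists y^# => //; rewrite -adjB nr_adj.
Qed.

Lemma star_preimage_cideal J : cideal J -> cideal [set x | J x^#].
Proof.
move=> cJ; have [clJ J0 lJ] := cideal_sub cJ; apply/cidealP; split; last first.
  by move=> b x /= Jx; rewrite !cstar_adjM; split; [apply: cidealMr|apply: cidealMl].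
split; first exact: closed_adj.
- by rewrite /= adj0.
- by move=> c x y /= Jx Jy; rewrite cstar_adjD cstar_adjZ; exact: lJ.
Qed.

Lemma smallest_cideal (P : set A) : cideal (smallest cideal P).
Proof.
apply/cidealP; split; last first.
  by move=> b x h; split=> I [cI Iq]; [apply: (cidealMl _ cI)|apply: (cidealMr _ cI)]; apply: h.
split=> [||c x y hx hy I [cI Iq]].
- by apply: closed_bigI => I [cI Iq]; case: cI.
- by move=> I [cI Iq]; have [_ I0 _] := cideal_sub cI.
- by have [_ _ lI] := cideal_sub cI; apply: lI; [apply: hx|apply: hy].
Qed.

Lemma smallest_cideal_min (P J : set A) : cideal J -> P `<=` J -> smallest cideal P `<=` J.
Proof. by move=> cJ PJ x; apply; split. Qed.

(** The elements whose adjoint lies in the ideal form again a closed ideal containing [P], so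
    minimality applies. *)
Lemma smallest_cideal_star (P : set A) : (forall x, P x -> x^# = x) ->
  star_closed (smallest cideal P).
Proof.
move=> hS x; have := smallest_cideal_min (star_preimage_cideal (smallest_cideal P)).
by apply=> s Ps /=; rewrite hS// => I [_]; apply.
Qed.

Definition gideal q : set A := smallest cideal [set q].

Lemma gideal_self q : gideal q q.
Proof. by move=> I [_]; apply. Qed.

Lemma gideal_min q J : cideal J -> J q -> gideal q `<=` J.
Proof. by move=> cJ Jq; apply: smallest_cideal_min => // _ ->. Qed.

Lemma gideal_cideal q : cideal (gideal q).
Proof. exact: smallest_cideal. Qed.

Lemma gideal_star q : q^# = q -> star_closed (gideal q).
Proof. by move=> qa; apply: smallest_cideal_star => _ ->. Qed.

Lemma closed_kernel (f : A -> A) (M : R) :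
  (forall x y, f (x - y) = f x - f y) -> (forall x, nr (f x) <= M * nr x) ->
  closed [set x | f x = 0].
Proof.
move=> fB fM; apply/closedP => x /= h; apply: nr_small => e e0.
have M0 : 0 < `|M| + 1 by rewrite ltr_wpDl.
have [y /= fy xy] := h _ (divr_gt0 e0 M0).
rewrite -[f x]subr0 -fy -fB (le_trans (fM _))//.
have := ltW xy; rewrite ler_pdivlMr// mulrC; apply: le_trans.
by rewrite ler_wpM2r ?nr_ge0// (le_trans (ler_norm _))// lerDl.
Qed.

(** [[set s | t ** s = 0]] is only a right ideal; asking also [t ** a ** s = 0] for all [a] makes it
    two-sided, and then minimality of the generated ideal applies. *)
Lemma annihilator_smallest (P : set A) t : (forall q, P q -> t ** q = 0) ->
  (forall a q, P q -> t ** a ** q = 0) ->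
  forall s, smallest cideal P s -> t ** s = 0.
Proof.
move=> tq taq s gs.
have [] // : (t ** s = 0 /\ forall a, t ** a ** s = 0).
move: s gs; apply: smallest_cideal_min => [|q Pq]; last first.
  by split=> [|a]; [exact: tq|exact: taq].
have cl (u : A) : closed [set s | u ** s = 0].
  by apply: (@closed_kernel _ (nr u)) => [x y|x]; [rewrite mulxB|exact: nrM].
apply/cidealP; split; last first.
  move=> b x [tx tax]; split; split=> [|a].
  - by rewrite cstar_mulA.
  - by rewrite cstar_mulA -(cstar_mulA t).
  - by rewrite cstar_mulA tx mul0x.
  - by rewrite cstar_mulA tax mul0x.
split.
- have -> : (fun s => t ** s = 0 /\ forall a, t ** a ** s = 0) =
      [set s | t ** s = 0] `&` \bigcap_(a in setT) [set s | t ** a ** s = 0].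
    by apply/seteqP; split=> s /= [h1 h2]; split=> // a; [move=> _|]; apply: h2.
  by apply: closedI => //; apply: closed_bigI.
- by split=> [|a]; rewrite mulx0.
- move=> c x y [tx tax] [ty tay]; split=> [|a].
    by rewrite cstar_mulDr mulxZ tx ty scaler0 addr0.
  by rewrite cstar_mulDr mulxZ tax tay scaler0 addr0.
Qed.

Lemma annihilator_gideal t q : (forall a, t ** a ** q = 0) -> t ** q = 0 ->
  forall s, gideal q s -> t ** s = 0.
Proof.
by move=> taq tq; apply: annihilator_smallest => [_ ->|a _ ->] //; exact: taq.
Qed.

Lemma two_sided_ideal_bigcap (F : set (set A)) :
  (forall J, F J -> two_sided_ideal [set: A] J) ->
  two_sided_ideal [set: A] (\bigcap_(J in F) J).
Proof.
move=> hF; split=> //.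
- by move=> J /hF[].
- by move=> c x y hx hy J FJ; have [_ _ l _] := hF _ FJ; apply: l; [apply: hx|apply: hy].
- move=> b x _ hx; split=> J FJ; have [_ _ _ /(_ b x I (hx J FJ))[]//] := hF _ FJ.
Qed.

(** Choose [j] in [J] within [1/2] of [e] and put [u = e - j]. Then [(1 - u) a = j a] lies in [J],
    and [1 - u] is inverted by a Neumann series. Hence every element with a left unit is in K(A). *)
Lemma dense_ideal_local_unit J e a : dense_two_sided_ideal [set: A] J ->
  e ** a = a -> J a.
Proof.
move=> [[_ J0 lJ mJ] dJ] ea.
have /closureP/(_ 2^-1)[|j Jj ej] := dJ e I; first by rewrite invr_gt0 ltr0n.
pose u := e - j; have nu : nr u <= 2^-1 by exact: ltW.
pose p := j ** a; have Jp : J p by have [] := mJ a j I Jj.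
have apu : a = p + u ** a by rewrite mulBx ea addrC subrK.
clearbody u p.
(* The partial sums [u + ... + u^n]. The term 1 of the Neumann series has no place in [A]; it
   reappears as the summand [p] in [a = p + l ** p]. *)
pose z := fix z n := if n is n'.+1 then u + u ** z n' else 0.
have [l zl] : exists l, nlim z l.
  have dz n : nr (z n.+1 - z n) <= 2^-1 ^+ n * nr u.
    elim: n => [|n IH]; first by rewrite /= mulx0 addr0 subr0 expr0 mul1r.
    rewrite [z n.+2]/= [z n.+1 in X in _ - X]/= opprD addrACA subrr add0r -mulxB.
    rewrite exprS -mulrA (le_trans (nrM _ _))//.
    by apply: ler_pM; rewrite ?nr_ge0.
  have dz2 m k : nr (z (k + m)%N - z m) <= 2^-1 ^+ m.
    suff : nr (z (k + m)%N - z m) <= (1 - 2^-1 ^+ k) * 2^-1 ^+ m.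
      have q0 i : 0 <= (2^-1 : R) ^+ i by rewrite exprn_ge0// invr_ge0 ler0n.
      by move=> /le_trans; apply; apply: ler_piMl => //; rewrite gerBl.
    elim: k => [|k IH]; first by rewrite add0n subrr nr0 expr0 subrr mul0r.
    rewrite addSn (le_trans (nr_dist _ (z (k + m)%N) _))//.
    have := dz (k + m)%N; rewrite exprD => h1.
    have p1 : 0 <= (2^-1 : R) ^+ k * 2^-1 ^+ m by rewrite mulr_ge0// exprn_ge0// invr_ge0 ler0n.
    have h2 : 2^-1 ^+ k * 2^-1 ^+ m * nr u <= 2^-1 ^+ k * 2^-1 ^+ m * 2^-1.
      by rewrite ler_wpM2l.
    apply: le_trans (lerD (le_trans h1 h2) IH) _; rewrite exprS.
    move: ((2^-1 : R) ^+ k) ((2^-1 : R) ^+ m) => q r.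
    by rewrite le_eqVlt; apply/orP; left; apply/eqP; field.
  apply: nlim_cauchy => d d0.
  have [N hN] := @natSinv_small R _ d0.
  exists N => m n Nm Nn; wlog mn : m n Nm Nn / (m <= n)%N.
    by move=> H; case: (leqP m n) => [|/ltnW] /H; [|rewrite nrBC]; apply.
  rewrite nrBC -(subnK mn); apply: le_lt_trans (dz2 _ _) _.
  apply: le_lt_trans (hN m Nm); rewrite exprVn lef_pV2 ?posrE ?exprn_gt0 ?ltr0n//.
  by rewrite -natrX ler_nat ltn_expl.
have le : l = u + u ** l.
  apply: (nlim_uniq (u := fun n => z n.+1)).
    by move=> d /zl[N hN]; exists N => n /leqW; exact: hN.
  apply: (nlim_map (f := fun v => u + u ** v) (M := nr u)) zl => v w.
  by rewrite opprD addrACA subrr add0r -mulxB nrM.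
have -> : a = p + l ** p.
  apply/subr0_eq; set d := _ - _.
  have du : d = u ** d.
    rewrite /d mulxB cstar_mulDr cstar_mulA [in LHS]apu.
    by rewrite [in X in _ - X]le cstar_mulDl opprD addrACA subrr add0r.
  apply: nr_eq0; have := nrM u d; rewrite -du; have := nr_ge0 d.
  move: nu (nr_ge0 u); move: (nr u) (nr d) => v w *; nra.
by rewrite -[p]scale1r; apply: lJ => //; rewrite scale1r; have [] := mJ l p I Jp.
Qed.

Local Notation K := (pedersen_ideal [set: A]).

Lemma pedersen_two_sided : two_sided_ideal [set: A] K.
Proof. by apply: two_sided_ideal_bigcap => J [[]]. Qed.

Lemma pedersen_local_unit e a : e ** a = a -> K a.
Proof. by move=> ea J [dJ _]; exact: dense_ideal_local_unit dJ ea. Qed.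

Lemma pedersenMl b x : K x -> K (b ** x).
Proof. by move=> Kx; have [_ _ _ /(_ b x I Kx)[]] := pedersen_two_sided. Qed.

Lemma pedersenMr b x : K x -> K (x ** b).
Proof. by move=> Kx; have [_ _ _ /(_ b x I Kx)[]] := pedersen_two_sided. Qed.

Lemma pedersen_lin (c : R[i]) x y : K x -> K y -> K (c *: x + y).
Proof. by have [_ _ + _] := pedersen_two_sided; apply. Qed.

Lemma pedersenZ (c : R[i]) x : K x -> K (c *: x).
Proof.
by move=> Kx; rewrite -[c *: x]addr0; apply: pedersen_lin => //; have [] := pedersen_two_sided.
Qed.

Lemma pedersen_faithful d : (forall z, K z -> z ** d = 0) -> d = 0.
Proof.
move=> h; apply: nr_small => e e0.
have [a [b [c [_ [[_ _ da _] [[ba _ _ _] _]]]]]] := local_unit d e0.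
by move: da; rewrite h ?subr0; [exact: ltW|exact: pedersen_local_unit ba].
Qed.

Lemma sum_of_add (X : Type) (F : X -> set A) x y :
  sum_of F x -> sum_of F y -> sum_of F (x + y).
Proof.
move=> [n [j [f [hf ->]]]] [m [j' [f' [hf' ->]]]].
exists (n + m)%N, (fun k : 'I_(n + m) => match fintype.split k with inl i => j i | inr i => j' i end).
exists (fun k : 'I_(n + m) => match fintype.split k with inl i => f i | inr i => f' i end); split.
  by move=> k; case: (fintype.split k).
rewrite big_split_ord; congr (_ + _); apply: eq_bigr => i _.
  by have := unsplitK (inl i : 'I_n + 'I_m) => /= ->.
by have := unsplitK (inr i : 'I_n + 'I_m) => /= ->.
Qed.

Lemma sum_of_sub (X : Type) (F : X -> set A) i : F i `<=` sum_of F.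
Proof. by move=> x Fx; exists 1%N, (fun=> i), (fun=> x); rewrite big_ord1. Qed.

Lemma sum_of_map (X : Type) (F : X -> set A) (f : A -> A) :
  f 0 = 0 -> (forall x y, f (x + y) = f x + f y) ->
  (forall i x, F i x -> F i (f x)) -> forall x, sum_of F x -> sum_of F (f x).
Proof.
move=> f0 fD Ff _ [n [j [g [hg ->]]]]; exists n, j, (f \o g); split.
  by move=> k; apply: Ff.
by elim/big_rec2: _ => // i _ y _ <-; rewrite fD.
Qed.

Lemma sum_of_min (X : Type) (F : X -> set A) V : closed_subspace V ->
  (forall i, F i `<=` V) -> closure (sum_of F) `<=` V.
Proof.
move=> cV FV; have [clV V0 _] := cV.
rewrite closureE; apply: smallest_sub => // _ [n [j [f [hf ->]]]].
by elim/big_rec: _ => // i x _ Vx; apply: csubD => //; apply: FV (hf i).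
Qed.

Lemma closure_map (S : set A) (f : A -> A) (M : R) :
  (forall x y, nr (f x - f y) <= M * nr (x - y)) ->
  (forall x, S x -> S (f x)) -> forall x, closure S x -> closure S (f x).
Proof.
move=> fM fS x /closureP Sx; apply/closureP => e e0.
have M0 : 0 < `|M| + 1 by rewrite ltr_wpDl.
have [y Sy xy] := Sx _ (divr_gt0 e0 M0); exists (f y); first exact: fS.
apply: le_lt_trans (fM _ _) _; move: xy; rewrite ltr_pdivlMr//; apply: le_lt_trans.
rewrite mulrC ler_wpM2l ?nr_ge0// (le_trans (ler_norm _))// lerDl//.
Qed.

Lemma closure_sum_cideal (X : Type) (F : X -> set A) : (forall i, cideal (F i)) ->
  cideal (closure (sum_of F)).
Proof.
move=> hF; have j0 : 'I_0 -> X by case.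
have s0 : sum_of F 0 by exists 0%N, j0, (fun=> 0); rewrite big_ord0; split=> // -[].
apply/cidealP; split; last first.
  move=> b x hx; split.
  - apply: (@closure_map _ (cstar_mul b) (nr b)) hx => [y z|y].
      by rewrite -mulxB nrM.
    by apply: sum_of_map => [|u v|i z]; [exact: mulx0|exact: cstar_mulDr|exact: cidealMl].
  - apply: (@closure_map _ (cstar_mul^~ b) (nr b)) hx => [y z|y] /=.
      by rewrite -mulBx mulrC nrM.
    by apply: (sum_of_map (f := cstar_mul^~ b)) => [|u v|i z]; [exact: mul0x|exact: cstar_mulDl|exact: cidealMr].
split; [exact: closed_closure|exact: subset_closure|].
move=> c x y /closureP hx /closureP hy; apply/closureP => e e0.
have M0 : 0 < complex.Re `|c| + 1.
  rewrite ltr_wpDl//; have : 0 <= `|c| by [].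
  by rewrite lecE => /andP[].
have [x' sx xx'] := hx _ (divr_gt0 (divr_gt0 e0 (ltr0Sn R 1)) M0).
have [y' sy yy'] := hy _ (divr_gt0 e0 (ltr0Sn R 1)).
exists (c *: x' + y').
  apply: sum_of_add => //; apply: (sum_of_map (f := fun x => c *: x)) sx => [|u v|i u].
  - exact: scaler0.
  - exact: scalerDr.
  - by move=> Fu; apply: csubZ => //; apply: cideal_sub.
rewrite opprD addrACA -scalerBr (splitr e); apply: le_lt_trans (nrD _ _) _.
rewrite ltrD// nrZc; move: xx'; rewrite ltr_pdivlMr//; apply: le_lt_trans.
by rewrite mulrC ler_wpM2l ?nr_ge0// lerDl.
Qed.

Lemma closure_sum_star (X : Type) (F : X -> set A) : (forall i, star_closed (F i)) ->
  star_closed (closure (sum_of F)).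
Proof.
move=> hF x; apply: (@closure_map _ (@cstar_adj R A) 1) => [y z|y].
  by rewrite -adjB nr_adj mul1r.
by apply: sum_of_map => [|u v|i z]; [exact: adj0|exact: cstar_adjD|exact: hF].
Qed.

End Ideals.

(** * Hereditary subalgebras and minimal projections *)

Definition minproj (R : realType) (A : cstarAlgType R) (p : A) : Prop :=
  [/\ p <> 0, p^# = p, p ** p = p & forall a, exists c : R[i], p ** a ** p = c *: p].

Section Hereditary.
Variables (R : realType) (A : cstarAlgType R).
Implicit Types (a b e p q s x y z : A) (C I J V : set A).

(** Heredity in its algebraic form, [C A C] inside [C], which for C*-subalgebras is equivalent to
    the order-theoretic one. *)
Definition her C := [/\ closed_subspace C, forall x y, C x -> C y -> C (x ** y),
  star_closed C & forall c a c', C c -> C c' -> C (c ** a ** c')].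

Lemma cideal_her J : cideal J -> star_closed J -> her J.
Proof.
move=> cJ sJ; split=> //; first exact: cideal_sub.
- by move=> x y Jx Jy; apply: cidealMl.
- by move=> c a c' Jc Jc'; apply: cidealMl.
Qed.

Lemma closed_subspaceI C C' : closed_subspace C -> closed_subspace C' ->
  closed_subspace (C `&` C').
Proof.
move=> [cC C0 lC] [cC' C'0 lC']; split=> //; first exact: closedI.
by move=> c x y [? ?] [? ?]; split; [apply: lC|apply: lC'].
Qed.

Lemma herI C C' : her C -> her C' -> her (C `&` C').
Proof.
move=> [cC mC sC hC] [cC' mC' sC' hC']; split.
- exact: closed_subspaceI.
- by move=> x y [? ?] [? ?]; split; [apply: mC|apply: mC'].
- by move=> x [? ?]; split; [apply: sC|apply: sC'].
- by move=> c a c' [? ?] [? ?]; split; [apply: hC|apply: hC'].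
Qed.

Lemma kernel_subspace (f : A -> A) (M : R) :
  (forall (c : R[i]) x y, f (c *: x + y) = c *: f x + f y) ->
  (forall x, nr (f x) <= M * nr x) -> closed_subspace [set x | f x = 0].
Proof.
move=> fl fM; have f0 : f 0 = 0.
  by have := fl 1 0 0; rewrite !scale1r addr0 -[X in X = _]addr0 => /addrI.
split=> //=.
- apply: (closed_kernel (M := M)) => // x y.
  by rewrite addrC -scaleN1r fl scaleN1r addrC.
- by move=> c x y fx fy; rewrite fl fx fy scaler0 addr0.
Qed.

Definition perp J : set A := [set a | forall j, J j -> a ** j = 0].

Section Perp.
Variable J : set A.
Hypotheses (cJ : cideal J) (sJ : star_closed J).

(** [(j a) (j a)^# = j (a (a^# j^#))], and [a^# j^#] is again in [J]. *)
Lemma perp_right a j : perp J a -> J j -> j ** a = 0.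
Proof.
move=> ha hj; apply: mul_adj_eq0; rewrite cstar_adjM -cstar_mulA.
rewrite [a ** _](_ : _ = 0) ?mulx0//; apply: ha.
by apply: (cidealMl _ cJ); exact: sJ.
Qed.

Lemma perp_cideal : cideal (perp J).
Proof.
apply/cidealP; split; last first.
  move=> b x hx; split=> j hj; first by rewrite -cstar_mulA hx// mulx0.
  by rewrite -cstar_mulA hx//; exact: (cidealMl _ cJ).
have -> : perp J = \bigcap_(j in J) [set a | a ** j = 0].
  by apply/seteqP; split.
have h j : closed_subspace [set a : A | a ** j = 0].
  apply: (@kernel_subspace (cstar_mul^~ j) (nr j)) => [c x y|x] /=.
    by rewrite cstar_mulDl mulZx.
  by rewrite mulrC nrM.
split.
- by apply: closed_bigI => j _; have [] := h j.
- by move=> j _; have [] := h j.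
- by move=> c x y hx hy j Jj; have [_ _] := h j; apply; [apply: hx|apply: hy].
Qed.

Lemma perp_star : star_closed (perp J).
Proof.
move=> a ha j hj; rewrite -[j]cstar_adjK -cstar_adjM perp_right ?adj0//.
exact: sJ.
Qed.

Lemma perp_disjoint x : J x -> perp J x -> x = 0.
Proof. by move=> jx px; apply: mul_adj_eq0; apply: px; exact: sJ. Qed.

End Perp.

Definition orth g : set A := [set z | g ** z = 0 /\ z ** g = 0].

Lemma orth_her g : g^# = g -> her (orth g).
Proof.
move=> ga; split.
- rewrite (_ : orth g = [set z | g ** z = 0] `&` [set z | z ** g = 0])//.
  apply: closed_subspaceI.
    apply: (@kernel_subspace _ (nr g)) => [c x y|x]; last exact: nrM.
    by rewrite cstar_mulDr mulxZ.
  apply: (@kernel_subspace (cstar_mul^~ g) (nr g)) => [c x y|x] /=.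
    by rewrite cstar_mulDl mulZx.
  by rewrite mulrC nrM.
- move=> x y [gx xg] [gy yg]; split; first by rewrite cstar_mulA gx mul0x.
  by rewrite -cstar_mulA yg mulx0.
- move=> x [gx xg]; split; first by rewrite -ga -cstar_adjM xg adj0.
  by rewrite -{1}ga -cstar_adjM gx adj0.
- move=> c a c' [gc cg] [gc' c'g]; split; first by rewrite !cstar_mulA gc !mul0x.
  by rewrite -cstar_mulA c'g mulx0.
Qed.

Definition unitset e : set A := [set z | e ** z = z /\ z ** e = z].

Lemma unitset_her e : e^# = e -> her (unitset e).
Proof.
move=> ea; split.
- rewrite (_ : unitset e = [set z | e ** z - z = 0] `&` [set z | z ** e - z = 0]).
    apply: closed_subspaceI.
      apply: (@kernel_subspace (fun z => e ** z - z) (nr e + 1)) => [c x y|x].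
        by rewrite cstar_mulDr mulxZ scalerBr opprD addrACA.
      by rewrite (le_trans (nrB _ _))// mulrDl mul1r lerD2r nrM.
    apply: (@kernel_subspace (fun z => z ** e - z) (nr e + 1)) => [c x y|x].
      by rewrite cstar_mulDl mulZx scalerBr opprD addrACA.
    by rewrite (le_trans (nrB _ _))// mulrDl mul1r lerD2r mulrC nrM.
  apply/seteqP; split=> z /= [h1 h2]; first by rewrite h1 h2 subrr.
  by split; apply/subr0_eq.
- move=> x y [ex xe] [ey ye]; split; first by rewrite cstar_mulA ex.
  by rewrite -cstar_mulA ye.
- move=> x [ex xe]; split; first by rewrite -{1}ea -cstar_adjM xe.
  by rewrite -{1}ea -cstar_adjM ex.
- move=> c a c' [ec ce] [ec' c'e]; split; first by rewrite !cstar_mulA ec.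
  by rewrite -cstar_mulA c'e.
Qed.

Lemma her_local_unit C x (d : R) : her C -> C x -> 0 < d -> exists a b,
  [/\ C a, C b, a^# = a & b^# = b] /\
  [/\ nr a <= 1, nr b <= 1, nr (x - a ** x) < d & nr (x - a ** (a ** x)) < d] /\
  b ** a = a /\ a ** b = a.
Proof.
move=> [cC mC sC hC] Cx d0.
have [a [b [c [[aa ba _] [[na nb xa xaa] [[ba1 ab1 _ _] h]]]]]] := local_unit x d0.
have Cw : C (x ** x^#) by apply: mC => //; exact: sC.
have [Ca Cb _] := h C cC Cw (fun y Cy => mC _ _ Cw Cy).
by exists a, b.
Qed.

(** Compress [b] to [(1 - k) b (1 - k)]. This is orthogonal to [g] because [k] is a unit for [g],
    and it agrees with [b] modulo [M] because [k] is in [M]: splitting off [g] loses nothing outside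
    [M]. *)
Lemma her_orth_notin C M g k : her C -> cideal M -> C k -> M k -> g^# = g ->
  k^# = k -> g ** k = g -> k ** g = g -> ~ (C `<=` M) -> ~ (C `&` orth g `<=` M).
Proof.
move=> hC cM Ck Mk ga ka gk kg CM CoM; apply: CM => b Cb.
have [cC mC sC _] := hC; have csM := cideal_sub cM.
pose b1 := b - k ** b; pose b2 := b1 - b1 ** k.
have Cb1 : C b1 by apply: csubB => //; exact: mC.
have Cb2 : C b2 by apply: csubB => //; exact: mC.
have ob2 : orth g b2.
  have gb1 : g ** b1 = 0 by rewrite mulxB cstar_mulA gk subrr.
  split; first by rewrite mulxB cstar_mulA gb1 mul0x subrr.
  by rewrite mulBx -cstar_mulA kg subrr.
have Mb2 : M b2 by apply: CoM.
have Mb1 : M b1.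
  by rewrite -[b1](subrK (b1 ** k)); apply: csubD => //; apply: cidealMl.
by rewrite -[b](subrK (k ** b)); apply: csubD => //; apply: cidealMr.
Qed.

(** By [atom_cube] the normalized [h = x x^#] satisfies [h^3 = h], and [p = h^2] is the projection.
    A normalized self-adjoint [b] in [C] with unit [p] has [b^2 = p], since [b^2] and [p - b^2] are
    orthogonal; then [b] is [p] or [- p], since [p - b] and [p + b] are orthogonal. *)
Lemma atom_minproj C : her C ->
  (forall x y, C x -> C y -> x^# = x -> y^# = y -> x ** y = 0 -> x = 0 \/ y = 0) ->
  (exists2 x, C x & x <> 0) -> exists2 p, C p & minproj p.
Proof.
move=> [cC mC sC hC] atom [x Cx x0].
have normalize b : C b -> b^# = b -> b <> 0 ->
    exists2 b', [/\ C b', b'^# = b' & b = (nr b)%:C *: b'] & b' ** b' ** b' = b'.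
  move=> Cb ba b0; have nb := nr_gt0 b0.
  exists ((nr b)^-1%:C *: b).
    split; [exact: csubZ|by rewrite adjZr ba|].
    by rewrite scalerA -rmorphM mulfV ?gt_eqF// scale1r.
  apply: (atom_cube cC mC atom); first exact: csubZ.
    by rewrite adjZr ba.
  by rewrite nrZ_ge0 ?invr_ge0 ?(ltW nb)// mulVf// gt_eqF.
have Cw : C (x ** x^#) by apply: mC => //; exact: sC.
have wa : (x ** x^#)^# = x ** x^# by rewrite cstar_adjM cstar_adjK.
have w0 : x ** x^# <> 0 by move/mul_adj_eq0.
have [h [Ch ha hE] h3] := normalize _ Cw wa w0.
have h0 : h <> 0 by move=> h0; apply: w0; rewrite hE h0 scaler0.
pose p := h ** h; have Cp : C p by exact: mC.
have pa : p^# = p by rewrite cstar_adjM ha.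
have pp : p ** p = p by rewrite /p cstar_mulA h3.
have p0 : p <> 0 by move=> p0; apply: h0; apply: adj_mul_eq0; rewrite ha.
clearbody p.
have real_part b : C b -> b^# = b -> p ** b = b -> b ** p = b ->
    exists c : R[i], b = c *: p.
  move=> Cb ba pb bp; have [->|/eqP b0] := eqVneq b 0; first by exists 0; rewrite scale0r.
  have [b' [Cb' b'a bE] b3] := normalize _ Cb ba b0.
  have b'0 : b' <> 0 by move=> b'0; apply: b0; rewrite bE b'0 scaler0.
  have nb := nr_gt0 b0.
  have b'E : b' = (nr b)^-1%:C *: b.
    by rewrite [X in _ = _ *: X]bE scalerA -rmorphM mulVf ?gt_eqF// scale1r.
  have pb' : p ** b' = b' by rewrite b'E mulxZ pb.
  have b'p : b' ** p = b' by rewrite b'E mulZx bp.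
  have r0 : b' ** b' <> 0 by move=> r0; apply: b'0; apply: adj_mul_eq0; rewrite b'a.
  have rp : b' ** b' = p.
    have Cr : C (b' ** b') by exact: mC.
    have [| | | | |//|/subr0_eq//] := atom (b' ** b') (p - b' ** b').
    - by [].
    - exact: csubB.
    - by rewrite cstar_adjM b'a.
    - by rewrite adjB pa cstar_adjM b'a.
    by rewrite mulxB -cstar_mulA b'p cstar_mulA b3 subrr.
  have [| | | | |/subr0_eq eb|/eqP] := atom (p - b') (p + b').
  - exact: csubB.
  - exact: csubD.
  - by rewrite adjB pa b'a.
  - by rewrite cstar_adjD pa b'a.
  - by rewrite mulBx !cstar_mulDr pp pb' b'p rp [b' + p]addrC subrr.
  - by exists (nr b)%:C; rewrite [LHS]bE -eb.
  - rewrite addr_eq0 => /eqP eb; exists (- (nr b)%:C).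
    by rewrite [LHS]bE [in RHS]eb scaleNr scalerN opprK.
exists p => //; split=> // a; pose z := p ** a ** p.
have Cz : C z by exact: hC.
have pz : p ** z = z by rewrite /z !cstar_mulA pp.
have zp : z ** p = z by rewrite /z -cstar_mulA pp.
have za : z^# = p ** a^# ** p by rewrite !cstar_adjM pa cstar_mulA.
have pza : p ** z^# = z^# by rewrite za !cstar_mulA pp.
have zap : z^# ** p = z^# by rewrite za -cstar_mulA pp.
have Cza : C z^# by exact: sC.
(* [real_part] is applied to the real and the imaginary part of [z]. *)
have [i ii ic] : exists2 i : R[i], i * i = -1 & Num.conj i = - i.
  by exists 'i%R; rewrite ?conjCi// -expr2 sqrCi.
have [c1 e1] : exists c : R[i], z + z^# = c *: p.
  apply: real_part; first exact: csubD.
  - by rewrite cstar_adjD cstar_adjK addrC.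
  - by rewrite cstar_mulDr pz pza.
  - by rewrite cstar_mulDl zp zap.
have [c2 e2] : exists c : R[i], i *: (z - z^#) = c *: p.
  apply: real_part; first by apply: csubZ => //; exact: csubB.
  - by rewrite cstar_adjZ adjB cstar_adjK ic scaleNr -scalerN opprB.
  - by rewrite mulxZ mulxB pz pza.
  - by rewrite mulZx mulBx zp zap.
exists (2^-1 * (c1 - i * c2)); rewrite -/z -scalerA scalerBl -scalerA -e1 -e2 scalerA.
rewrite ii scaleN1r opprK addrACA subrr addr0.
by rewrite -mulr2n -[z *+ 2]scaler_nat scalerA mulVf ?pnatr_eq0// scale1r.
Qed.

End Hereditary.

Lemma geometric_series (R : realType) (V : completeNormedModType R[i]) (u : nat -> V) :
  (forall n, nr (u n) <= 2^-1 ^+ n) -> exists l, nlim (fun n => \sum_(i < n) u i) l.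
Proof.
move=> hu; pose z n := \sum_(i < n) u i.
have q0 i : 0 <= (2^-1 : R) ^+ i by rewrite exprn_ge0// invr_ge0 ler0n.
have dz m k : nr (z (k + m)%N - z m) <= (1 - 2^-1 ^+ k) * (2 * 2^-1 ^+ m).
  elim: k => [|k IH]; first by rewrite add0n subrr nr0 expr0 subrr mul0r.
  rewrite addSn (le_trans (nr_dist _ (z (k + m)%N) _))//.
  have h1 : nr (z (k + m).+1 - z (k + m)%N) <= 2^-1 ^+ k * 2^-1 ^+ m.
    by rewrite /z big_ord_recr /= addrAC subrr add0r -exprD.
  apply: le_trans (lerD h1 IH) _; rewrite exprS.
  move: ((2^-1 : R) ^+ k) ((2^-1 : R) ^+ m) => q r.
  by rewrite le_eqVlt; apply/orP; left; apply/eqP; field.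
apply: nlim_cauchy => d d0.
have [N hN] := @natSinv_small R _ (divr_gt0 d0 (ltr0Sn R 1)).
exists N => m n Nm Nn; wlog mn : m n Nm Nn / (m <= n)%N.
  by move=> H; case: (leqP m n) => [|/ltnW] /H; [|rewrite nrBC]; apply.
rewrite nrBC -(subnK mn); apply: le_lt_trans (dz _ _) _.
apply: (@le_lt_trans _ _ (2 * 2^-1 ^+ m)).
  by rewrite ler_piMl ?mulr_ge0// gerBl.
rewrite mulrC -ltr_pdivlMr//; apply: le_lt_trans (hN m Nm).
rewrite exprVn lef_pV2 ?posrE ?exprn_gt0 ?ltr0n//.
by rewrite -natrX ler_nat ltn_expl.
Qed.

(** * Quasi-centralizers *)

Section QuasiCentralizer.
Variables (R : realType) (A : cstarAlgType R) (T : A -> A -> A).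
Local Notation K := (pedersen_ideal [set: A]).
Hypothesis hT : quasi_centralizer K T.
Implicit Types (a b e p q s x y z : A) (C I V : set A).

(** The axiom covers only [a] in K(A). After multiplication by [z] in K(A) both sides become
    [T(z a x, y)], because [z a] is in K(A) too, and K(A) separates points. *)
Lemma quasiMl a x y : K x -> K y -> T (a ** x) y = a ** T x y.
Proof.
move=> Kx Ky; apply/subr0_eq/pedersen_faithful => z Kz.
have [_ _ _ TM _] := hT; rewrite mulxB -TM//; last exact: pedersenMl.
by rewrite !cstar_mulA -TM// ?subrr//; exact: pedersenMr.
Qed.

Lemma pedersen_rfaithful d : (forall z, K z -> d ** z = 0) -> d = 0.
Proof.
move=> h; rewrite -[d]cstar_adjK [d^#](_ : _ = 0) ?adj0//.
apply: nr_small => e e0.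
have [a [b [c [[aa _ _] [[_ _ da _] [[ba _ _ _] _]]]]]] := local_unit d^# e0.
move: da; rewrite -{1}aa -cstar_adjM h ?adj0 ?subr0; first exact: ltW.
exact: pedersen_local_unit ba.
Qed.

Lemma quasiMr b x y : K x -> K y -> T x (y ** b) = T x y ** b.
Proof.
move=> Kx Ky; apply/subr0_eq/pedersen_rfaithful => z Kz.
have [_ _ _ _ TM] := hT; rewrite mulBx -TM//; last exact: pedersenMr.
by rewrite -!cstar_mulA -TM// ?subrr//; exact: pedersenMl.
Qed.

Let K0 : K 0. Proof. by have [] := @pedersen_two_sided R A. Qed.

Lemma quasi0l y : K y -> T 0 y = 0.
Proof. by move=> Ky; rewrite -[in LHS](mul0x (0 : A)) quasiMl// mul0x. Qed.

Lemma quasi0r x : K x -> T x 0 = 0.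
Proof. by move=> Kx; rewrite -[in LHS](mulx0 (0 : A)) quasiMr// mulx0. Qed.

Lemma quasiZl (c : R[i]) x y : K x -> K y -> T (c *: x) y = c *: T x y.
Proof.
move=> Kx Ky; have [_ Tl _ _ _] := hT.
by rewrite -[c *: x]addr0 Tl// quasi0l// addr0.
Qed.

Lemma quasiZr (c : R[i]) x y : K x -> K y -> T x (c *: y) = c *: T x y.
Proof.
move=> Kx Ky; have [_ _ Tr _ _] := hT.
by rewrite -[c *: y]addr0 Tr// quasi0r// addr0.
Qed.

Definition qbounded (q : A) (M : R) := forall x y, K x -> K y ->
  nr x <= 1 -> nr y <= 1 -> nr (q ** T x y ** q) <= M.

Lemma qbounded_homo q M x y : qbounded q M -> K x -> K y ->
  nr (q ** T x y ** q) <= M * nr x * nr y.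
Proof.
move=> hq Kx Ky.
have [->|/eqP/nr_gt0 x0] := eqVneq x 0.
  by rewrite quasi0l// mulx0 mul0x nr0 mulr0 mul0r.
have [->|/eqP/nr_gt0 y0] := eqVneq y 0.
  by rewrite quasi0r// mulx0 mul0x nr0 mulr0.
have := hq ((nr x)^-1%:C *: x) ((nr y)^-1%:C *: y).
rewrite quasiZl//; last exact: pedersenZ.
rewrite quasiZr// !mulxZ !mulZx !nrZ_ge0 ?invr_ge0 ?nr_ge0//.
rewrite !mulVf ?gt_eqF// => /(_ _ _ (lexx _) (lexx _)) h.
have {}h := h (pedersenZ _ Kx) (pedersenZ _ Ky).
by rewrite -ler_pdivrMr// -ler_pdivrMr// mulrC [_ / nr y]mulrC.
Qed.

Definition tbounded I := exists M, forall s x y, I s -> K x -> K y ->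
  nr (s ** T x y) <= M * nr s * nr x * nr y.

(** A record type, so that it can index [sum_of] and later serve as the family in
    [locally_bounded]. *)
Record fam := Fam { fam_set : set A; fam_cideal : cideal fam_set;
  fam_star : star_closed fam_set; fam_bounded : tbounded fam_set }.

Definition tideal : set A := closure (sum_of fam_set).

Lemma tideal_cideal : cideal tideal.
Proof. by apply: closure_sum_cideal => -[]. Qed.

Lemma tideal_star : star_closed tideal.
Proof. by apply: closure_sum_star => -[]. Qed.

(** The ideal generated by [q'] belongs to the family, with the same [M]. Test [s T(x, y)] on both
    sides by [z] and [z'] with [z q = z] and [z' q = z']: then
    [z'^# s T(x, y) z = q T(z'^# s x, y z) q]. Such [z] separate the ideal, since they include all
    [a q']. *)
Lemma qbounded_tideal q q' M : q^# = q -> q'^# = q' -> q ** q' = q' ->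
  qbounded q M -> tideal q'.
Proof.
move=> qa q'a qq' hq.
have M0 : 0 <= M.
  have := hq 0 0 K0 K0; rewrite nr0 quasi0l// mulx0 mul0x nr0; apply; exact: ler01.
have gI := gideal_cideal q'; have gs := gideal_star q'a.
have q'q : q' ** q = q' by rewrite -{1}q'a -{1}qa -cstar_adjM qq'.
have test t (N : R) : gideal q' t -> 0 <= N ->
    (forall z, z ** q = z -> nr z <= 1 -> nr (t ** z) <= N) -> nr t <= N.
  move=> gt N0 ht; apply: (norm_test (C := gideal q') (Z := [set z | z ** q = z])) gt N0 ht.
  - exact: cideal_sub.
  - by move=> x y gx gy; exact: (cidealMl _ gI).
  - exact: gs.
  - by move=> c z _ /= zq; rewrite -cstar_mulA zq.
  - by move=> c z /= zq; rewrite mulZx zq.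
  - move=> c gc cz; apply: mul_adj_eq0.
    apply: (@annihilator_gideal _ _ c q' _ _ _ (gs _ gc)) => [a|].
      by rewrite -cstar_mulA cz//= -cstar_mulA q'q.
    by rewrite cz//= q'q.
have hfam : tbounded (gideal q').
  exists M => s x y gsx Kx Ky.
  have B0 : 0 <= M * nr s * nr x * nr y by rewrite !mulr_ge0// nr_ge0.
  apply: (test) => //; first exact: (cidealMr _ gI).
  move=> z zq nz; rewrite -nr_adj; apply: (test) => //.
    by apply: gs; do 2 apply: (cidealMr _ gI).
  move=> z' z'q nz'.
  have -> : nr ((s ** T x y ** z)^# ** z') = nr (q ** T (z'^# ** s ** x) (y ** z) ** q).
    rewrite -nr_adj cstar_adjM cstar_adjK quasiMl//; last exact: pedersenMr.
    by rewrite quasiMr// -{1}z'q -{1}zq cstar_adjM qa !cstar_mulA.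
  have Kz1 : K (z'^# ** s ** x) by exact: pedersenMl.
  have Kz2 : K (y ** z) by exact: pedersenMr.
  apply: le_trans (qbounded_homo hq Kz1 Kz2) _.
  have h1 : nr (z'^# ** s ** x) <= nr s * nr x.
    rewrite (le_trans (nrM _ _))// ler_wpM2r ?nr_ge0// (le_trans (nrM _ _))//.
    by rewrite nr_adj ler_piMl ?nr_ge0.
  have h2 : nr (y ** z) <= nr y.
    by rewrite (le_trans (nrM _ _))// ler_piMr ?nr_ge0.
  rewrite -!mulrA ler_wpM2l// mulrA; apply: ler_pM; rewrite ?nr_ge0//.
apply: subset_closure.
apply: (@sum_of_sub _ _ _ fam_set (Fam gI gs hfam)); exact: gideal_self.
Qed.

Definition tperp : set A := perp tideal.

Lemma tperp_right a j : tperp a -> tideal j -> j ** a = 0.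
Proof. exact: perp_right tideal_cideal tideal_star a j. Qed.

Lemma tperp_cideal : cideal tperp.
Proof. exact: perp_cideal tideal_cideal. Qed.

Lemma tperp_star : star_closed tperp.
Proof. exact: perp_star tideal_cideal tideal_star. Qed.

Lemma tideal_tperp x : tideal x -> tperp x -> x = 0.
Proof. exact: perp_disjoint tideal_star x. Qed.

Lemma not_qbounded q (N : R) : ~ (exists M, qbounded q M) -> exists x y,
  [/\ K x, K y, nr x <= 1 & nr y <= 1] /\ N < nr (q ** T x y ** q).
Proof.
move=> h; apply: contrapT => h'; apply: h; exists N => x y Kx Ky nx ny.
by rewrite leNgt; apply/negP => hN; apply: h'; exists x, y.
Qed.

(* Gliding hump: [x = sum 2^-n g_n x_n] and [y = sum 2^-n y_n g_n] lie in [K]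
   because of [e], but [g_n T(x, y) g_n] is unbounded. *)
Lemma gliding_hump e (P : set A -> Prop) : K e ->
  (forall C, P C -> C `<=` unitset e) ->
  (forall (N : R) C, 0 <= N -> P C -> exists g C',
    [/\ C g, g^# = g, nr g <= 1 &
      exists x y, [/\ K x, K y, nr x <= 1 & nr y <= 1] /\
        N <= nr (g ** g ** T x y ** (g ** g))] /\
    [/\ P C', C' `<=` C & C' `<=` orth g]) ->
  forall C, ~ P C.
Proof.
move=> Ke Pe step C0 PC0.
pose st := {C | P C}.
(* A state is the current algebra with its proof of [P]. The lower bound [n 4^n] pays for the two
   weights [2^-n] in [x] and [y]. *)
pose good (nC : nat * st) (r : (A * A * A) * st) :=
  let: (g, x, y) := r.1 in
  [/\ sval nC.2 g, g^# = g & nr g <= 1] /\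
  [/\ K x, K y, nr x <= 1 & nr y <= 1] /\
  nC.1%:R * (2 ^+ nC.1 * 2 ^+ nC.1) <= nr (g ** g ** T x y ** (g ** g)) /\
  sval r.2 `<=` sval nC.2 /\ sval r.2 `<=` orth g.
have /choice[F hF] : forall nC, exists r, good nC r.
  move=> [n [C PC]]; have N0 : 0 <= n%:R * (2 ^+ n * 2 ^+ n) :> R.
    by rewrite !mulr_ge0// exprn_ge0.
  have [g [C' [[Cg ga ng [x [y [hxy hN]]]] [PC' C'C C'g]]]] := step _ _ N0 PC.
  by exists ((g, x, y), exist _ C' PC').
pose S := fix S n : st := if n is n'.+1 then (F (n', S n')).2 else exist _ C0 PC0.
pose g n := (F (n, S n)).1.1.1; pose xx n := (F (n, S n)).1.1.2.
pose yy n := (F (n, S n)).1.2.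
have HF n : [/\ sval (S n) (g n), (g n)^# = g n & nr (g n) <= 1] /\
  [/\ K (xx n), K (yy n), nr (xx n) <= 1 & nr (yy n) <= 1] /\
  n%:R * (2 ^+ n * 2 ^+ n) <= nr (g n ** g n ** T (xx n) (yy n) ** (g n ** g n)) /\
  sval (S n.+1) `<=` sval (S n) /\ sval (S n.+1) `<=` orth (g n).
  have := hF (n, S n); rewrite /good [S n.+1]/= /g /xx /yy.
  by case: (F (n, S n)) => [[[? ?] ?] ?].
have SS m k : sval (S (k + m)%N) `<=` sval (S m).
  elim: k => // k IH; have [_ [_ [_ [h _]]]] := HF (k + m)%N.
  exact: subset_trans h IH.
have orth_lt m n : (m < n)%N -> g m ** g n = 0 /\ g n ** g m = 0.
  move=> mn; have [_ [_ [_ [_]]]] := HF m; apply.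
  have [[Sg _ _] _] := HF n; rewrite -(subnK mn) in Sg *.
  exact: SS Sg.
have orth_ne m n : m <> n -> g m ** g n = 0.
  move=> /eqP; rewrite neq_ltn => /orP[] /orth_lt[]//.
have eg n : e ** g n = g n /\ g n ** e = g n.
  by have [[Sg _ _] _] := HF n; apply: (Pe _ (svalP (S n))).
have nq n : 0 <= (2^-1 : R) ^+ n by rewrite exprn_ge0// invr_ge0 ler0n.
pose u n := ((2^-1 : R) ^+ n)%:C *: (g n ** xx n).
pose v n := ((2^-1 : R) ^+ n)%:C *: (yy n ** g n).
have nu n : nr (u n) <= 2^-1 ^+ n.
  have [[_ _ ng] [[_ _ nx _] _]] := HF n.
  rewrite nrZ_ge0// ler_piMr// (le_trans (nrM _ _))// -[leRHS]mulr1.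
  by rewrite ler_pM ?nr_ge0.
have nv n : nr (v n) <= 2^-1 ^+ n.
  have [[_ _ ng] [[_ _ _ ny] _]] := HF n.
  rewrite nrZ_ge0// ler_piMr// (le_trans (nrM _ _))// -[leRHS]mulr1.
  by rewrite ler_pM ?nr_ge0.
have [x xl] := geometric_series nu; have [y yl] := geometric_series nv.
have mull a (w : nat -> A) n : a ** (\sum_(i < n) w i) = \sum_(i < n) a ** w i.
  by elim/big_rec2: _ => [|i z1 z2 _ <-]; rewrite ?mulx0 ?cstar_mulDr.
have mulr a (w : nat -> A) n : (\sum_(i < n) w i) ** a = \sum_(i < n) w i ** a.
  by elim/big_rec2: _ => [|i z1 z2 _ <-]; rewrite ?mul0x ?cstar_mulDl.
have liml a (w : nat -> A) l : nlim w l -> nlim (fun n => a ** w n) (a ** l).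
  by apply: (nlim_map (M := nr a)) => x' y'; rewrite -mulxB nrM.
have limr a (w : nat -> A) l : nlim w l -> nlim (fun n => w n ** a) (l ** a).
  apply: (nlim_map (f := cstar_mul^~ a) (M := nr a)) => x' y'.
  by rewrite -mulBx mulrC nrM.
(* Partial sums in K(A) do not put the limit there; [e x = x] with [e] in K(A) does. *)
have Kx : K x.
  suff <- : e ** x = x by apply: pedersenMr.
  apply: nlim_uniq (liml e _ _ xl) _; move: xl; congr nlim; apply/funext => n.
  rewrite mull; apply: eq_bigr => i _.
  by rewrite /u mulxZ cstar_mulA (eg i).1.
have Ky : K y.
  suff <- : y ** e = y by apply: pedersenMl.
  apply: nlim_uniq (limr e _ _ yl) _; move: yl; congr nlim; apply/funext => n.
  rewrite mulr; apply: eq_bigr => i _.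
  by rewrite /v mulZx -cstar_mulA (eg i).2.
(* By orthogonality only the [n]-th term survives, and it picks up a second factor [g n]; whence the
   squares [g ** g] in the hypothesis. *)
have gx n : g n ** x = ((2^-1 : R) ^+ n)%:C *: (g n ** g n ** xx n).
  apply: nlim_uniq (liml (g n) _ _ xl) _ => d d0; exists n.+1 => m nm.
  rewrite mull (bigD1 (Ordinal nm))//= big1 ?addr0; last first.
    move=> i /eqP ine; rewrite /u mulxZ cstar_mulA orth_ne ?mul0x ?scaler0// => ni.
    by apply: ine; apply: val_inj.
  by rewrite /u mulxZ cstar_mulA subrr nr0.
have yg n : y ** g n = ((2^-1 : R) ^+ n)%:C *: (yy n ** (g n ** g n)).
  apply: nlim_uniq (limr (g n) _ _ yl) _ => d d0; exists n.+1 => m nm.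
  rewrite mulr (bigD1 (Ordinal nm))//= big1 ?addr0; last first.
    move=> i /eqP ine; rewrite /v mulZx -cstar_mulA orth_ne ?mulx0 ?scaler0// => ni.
    by apply: ine; apply: val_inj.
  by rewrite /v mulZx -cstar_mulA subrr nr0.
have big n : n%:R <= nr (T x y).
  have [[_ _ ng] [[Kxn Kyn _ _] [hN _]]] := HF n.
  have : nr (g n ** T x y ** g n) <= nr (T x y).
    rewrite (le_trans (nrM _ _))// (le_trans (ler_wpM2l (nr_ge0 _) ng))// mulr1.
    by rewrite (le_trans (nrM _ _))// ler_piMl ?nr_ge0.
  apply: le_trans; rewrite -quasiMl// -quasiMr//; last exact: pedersenMl.
  have K1 : K (g n ** g n ** xx n) by exact: pedersenMl.
  have K2 : K (yy n ** (g n ** g n)) by exact: pedersenMr.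
  rewrite gx yg quasiZl ?quasiZr ?quasiMl ?quasiMr//; last exact: pedersenZ.
  rewrite !nrZ_ge0//.
  have p2 : 0 < (2 ^+ n : R) by rewrite exprn_gt0// ltr0n.
  rewrite exprVn mulrA -invfM [leRHS]mulrC ler_pdivlMr ?mulr_gt0//.
  by rewrite cstar_mulA.
have := big (Num.trunc (nr (T x y))).+1.
by rewrite leNgt truncnS_gt.
Qed.

End QuasiCentralizer.

(** * The decomposition *)

Section OrthogonalSum.
Variables (R : realType) (A : cstarAlgType R).
Implicit Types (x y : A) (I J : set A).

Definition sum_set I J : set A := [set x | exists a b, [/\ I a, J b & x = a + b]].

(** [|a|^2 = |a a^#| = |(a + b) a^#|], since [b a^# = 0]. *)
Lemma nr_orth_sum I J a b : star_closed I -> star_closed J ->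
  (forall x y, I x -> J y -> x ** y = 0) -> I a -> J b -> nr a <= nr (a + b).
Proof.
move=> sI sJ IJ Ia Jb; have [->|/eqP/nr_gt0 a0] := eqVneq a 0; first by rewrite nr0 nr_ge0.
rewrite -(ler_pM2r a0) -expr2 -nr_cstarr.
have ba : b ** a^# = 0.
  by rewrite -[_ ** _]cstar_adjK cstar_adjM cstar_adjK IJ ?adj0//; exact: sJ.
by rewrite -[a ** a^#]addr0 -ba -cstar_mulDl -[in leRHS](nr_adj a) nrM.
Qed.

(** Only closedness is at stake: by [nr_orth_sum] the components of an approximating sequence are
    Cauchy. *)
Lemma sum_set_cideal I J : cideal I -> cideal J -> star_closed I -> star_closed J ->
  (forall x y, I x -> J y -> x ** y = 0) -> cideal (sum_set I J).
Proof.
move=> cI cJ sI sJ IJ; have cIs := cideal_sub cI; have cJs := cideal_sub cJ.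
have [clI I0 lI] := cIs; have [clJ J0 lJ] := cJs.
apply/cidealP; split; last first.
  move=> b _ [x [y [Ix Jy ->]]]; split.
    exists (b ** x), (b ** y); split; [exact: (cidealMl _ cI)|exact: (cidealMl _ cJ)|].
    exact: cstar_mulDr.
  exists (x ** b), (y ** b); split; [exact: (cidealMr _ cI)|exact: (cidealMr _ cJ)|].
  exact: cstar_mulDl.
split.
- apply/closedP => x hx.
  have /choice[z hz] : forall n : nat, exists ab : A * A,
      [/\ I ab.1, J ab.2 & nr (x - (ab.1 + ab.2)) < n.+1%:R^-1].
    move=> n; have [|_ [a [b [Ia Jb ->]]] xab] := hx n.+1%:R^-1; first by rewrite invr_gt0 ltr0n.
    by exists (a, b).
  have hd m n : nr ((z m).1 - (z n).1) <= m.+1%:R^-1 + n.+1%:R^-1.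
    have [Im Jm xm] := hz m; have [In Jn xn] := hz n.
    apply: le_trans (nr_orth_sum sI sJ IJ (csubB cIs Im In) (csubB cJs Jm Jn)) _.
    rewrite addrACA -opprD; apply: le_trans (nr_dist _ x _) _.
    by rewrite lerD ?(ltW xn)// nrBC ltW.
  have [a al] : exists a, nlim (fun n => (z n).1) a.
    apply: nlim_cauchy => e e0.
    have [N hN] := natSinv_small (divr_gt0 e0 (ltr0Sn R 1)).
    exists N => m n /hN h1 /hN h2; apply: le_lt_trans (hd m n) _.
    by rewrite (splitr e) ltrD.
  have Ia : I a by apply: nlim_closed al => // n; have [] := hz n.
  have bl : nlim (fun n => (z n).2) (x - a).
    move=> e e0; have e20 := divr_gt0 e0 (ltr0Sn R 1).
    have [N hN] := natSinv_small e20; have [N' hN'] := al _ e20.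
    exists (maxn N N') => n; rewrite geq_max => /andP[/hN h1 /hN' h2].
    have [_ _ /ltW h3] := hz n.
    have -> : (z n).2 - (x - a) = - (x - ((z n).1 + (z n).2)) - ((z n).1 - a).
      by rewrite !opprB [RHS]addrC !addrA subrK [_ + a]addrC.
    apply: le_lt_trans (nrB _ _) _; rewrite nrN (splitr e) ltrD//.
    exact: le_lt_trans h1.
  exists a, (x - a); split=> //; last by rewrite addrC subrK.
  by apply: nlim_closed bl => // n; have [] := hz n.
- by exists 0, 0; rewrite addr0.
- move=> c _ _ [x [y [Ix Jy ->]]] [x' [y' [Ix' Jy' ->]]].
  exists (c *: x + x'), (c *: y + y'); split; [exact: lI|exact: lJ|].
  by rewrite scalerDr addrACA.
Qed.

(** Polarization: [4 v2^# t v1] is the sum of [c B(c)] over [c = 1, -1, i, -i], so the four [B(c)]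
    cannot all have norm at most [M]. *)
Lemma polarization_witness (t v1 v2 : A) (M : R) : M < nr (v2^# ** t ** v1) ->
  exists c : R[i], complex.Re `|c| = 1 /\
    M < nr ((v1 + c *: v2)^# ** t ** (v1 + c *: v2)).
Proof.
move=> hM.
have [i ii ic] : exists2 i : R[i], i * i = -1 & Num.conj i = - i.
  by exists 'i%R; rewrite ?conjCi// -expr2 sqrCi.
pose B (c : R[i]) := (v1 + c *: v2)^# ** t ** (v1 + c *: v2).
pose p := v1^# ** t ** v1 + v2^# ** t ** v2.
pose q := v1^# ** t ** v2; pose r := v2^# ** t ** v1.
have BE c : Num.conj c * c = 1 -> c *: B c = c *: p + (c * c) *: q + r.
  move=> cc; rewrite /B cstar_adjD cstar_adjZ !cstar_mulDl !cstar_mulDr !mulZx !mulxZ.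
  rewrite [_ *: (c *: _)]scalerA cc scale1r [X in _ + X]addrC addrACA -/p -/q -/r.
  by rewrite !scalerDr !scalerA [c * _^*]mulrC cc scale1r addrA.
have pairE c : Num.conj c * c = 1 -> c *: B c + (- c) *: B (- c) = ((c * c) *: q + r) *+ 2.
  move=> cc; have cc' : Num.conj (- c) * - c = 1 by rewrite rmorphN mulrNN.
  rewrite !BE// mulrNN scaleNr -[c *: p + _ + r]addrA -[- _ + _ + r]addrA.
  by rewrite addrACA subrr add0r.
have iN (c : R[i]) : Num.conj c * c = 1 -> complex.Re `|c| = 1.
  move=> cc; have : `|c| ^+ 2 = 1 by rewrite normCK mulrC.
  by move=> /eqP; rewrite sqrp_eq1// => /eqP ->.
have c1 : Num.conj (1 : R[i]) * 1 = 1 by rewrite rmorph1 mulr1.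
have ci : Num.conj i * i = 1 by rewrite ic mulNr ii opprK.
have cN (c : R[i]) : Num.conj c * c = 1 -> Num.conj (- c) * - c = 1.
  by rewrite rmorphN mulrNN.
have sumE : r *+ 4 = 1 *: B 1 + (- 1) *: B (- 1) + (i *: B i + (- i) *: B (- i)).
  rewrite !pairE// ii mulr1 scale1r scaleN1r -mulrnDl addrACA subrr add0r.
  by rewrite -mulr2n -mulrnA.
apply: contrapT => hn.
have bound c : Num.conj c * c = 1 -> nr (c *: B c) <= M.
  move=> cc; rewrite nrZc (iN c cc) mul1r leNgt; apply/negP => h; apply: hn.
  by exists c; rewrite iN.
have : nr (r *+ 4) <= M + M + (M + M).
  rewrite sumE (le_trans (nrD _ _))// lerD// (le_trans (nrD _ _))// lerD// bound//; exact: cN.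
rewrite -scaler_nat -(rmorph_nat (real_complex R)) nrZ_ge0 ?ler0n//.
by move: hM; rewrite -/r; lra.
Qed.

End OrthogonalSum.

(** * The two summands and local boundedness *)

Section Decomposition.
Variables (R : realType) (A : cstarAlgType R) (T : A -> A -> A).
Local Notation K := (pedersen_ideal [set: A]).
Hypothesis hT : quasi_centralizer K T.
Implicit Types (a b e p q s x y z : A) (C I V : set A).
Local Notation J := (tideal T).
Local Notation Jp := (tperp T).

Definition hump_elem g := forall N : R, exists x y,
  [/\ K x, K y, nr x <= 1 & nr y <= 1] /\ N <= nr (g ** g ** T x y ** (g ** g)).

(** This is [qbounded_tideal] for [q = g ** g], read backwards. *)
Lemma hump_elemP g q' : g^# = g -> q'^# = q' -> g ** q' = q' -> ~ J q' -> hump_elem g.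
Proof.
move=> ga q'a gq' Jq' N; have [|x [y [h /ltW hN]]] := @not_qbounded _ _ T (g ** g) N.
  case=> M hM; apply: Jq'; apply: (qbounded_tideal hT _ q'a _ hM).
    by rewrite cstar_adjM ga.
  by rewrite -cstar_mulA gq'.
by exists x, y.
Qed.

(** With the tolerance [|x|] the approximate unit [a] of [x] cannot be 0. Being in [Jp] it is then
    not in [J], so its unit [g] carries humps. The last clause keeps [g] in the algebras that
    contain [x]. *)
Lemma tperp_hump x : Jp x -> x^# = x -> x <> 0 -> exists g,
  [/\ g^# = g, nr g <= 1, hump_elem g &
    forall V, closed_subspace V -> V (x ** x) -> (forall y, V y -> V (x ** x ** y)) -> V g].
Proof.
move=> Jpx xa x0.
have [a [b [c [[aa ba _] [[_ nb xax _] [[ba1 _ _ _] hV]]]]]] := local_unit x (nr_gt0 x0).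
rewrite xa in hV; exists b; split=> //; last by move=> V cV Vw wV; have [] := hV V cV Vw wV.
apply: (hump_elemP ba aa ba1) => Ja.
have Jpx2 := cidealMl x (tperp_cideal T) Jpx.
have [Jpa _ _] : [/\ Jp a, Jp b & Jp c].
  apply: hV => //; first exact/cideal_sub/tperp_cideal.
  by move=> y; exact: (cidealMl _ (tperp_cideal T)).
by move: xax; rewrite (tideal_tperp Ja Jpa) mul0x subr0 ltxx.
Qed.

(** Without a minimal projection, [atom_minproj] yields an orthogonal pair [x], [y] every time: [x]
    supplies a hump [g], and [y] survives in the part orthogonal to [g], so the humps never end. *)
Lemma exists_minproj e C : K e -> her C -> C `<=` unitset e -> C `<=` Jp ->
  (exists2 x, C x & x <> 0) -> exists2 p, C p & minproj p.
Proof.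
move=> Ke hC Ce CJ C0; apply: contrapT => nomin.
pose P (D : set A) := [/\ her D, D `<=` unitset e, D `<=` Jp, (exists2 x, D x & x <> 0) &
  ~ exists2 p, D p & minproj p].
apply: (gliding_hump hT (P := P) Ke _ _ (C := C)); [by move=> D []| |by split].
move=> N D N0 [hD De DJ D0 Dm].
have [x [y [[Dx Dy xa ya] [xy x0 y0]]]] : exists x y, [/\ D x, D y, x^# = x & y^# = y] /\
    [/\ x ** y = 0, x <> 0 & y <> 0].
  apply: contrapT => h; apply: Dm; apply: atom_minproj => // x y Dx Dy xa ya xy.
  apply: contrapT => /not_orP[x0 y0]; apply: h; by exists x, y.
have [g [ga ng hg gV]] := tperp_hump (DJ _ Dx) xa x0.
have [cD mD sD hDD] := hD.
have yx : y ** x = 0 by rewrite -ya -xa -cstar_adjM xy adj0.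
have [cO mO sO hO] := orth_her ya.
have Ox : orth y x by split.
have Og : orth y g by apply: gV => // [|z Oz]; apply: (mO) => //; apply: (mO).
have Dg : D g by apply: gV => // [|z Dz]; apply: (mD) => //; apply: (mD).
exists g, (D `&` orth g); split; first by split=> //; exact: hg.
split; [|by move=> z []|by move=> z []].
split.
- by apply: herI => //; exact: orth_her.
- by move=> z [/De].
- by move=> z [/DJ].
- by exists y => //; split=> //; case: Og.
- by case=> p [Dp _] mp; apply: Dm; exists p.
Qed.

Definition tmin : set A := [set p | minproj p /\ Jp p].
Definition tsoc : set A := smallest (@cideal R A) tmin.

Lemma tsoc_cideal : cideal tsoc. Proof. exact: smallest_cideal. Qed.

Lemma tsoc_star : star_closed tsoc.
Proof. by apply: smallest_cideal_star => p [[]]. Qed.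

Lemma tsoc_tperp : tsoc `<=` Jp.
Proof. by apply: smallest_cideal_min; [exact: tperp_cideal|move=> p []]. Qed.

Lemma tsoc_min p : tmin p -> tsoc p.
Proof. by move=> mp I [_]; apply. Qed.

Local Notation M := (sum_set J tsoc).

Lemma tsum_cideal : cideal M.
Proof.
apply: sum_set_cideal; [exact: tideal_cideal|exact: tsoc_cideal|exact: tideal_star|exact: tsoc_star|].
by move=> x y Jx /tsoc_tperp Jy; apply: tperp_right Jy Jx.
Qed.

Lemma tideal_tsum : J `<=` M.
Proof.
move=> x Jx; exists x, 0; split=> //; last by rewrite addr0.
by have [] := cideal_sub tsoc_cideal.
Qed.

Lemma tsoc_tsum : tsoc `<=` M.
Proof.
move=> x Sx; exists 0, x; split=> //; last by rewrite add0r.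
by have [] := cideal_sub (tideal_cideal T).
Qed.

(** The elements common to [J] and [C] determine the norm on [C]. The point is faithfulness: if [c]
    kills them, then [c c^# j c = 0], because [c^# j c] is one of them; the C*-identity gives
    [c c^# j = 0] and then [c^# j = 0], so [c^#] is in [Jp]. *)
Lemma essential_test C t (N : R) : her C -> (forall x, C x -> Jp x -> x = 0) ->
  C t -> 0 <= N -> N < nr t -> exists z, [/\ J z, C z, nr z <= 1 & N < nr (t ** z)].
Proof.
move=> [cC mC sC hC] C0 Ct N0 Nt; apply: contrapT => h.
have cJ := tideal_cideal T.
suff : nr t <= N by rewrite leNgt Nt.
apply: (norm_test (C := C) (Z := J `&` C)) => //.
- by move=> c z Cc [Jz Cz]; split; [exact: (cidealMl _ cJ)|exact: mC].
- by move=> c z [Jz Cz]; split; [exact: (csubZ _ (cideal_sub cJ))|exact: (csubZ _ cC)].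
- move=> c Cc cz.
  have t1 j : J j -> c ** c^# ** j ** c = 0.
    move=> Jj; rewrite -!cstar_mulA [c^# ** _]cstar_mulA; apply: cz; split.
      by apply: (cidealMr _ cJ); apply: (cidealMl _ cJ).
    by apply: hC => //; exact: sC.
  have t2 j : J j -> c ** c^# ** j = 0.
    move=> Jj; apply: mul_adj_eq0; rewrite !cstar_adjM cstar_adjK.
    rewrite -[_ ** j ** _]cstar_mulA [j ** (_ ** _)]cstar_mulA.
    rewrite !cstar_mulA -[_ ** j ** j^#]cstar_mulA t1 ?mul0x//.
    exact: (cidealMr _ cJ).
  have t3 j : J j -> c^# ** j = 0.
    move=> Jj; apply: adj_mul_eq0; rewrite cstar_adjM cstar_adjK -cstar_mulA.
    by rewrite [c ** _]cstar_mulA t2 ?mulx0.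
  have c0 : c^# = 0 by apply: C0; [exact: sC|exact: t3].
  by rewrite -[c]cstar_adjK c0 adj0.
- move=> z [Jz Cz] nz; rewrite leNgt; apply/negP => hz; apply: h.
  by exists z.
Qed.

(* [v] with [|v^* T(x, y) v|] large is found in [J /\ C] by testing twice and
   polarizing; a local unit of [v] then does the job. *)
Lemma essential_hump C (N : R) : her C -> (forall x, C x -> Jp x -> x = 0) ->
  ~ (C `<=` J) -> 0 <= N ->
  exists g k, [/\ C g, g^# = g, nr g <= 1 & exists x y,
      [/\ K x, K y, nr x <= 1 & nr y <= 1] /\ N <= nr (g ** g ** T x y ** (g ** g))] /\
    [/\ C k, J k, k^# = k, g ** k = g & k ** g = g].
Proof.
move=> hC C0 CJ N0; have [cC mC sC hCC] := hC; have cJ := tideal_cideal T.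
have sJ := tideal_star (T := T).
(* Otherwise the local units of the elements of [C] would all lie in [J], and [C] with them. *)
have [b [Cb ba hb]] : exists b, [/\ C b, b^# = b & ~ exists M', qbounded T b M'].
  apply: contrapT => h; apply: CJ => c Cc.
  have /closedP : closed J by case: (cideal_sub cJ).
  apply=> d d0.
  have [a [b [[Ca Cb aa ba] [[_ _ ca _] [ba1 _]]]]] := her_local_unit hC Cc d0.
  exists (a ** c) => //; apply: (cidealMr _ cJ).
  have [M' hM'] : exists M', qbounded T b M' by apply: contrapT => h'; apply: h; exists b.
  exact: (qbounded_tideal hT ba aa ba1 hM').
pose be := nr b *+ 2; have be0 : 0 <= be by rewrite mulrn_wge0// nr_ge0.
(* [be] bounds [|v|] for the [v = b z + c b z'] found below, so [N be^2] leaves [N] after division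
   by [|v|^2]; the 1 pays for replacing [v] by [g^2 v]. *)
pose M1 := N * be ^+ 2 + 1.
have M10 : 0 <= M1 by rewrite addr_ge0// mulr_ge0// exprn_ge0.
have [x [y [hxy hM1]]] := not_qbounded M1 hb.
set t := T x y in hM1.
have Ct : C (b ** t ** b) by exact: hCC.
have [z [Jz Cz nz hz]] := essential_test hC C0 Ct M10 hM1.
have Ctz : C (b ** t ** b ** z)^# by apply: sC; exact: mC.
rewrite -nr_adj in hz.
have [z' [Jz' Cz' nz' hz']] := essential_test hC C0 Ctz M10 hz.
have {hz hz'} : M1 < nr ((b ** z')^# ** t ** (b ** z)).
  by rewrite cstar_adjM ba; move: hz'; rewrite -nr_adj cstar_adjM cstar_adjK !cstar_mulA.
move=> /polarization_witness[c [c1]]; set v := _ + _ => hv.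
have nv : nr v <= be.
  rewrite /be mulr2n (le_trans (nrD _ _))// nrZc c1 mul1r.
  by rewrite lerD// (le_trans (nrM _ _))// ler_piMr// nr_ge0.
have Cv : C v by apply: csubD => //; [exact: mC|apply: csubZ => //; exact: mC].
have Jv : J v.
  apply: (csubD (cideal_sub cJ)); first exact: (cidealMl _ cJ).
  by apply: (csubZ _ (cideal_sub cJ)); exact: (cidealMl _ cJ).
(* An error [|v - g^2 v| < 1 / D] changes [v^# t v] by at most 1. *)
pose D := 2 * nr t * be + 1; have D0 : 0 < D by rewrite ltr_wpDl// !mulr_ge0// nr_ge0.
have hJC : her (J `&` C) by apply: herI => //; apply: cideal_her.
have Dd : 0 < D^-1 by rewrite invr_gt0.
have [g [k [[JCg JCk ga ka] [[ng nk _ hg] [kg gk]]]]] := her_local_unit hJC (conj Jv Cv) Dd.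
exists g, k; split; last by case: JCk => ? ?; split.
split=> //; first by case: JCg.
exists x, y; split=> //; rewrite -/t; set S := _ ** _.
have v0 : 0 < nr v.
  rewrite lt_neqAle nr_ge0 andbT eq_sym; apply/eqP => /nr_eq0 v0.
  by move: hv; rewrite v0 mulx0 nr0 ltNge M10.
have e1 : v^# ** S ** v = (g ** (g ** v))^# ** t ** (g ** (g ** v)).
  by rewrite /S !cstar_adjM ga !cstar_mulA.
set w := g ** (g ** v) in e1 hg.
have nw : nr w <= nr v.
  rewrite (le_trans (nrM _ _))// (le_trans _ (ler_piMl (nr_ge0 v) ng))//.
  by rewrite (le_trans (ler_piMl (nr_ge0 _) ng))// nrM.
have diff : nr (v^# ** t ** v - w^# ** t ** w) <= 1.
  have -> : v^# ** t ** v - w^# ** t ** w = (v - w)^# ** t ** v + w^# ** t ** (v - w).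
    by rewrite adjB !mulBx mulxB addrA subrK.
  have hD : D^-1 * nr t * be + be * nr t * D^-1 <= 1.
    have -> : D^-1 * nr t * be + be * nr t * D^-1 = (2 * nr t * be) / D.
      by field; rewrite gt_eqF.
    by rewrite ler_pdivrMr// mul1r /D lerDl.
  apply: le_trans hD; rewrite (le_trans (nrD _ _))// lerD//.
    rewrite (le_trans (nrM _ _))// ler_pM ?nr_ge0// (le_trans (nrM _ _))//.
    by rewrite ler_wpM2r ?nr_ge0// nr_adj ltW.
  rewrite (le_trans (nrM _ _))// ler_pM ?nr_ge0 ?(ltW hg)// (le_trans (nrM _ _))//.
  by rewrite ler_wpM2r ?nr_ge0// nr_adj (le_trans nw).
have h1 : nr (v^# ** S ** v) <= nr v * nr S * nr v.
  rewrite (le_trans (nrM _ _))// ler_wpM2r ?nr_ge0// (le_trans (nrM _ _))//.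
  by rewrite nr_adj.
rewrite -(ler_pM2l v0) -(ler_pM2r v0); apply: le_trans h1.
have h2 : nr v * N * nr v <= N * be ^+ 2.
  rewrite mulrAC [leRHS]mulrC ler_wpM2r// expr2 ler_pM ?nr_ge0//.
rewrite e1; have := nr_dist (v^# ** t ** v) (w^# ** t ** w) 0; rewrite !subr0.
by move: h2 diff hv; rewrite /M1; lra.
Qed.

(** As long as [D] is not inside [M], a hump splits off: by [essential_hump] if [D] meets [Jp] only
    in 0, otherwise as a minimal projection in [D] and [Jp], which is its own unit. The unit is in
    [M] either way, so [her_orth_notin] keeps the rest outside [M] and the humps never end. *)
Lemma her_tsum e C : K e -> her C -> C `<=` unitset e -> C `<=` M.
Proof.
move=> Ke hC Ce; apply: contrapT => CM.
pose P (D : set A) := [/\ her D, D `<=` unitset e & ~ D `<=` M].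
apply: (gliding_hump hT (P := P) Ke _ _ (C := C)); [by move=> D []| |by split].
move=> N D N0 [hD De DM].
suff [g [k [[Dg ga ng hg] [Dk Mk ka gk kg]]]] : exists g k,
    [/\ D g, g^# = g, nr g <= 1 & exists x y,
      [/\ K x, K y, nr x <= 1 & nr y <= 1] /\ N <= nr (g ** g ** T x y ** (g ** g))] /\
    [/\ D k, M k, k^# = k, g ** k = g & k ** g = g].
  exists g, (D `&` orth g); split=> //; split; [|by move=> z []|by move=> z []].
  split.
  - by apply: herI => //; exact: orth_her.
  - by move=> z [/De].
  - exact: (her_orth_notin hD tsum_cideal Dk Mk ga ka gk kg).
have [D0|/existsNP[x /not_implyP[Dx /not_implyP[Jx x0]]]] :=
    pselect (forall x, D x -> Jp x -> x = 0).
  have [|g [k [h1 [Dk Jk ka gk kg]]]] := essential_hump hD D0 _ N0.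
    by move=> DJ; apply: DM => x /DJ; exact: tideal_tsum.
  by exists g, k; split=> //; split=> //; exact: tideal_tsum.
have [||||p [Dp Jp_p] mp] := @exists_minproj e (D `&` Jp) Ke.
- by apply: herI => //; apply: cideal_her; [exact: tperp_cideal|exact: tperp_star].
- by move=> z [/De].
- by move=> z [].
- by exists x.
have [p0 pa pp _] := mp.
have np : nr p <= 1.
  have := nr_cstar p; rewrite pa pp expr2 -[X in X = _]mulr1 => /mulfI ->//.
  by apply/eqP => /nr_eq0.
exists p, p; split.
  split=> //; apply: (hump_elemP pa pa pp) => Jpp.
  by apply: p0; apply: (tideal_tperp Jpp Jp_p).
by split=> //; apply: tsoc_tsum; apply: tsoc_min.
Qed.

(** [x] is a limit of elements [a x] with [a] in [unitset b] and [b] in K(A), and [her_tsum] puts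
    [a] in [M]. *)
Lemma tsum_full x : M x.
Proof.
have /closedP : closed M by case: (cideal_sub tsum_cideal).
apply=> d d0.
have [a [b [c [[aa ba _] [[_ _ xa _] [[ba1 ab1 cb _] _]]]]]] := local_unit x d0.
exists (a ** x) => //; apply: (cidealMr _ tsum_cideal).
by apply: (her_tsum (pedersen_local_unit cb) (unitset_her ba)).
Qed.

Lemma tperp_tsoc : Jp = tsoc.
Proof.
apply/seteqP; split; last exact: tsoc_tperp.
move=> x Jpx; have [j [s [Jj Ss xjs]]] := tsum_full x.
have Jpj : Jp j.
  have -> : j = x - s by rewrite xjs addrK.
  by apply: (csubB (cideal_sub (tperp_cideal T))) => //; exact: tsoc_tperp.
by rewrite xjs (tideal_tperp Jj Jpj) add0r.
Qed.

Lemma tideal_decomposition : direct_sum_decomposition J Jp.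
Proof.
split; [exact: tideal_cideal|exact: tperp_cideal| |].
- apply/seteqP; split=> [x [Jx Jpx]|_ ->]; first exact: (tideal_tperp Jx Jpx).
  have [_ ? _] := cideal_sub (tideal_cideal T).
  by have [_ ? _] := cideal_sub (tperp_cideal T); split.
- move=> x; have [j [s [Jj Ss ->]]] := tsum_full x.
  by exists j, s; split=> //; exact: tsoc_tperp.
Qed.

Lemma quasiDl x x' y : K x -> K x' -> K y -> T (x + x') y = T x y + T x' y.
Proof. by case: hT => _ h _ _ _ Kx Kx' Ky; have := h 1 x x' y Kx Kx' Ky; rewrite !scale1r. Qed.

(* A dense ideal of [J] on which [T] takes values in [J]; it contains K(J). *)
Definition tcore : set A := [set x | [/\ J x, K x &
  forall y, K y -> J (T x y) /\ forall b, J (T (x ** b) y)]].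

(** For [x] in [J] take a local unit [a] of [x] and its unit [b], both in [J]: then
    [T(a x, y) = b T(a x, y)] is in [J]. The clause on [x ** b] in [tcore] makes it a right
    ideal. *)
Lemma tcore_dense : dense_two_sided_ideal J tcore.
Proof.
have cJ := tideal_cideal T; have cJs := cideal_sub cJ; have [clJ J0 lJ] := cJs.
have [_ K0 lK _] := @pedersen_two_sided R A.
split; last first.
  move=> x Jx; apply/closureP => d d0.
  have [a [b [c [[aa ba _] [[_ _ xa _] [[ba1 ab1 cb _] hV]]]]]] := local_unit x d0.
  have [Ja Jb _] : [/\ J a, J b & J c].
    apply: hV => [||y _]; first exact: cJs.
      exact: (cidealMr _ cJ).
    by do 2 apply: (cidealMr _ cJ).
  have Ka := pedersen_local_unit ba1.
  exists (a ** x) => //; split; [exact: (cidealMr _ cJ)|exact: pedersenMr|].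
  move=> y Ky; rewrite -ba1; split=> [|b']; rewrite -!cstar_mulA quasiMl//.
  - exact: (cidealMr _ cJ).
  - exact: pedersenMr.
  - exact: (cidealMr _ cJ).
  - by apply: pedersenMr.
split.
- by move=> x [].
- split=> // y Ky; rewrite (quasi0l hT Ky); split=> // b.
  by rewrite mul0x (quasi0l hT Ky).
- move=> c x y [Jx Kx hx] [Jy Ky hy]; split; [exact: lJ|exact: lK|].
  have TcD x' y' z : K x' -> K y' -> K z -> T (c *: x' + y') z = c *: T x' z + T y' z.
    by case: hT => _ h _ _ _; exact: h.
  move=> z Kz; split=> [|b]; rewrite ?cstar_mulDl ?mulZx TcD//; try exact: pedersenMr.
    by apply: lJ; [case: (hx z Kz)|case: (hy z Kz)].
  by apply: lJ; [case: (hx z Kz)|case: (hy z Kz)].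
- move=> b x Jb [Jx Kx hx]; split; split.
  + exact: (cidealMl _ cJ).
  + exact: pedersenMl.
  + move=> y Ky; split=> [|b']; rewrite -?cstar_mulA quasiMl//; try exact: pedersenMr.
      exact: (cidealMr _ cJ).
    exact: (cidealMr _ cJ).
  + exact: (cidealMr _ cJ).
  + exact: pedersenMr.
  + move=> y Ky; split=> [|b']; rewrite -?cstar_mulA; by have [_] := hx y Ky; apply.
Qed.

Lemma pedersen_tcore : pedersen_ideal J `<=` tcore.
Proof. by move=> x; apply; split=> //; exact: tcore_dense. Qed.

Lemma cideal_left_approx I (a x : A) (d : R) : cideal I -> I x -> 0 < d ->
  exists2 u, I u /\ nr u <= 1 & nr (x - u ** x) < d.
Proof.
move=> cI Ix d0.
have [u [b [c [_ [[nu _ xu _] [_ hV]]]]]] := local_unit x d0.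
have [Iu _ _] : [/\ I u, I b & I c].
  apply: hV => [||y _]; first exact: cideal_sub.
    exact: (cidealMr _ cI).
  by do 2 apply: (cidealMr _ cI).
by exists u.
Qed.

(** For [s] in an ideal of the family, [s T(., y)] is continuous, so [s T(x, y)] is a limit of
    [s u T(x, y)] with [u] in [I]. This extends to all [s] in [J], and [T(x, y)], being in [J], is
    itself a limit of such products. *)
Lemma tcore_mem I x y : cideal I ->
  tcore x -> I x -> K y -> I (T x y).
Proof.
move=> cI [Jx Kx hx] Ix Ky.
have cJ := tideal_cideal T; have Is := cideal_sub cI; have [clI I0 lI] := Is.
have key s : J s -> I (s ** T x y).
  have cV : closed_subspace [set s | I (s ** T x y)].
    split=> /=; last by move=> c s1 s2 h h'; rewrite cstar_mulDl mulZx; apply: lI.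
      apply/closedP => s1 hs; have /closedP := clI; apply=> d d0 /=.
      have M0 : 0 < nr (T x y) + 1 by rewrite ltr_wpDl// nr_ge0.
      have [s' Is' ss'] := hs _ (divr_gt0 d0 M0); exists (s' ** T x y) => //.
      rewrite -mulBx; apply: le_lt_trans (nrM _ _) _.
      move: ss'; rewrite ltr_pdivlMr//; apply: le_lt_trans.
      by rewrite ler_wpM2l ?nr_ge0// lerDl.
    by rewrite mul0x.
  move=> Js; apply: (sum_of_min cV) Js => -[I' cI' _ [M' hM']] s' /= I's'.
  have /closedP := clI; apply=> d d0.
  pose L := `|M' * nr s'| * nr y + 1.
  have L0 : 0 < L by rewrite ltr_wpDl// mulr_ge0// nr_ge0.
  have [u [Iu _] xu] := cideal_left_approx 0 cI Ix (divr_gt0 d0 L0).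
  exists (s' ** T (u ** x) y); first by rewrite quasiMl// cstar_mulA; apply: (cidealMr _ cI); exact: (cidealMl _ cI).
  have -> : s' ** T x y - s' ** T (u ** x) y = s' ** T (x - u ** x) y.
    rewrite quasiDl//; last first.
      by rewrite -scaleN1r; apply: pedersenZ; exact: pedersenMl.
    rewrite -[in RHS]scaleN1r (quasiZl hT)//; last exact: pedersenMl.
    by rewrite scaleN1r -mulxB.
  have Kd : K (x - u ** x).
    by rewrite addrC -scaleN1r; apply: pedersen_lin => //; exact: pedersenMl.
  apply: le_lt_trans (hM' _ _ _ I's' Kd Ky) _.
  move: xu; rewrite ltr_pdivlMr//; apply: le_lt_trans.
  rewrite [leLHS]mulrAC mulrC ler_wpM2l ?nr_ge0// /L.
  rewrite (@le_trans _ _ (`|M' * nr s'| * nr y))// ?lerDl//.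
  by rewrite ler_wpM2r ?nr_ge0// ler_norm.
have Jt : J (T x y) by have [] := hx y Ky.
have /closedP := clI; apply=> d d0.
have [u [Ju _] xu] := cideal_left_approx 0 cJ Jt d0.
by exists (u ** T x y) => //; exact: key.
Qed.

(** The family bounds only [s T(x, y)]. By [tcore_mem] the value [T(x, y)] is in the ideal, hence
    approximated by [u T(x, y)] with [u] in the ideal and [|u| <= 1], and the bound passes over. *)
Lemma tideal_locally_bounded : locally_bounded J T.
Proof.
exists (fam T), (@fam_set R A T); split=> //.
- move=> [I cI sI bI] /=; have IJ : I `<=` J.
    move=> x Ix; apply: subset_closure.
    exact: (@sum_of_sub _ _ _ (@fam_set R A T) (Fam cI sI bI)).
  have [clI I0 lI] := cideal_sub cI; split=> //; split=> // b x Jb Ix.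
  by split; [exact: (cidealMl _ cI)|exact: (cidealMr _ cI)].
- move=> [I cI sI bI] /=; have IJ : I `<=` J.
    move=> x Ix; apply: subset_closure.
    exact: (@sum_of_sub _ _ _ (@fam_set R A T) (Fam cI sI bI)).
  have [M' hM'] := bI; exists (`|M'|%:C) => x y [/pedersen_tcore Cx Ix] [/pedersen_tcore [Jy Ky _] Iy].
  have It : I (T x y) by exact: tcore_mem.
  rewrite !nrE -!rmorphM lecR; apply/ler_addgt0Pr => d d0.
  have [u [Iu nu] tu] := cideal_left_approx 0 cI It d0.
  have [_ Kx _] := Cx.
  rewrite -[T x y](subrK (u ** T x y)) addrC (le_trans (nrD _ _))//.
  rewrite addrC [leRHS]addrC lerD ?(ltW tu)//.
  apply: le_trans (hM' u x y Iu Kx Ky) _.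
  do 2 (apply: ler_wpM2r; first exact: nr_ge0).
  apply: (@le_trans _ _ (`|M'| * nr u)); first by rewrite ler_wpM2r ?nr_ge0// ler_norm.
  by rewrite ler_piMr.
Qed.

End Decomposition.

(** * Subalgebras and Hilbert spaces as types *)

Section Types.
Variables (R : realType) (V : completeNormedModType R[i]).

(** Bundled, so that the carrier is a type on which the algebraic and metric structures can be
    declared. *)
Record csub := CSub {
  cs_set :> set V;
  cs_closed : closed cs_set;
  cs_zero : cs_set 0;
  cs_lin : forall (c : R[i]) x y, cs_set x -> cs_set y -> cs_set (c *: x + y) }.

Definition carrier (S : csub) : Type := {x : V | cs_set S x}.

Variable S : csub.
HB.instance Definition _ := gen_eqMixin (carrier S).
HB.instance Definition _ := gen_choiceMixin (carrier S).

Lemma carrier_inj (a b : carrier S) : sval a = sval b -> a = b.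
Proof. by case: a b => [a Sa] [b Sb] /= ab; subst b; congr exist; exact: Prop_irrelevance. Qed.

Lemma csD x y : cs_set S x -> cs_set S y -> cs_set S (x + y).
Proof. by move=> Sx Sy; rewrite -[x]scale1r; exact: cs_lin. Qed.

Lemma csZ (c : R[i]) x : cs_set S x -> cs_set S (c *: x).
Proof. by move=> Sx; rewrite -[X in cs_set S X]addr0; apply: cs_lin => //; exact: cs_zero. Qed.

Lemma csN x : cs_set S x -> cs_set S (- x).
Proof. by rewrite -scaleN1r; exact: csZ. Qed.

Definition cs0 : carrier S := exist _ 0 (cs_zero S).
Definition csadd (a b : carrier S) : carrier S := exist _ _ (csD (svalP a) (svalP b)).
Definition csopp (a : carrier S) : carrier S := exist _ _ (csN (svalP a)).
Definition csscale (c : R[i]) (a : carrier S) : carrier S := exist _ _ (csZ c (svalP a)).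

Fact csaddA : associative csadd.
Proof. by move=> a b c; apply: carrier_inj; rewrite /= addrA. Qed.
Fact csaddC : commutative csadd.
Proof. by move=> a b; apply: carrier_inj; rewrite /= addrC. Qed.
Fact csadd0 : left_id cs0 csadd.
Proof. by move=> a; apply: carrier_inj; rewrite /= add0r. Qed.
Fact csaddN : left_inverse cs0 csopp csadd.
Proof. by move=> a; apply: carrier_inj; rewrite /= addNr. Qed.

HB.instance Definition _ := GRing.isZmodule.Build (carrier S) csaddA csaddC csadd0 csaddN.

Fact csscaleA (c d : R[i]) a : csscale c (csscale d a) = csscale (c * d) a.
Proof. by apply: carrier_inj; rewrite /= scalerA. Qed.
Fact csscale1 : left_id 1 csscale.
Proof. by move=> a; apply: carrier_inj; rewrite /= scale1r. Qed.
Fact csscaleDr : right_distributive csscale +%R.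
Proof. by move=> a b c; apply: carrier_inj; rewrite /= scalerDr. Qed.
Fact csscaleDl a : {morph csscale^~ a : b c / b + c}.
Proof. by move=> b c; apply: carrier_inj; rewrite /= scalerDl. Qed.

HB.instance Definition _ := GRing.Zmodule_isLmodule.Build R[i] (carrier S)
  csscaleA csscale1 csscaleDr csscaleDl.

Definition csnorm (a : carrier S) : R[i] := `|sval a|.
Fact csnormD a b : csnorm (a + b) <= csnorm a + csnorm b.
Proof. exact: ler_normD. Qed.
Fact csnormZ (c : R[i]) (a : carrier S) : csnorm (c *: a) = `|c| * csnorm a.
Proof. exact: normrZ. Qed.
Fact csnorm0 a : csnorm a = 0 -> a = 0.
Proof. by move=> h; apply: carrier_inj; exact: normr0_eq0. Qed.

HB.instance Definition _ := Lmodule_isNormed.Build R[i] (carrier S) csnormD csnormZ csnorm0.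

Lemma nr_carrier (a : carrier S) : nr a = nr (sval a).
Proof. by []. Qed.

Fact carrier_complete (F : set_system (carrier S)) :
  ProperFilter F -> cauchy F -> cvg F.
Proof.
move=> FF /cauchy_ballP cF.
have /cauchy_cvg/cvg_ex[l Fl] : cauchy (sval @ F).
  apply/cauchy_ballP => e /cF[[P Q] [/= FP FQ] PQ].
  exists (sval @` P, sval @` Q); first by split => /=; [apply: filterS FP|apply: filterS FQ] => x Px; exists x.
  by case=> _ _ /= [[x Px <-] [y Qy <-]]; have := PQ (x, y) (conj Px Qy); rewrite -!ball_normE.
have Sl : cs_set S l.
  have /closedP hS : closed (cs_set S) by exact: cs_closed.
  apply: hS => e e0.
  have /filter_ex[x] : F [set x | ball l e%:C (sval x)].
    by apply: Fl; apply: nbhsx_ballx; rewrite gt0c.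
  by rewrite /= -ball_normE /ball_/= nrE ltcR => lx; exists (sval x) => //; exact: svalP.
apply/cvg_ex; exists (exist _ l Sl) => B /nbhs_ballP[e /= e0 eB].
have : F [set x | ball l e (sval x)] by apply: Fl; apply: nbhsx_ballx.
by apply: filterS => x; rewrite /= -!ball_normE => xl; apply: eB; rewrite -ball_normE.
Qed.

HB.instance Definition _ := Uniform_isComplete.Build (carrier S) carrier_complete.

End Types.

Section SubAlgebra.
Variables (R : realType) (A : cstarAlgType R).

Record cstarsub := CStarSub {
  ca_csub :> csub A;
  ca_mul : forall x y, cs_set ca_csub x -> cs_set ca_csub y -> cs_set ca_csub (x ** y);
  ca_adj : forall x, cs_set ca_csub x -> cs_set ca_csub x^# }.

Definition calg (S : cstarsub) : Type := carrier S.

Variable S : cstarsub.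
HB.instance Definition _ := CompleteNormedModule.on (calg S).

Definition calg_mul (a b : calg S) : calg S := exist _ _ (ca_mul (svalP a) (svalP b)).
Definition calg_adj (a : calg S) : calg S := exist _ _ (ca_adj (svalP a)).

Fact calg_mulA : associative calg_mul.
Proof. by move=> a b c; apply: carrier_inj; rewrite /= cstar_mulA. Qed.
Fact calg_mulDl : left_distributive calg_mul +%R.
Proof. by move=> a b c; apply: carrier_inj; rewrite /= cstar_mulDl. Qed.
Fact calg_mulDr : right_distributive calg_mul +%R.
Proof. by move=> a b c; apply: carrier_inj; rewrite /= cstar_mulDr. Qed.
Fact calg_scaleAl (c : R[i]) (x y : calg S) : c *: calg_mul x y = calg_mul (c *: x) y.
Proof. by apply: carrier_inj; rewrite /= cstar_scaleAl. Qed.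
Fact calg_scaleAr (c : R[i]) (x y : calg S) : c *: calg_mul x y = calg_mul x (c *: y).
Proof. by apply: carrier_inj; rewrite /= cstar_scaleAr. Qed.
Fact calg_adjK : involutive calg_adj.
Proof. by move=> a; apply: carrier_inj; rewrite /= cstar_adjK. Qed.
Fact calg_adjD : {morph calg_adj : x y / x + y}.
Proof. by move=> a b; apply: carrier_inj; rewrite /= cstar_adjD. Qed.
Fact calg_adjZ (c : R[i]) (x : calg S) : calg_adj (c *: x) = Num.conj c *: calg_adj x.
Proof. by apply: carrier_inj; rewrite /= cstar_adjZ. Qed.
Fact calg_adjM (x y : calg S) : calg_adj (calg_mul x y) = calg_mul (calg_adj y) (calg_adj x).
Proof. by apply: carrier_inj; rewrite /= cstar_adjM. Qed.
Fact calg_normM (x y : calg S) : `|calg_mul x y| <= `|x| * `|y|.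
Proof. exact: cstar_normM. Qed.
Fact calg_norm (x : calg S) : `|calg_mul (calg_adj x) x| = `|x| ^+ 2.
Proof. exact: cstar_norm. Qed.

HB.instance Definition _ := isCStarAlgebra.Build R (calg S)
  calg_mulA calg_mulDl calg_mulDr calg_scaleAl calg_scaleAr calg_adjK calg_adjD
  calg_adjZ calg_adjM calg_normM calg_norm.

End SubAlgebra.

(** * The Hilbert space of a minimal projection *)

Section MinimalProjection.
Variables (R : realType) (A : cstarAlgType R) (p : A).
Hypothesis mp : minproj p.

Lemma scale_minproj_inj (c d : R[i]) : c *: p = d *: p -> c = d.
Proof.
move=> /eqP; rewrite -subr_eq0 -scalerBl scaler_eq0 subr_eq0.
by case/orP => /eqP // p0; case: mp.
Qed.

Lemma nr_minproj : nr p = 1.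
Proof.
have [p0 pa pp _] := mp.
by have := nr_cstar p; rewrite pa pp expr2 -[X in X = _]mulr1 => /mulfI -> //; apply/eqP => /nr_eq0.
Qed.

(* If [c < 0], then [x x^* + x^* x = ((x + x^* )^2 + (i (x - x^* ))^2) / 2] is both
   positive and a negative multiple of the positive element [x x^* / c + p]. *)
Lemma minproj_adj_mul (x : A) (c : R[i]) : x ** p = x -> x^# ** x = c *: p -> 0 <= c.
Proof.
have [p0 pa pp _] := mp => xp xx.
have px : p ** x^# = x^# by rewrite -{1}pa -cstar_adjM xp.
have /CrealP/complex_realP[r cr] : Num.conj c = c.
  apply: scale_minproj_inj; rewrite -{1}pa -cstar_adjZ -xx.
  by rewrite cstar_adjM cstar_adjK.
subst c; rewrite ler0c leNgt; apply/negP => r0.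
pose lm (a y : A) := a ** y.
have lm_bsa a : a^# = a -> bsa (lm a).
  move=> aa; split; first by move=> y z; rewrite /lm cstar_adjM aa cstar_mulA.
  by exists (nr a) => y; exact: nrM.
have lm_pos a : a^# = a -> pos (lm (a ** a)).
  move=> aa; have := pos_sqr (lm_bsa a aa); congr pos.
  by apply/funext => y; rewrite /= /lm cstar_mulA.
have lm_add a b : pos (lm a) -> pos (lm b) -> pos (lm (a + b)).
  move=> ha hb; have := pos_add ha hb; congr pos.
  by apply/funext => y; rewrite /lm cstar_mulDl.
have [i ii ic] : exists2 i : R[i], i * i = -1 & Num.conj i = - i.
  by exists 'i%R; rewrite ?conjCi// -expr2 sqrCi.
pose y := x ** x^# + x^# ** x.
pose a1 := x + x^#; pose a2 := i *: (x - x^#).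
have a1a : a1^# = a1 by rewrite /a1 cstar_adjD cstar_adjK addrC.
have a2a : a2^# = a2 by rewrite /a2 cstar_adjZ adjB cstar_adjK ic scaleNr -scalerN opprB.
have ysq : a1 ** a1 + a2 ** a2 = y *+ 2.
  rewrite /a1 /a2 mulZx mulxZ scalerA ii scaleN1r mulxB !mulBx !cstar_mulDl !cstar_mulDr.
  rewrite opprB !opprD !opprK /y mulr2n.
  rewrite [X in X + _ = _]addrACA [X in _ + X = _]addrC [LHS]addrACA.
  rewrite [X in X + _ = _]addrACA subrr add0r [X in _ + X = _]addrACA subrr addr0.
  by rewrite [RHS]addrACA [LHS]addrC.
have lm_scale (d : R) a : 0 < d -> pos (lm a) -> pos (lm (d%:C *: a)).
  move=> d0 ha; have := pos_scale d0 ha; congr pos.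
  by apply/funext => z; rewrite /lm mulZx.
have y_pos : pos (lm y).
  have -> : y = 2^-1%:C *: (y *+ 2).
    rewrite -[y *+ 2]scaler_nat -(rmorph_nat (real_complex R)) scalerA -rmorphM.
    by rewrite mulVf ?pnatr_eq0// scale1r.
  apply: lm_scale; first by rewrite invr_gt0 ltr0n.
  by rewrite -ysq; apply: lm_add; exact: lm_pos.
pose e := x ** x^#; have ea : e^# = e by rewrite cstar_adjM cstar_adjK.
have ee : e ** e = r%:C *: e.
  by rewrite /e cstar_mulA -(cstar_mulA x) xx mulxZ xp mulZx.
have s0 : 0 < - r by rewrite oppr_gt0.
(* [- y = e^2 / (- r) + (- r) p^2], because [e^2 = r e] and [x^# x = r p]. *)
have Ny_pos : pos (lm (- y)).
  have -> : - y = (- r)^-1%:C *: (e ** e) + (- r)%:C *: (p ** p).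
    rewrite ee scalerA -rmorphM invrN mulNr mulVf ?lt_eqF// rmorphN1 scaleN1r pp.
    by rewrite rmorphN scaleNr -xx -opprD.
  by apply: lm_add; apply: lm_scale; rewrite ?invr_gt0//; exact: lm_pos.
have y0 : y = 0.
  apply: right_faithful => z; apply: nr_small => d d0.
  have M0 : 0 < nr z + 1 by rewrite ltr_wpDl// nr_ge0.
  have d1 : 0 < d / (nr z + 1) by rewrite divr_gt0.
  have hid := pos_scale d1 (pos_id A).
  have := @pos_opb _ _ (d / (nr z + 1)) (lm y) d1 _ _ (lm_bsa y _).1.
  have -> : (fun x0 => (d / (nr z + 1))%:C *: x0 - lm y x0) =
      (fun x0 => (d / (nr z + 1))%:C *: x0 + lm (- y) x0).
    by apply/funext => w; rewrite /lm mulNx.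
  have ya : y^# = y by rewrite cstar_adjD !cstar_adjM !cstar_adjK.
  move=> /(_ (pos_add hid Ny_pos) (pos_add hid y_pos) ya z) h.
  apply: le_trans h _; rewrite mulrAC ler_pdivrMr// ler_wpM2l ?(ltW d0)// lerDl//.
have eE : e = (- r)%:C *: p.
  by apply/eqP; rewrite -subr_eq0 rmorphN scaleNr opprK -xx; apply/eqP.
(* [y = 0] means [e = - r p]; inserted into [e^2 = r e] this gives [r^2 = - r^2]. *)
have : (r * r)%:C *: p = (r * - r)%:C *: p.
  by move: ee; rewrite eE mulZx mulxZ pp !scalerA -!rmorphM mulrNN.
move=> /scale_minproj_inj/complexI; rewrite mulrN => h.
have : 0 < r * r by rewrite nmulr_rgt0.
by lra.
Qed.

End MinimalProjection.

Section HilbertSpace.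
Variables (R : realType) (A : cstarAlgType R).

Record minprojType := MinProj { mp_val :> A; mp_min : minproj mp_val }.
Variable p : minprojType.

Let p0 : (p : A) <> 0. Proof. by case: (mp_min p). Qed.
Let padj : (p : A)^# = p. Proof. by case: (mp_min p). Qed.

Fact hs_closed : closed [set x : A | x ** p = x].
Proof.
apply/closedP => x /= h; apply/subr0_eq/nr_small => e e0.
have M0 : 0 < nr (p : A) + 1 by rewrite ltr_wpDl// nr_ge0.
have [y /= yp xy] := h _ (divr_gt0 e0 M0).
have -> : x ** p - x = (x - y) ** p - (x - y) by rewrite mulBx yp opprB addrA subrK.
rewrite (le_trans (nrB _ _))// (le_trans (lerD (nrM _ _) (lexx _)))//.
rewrite -[X in _ + X]mulr1 -mulrDr.
by move: xy; rewrite ltr_pdivlMr// => /ltW.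
Qed.

Fact hs_zero : [set x : A | x ** p = x] 0.
Proof. by rewrite /= mul0x. Qed.

Fact hs_lin (c : R[i]) x y : [set x : A | x ** p = x] x -> [set x : A | x ** p = x] y ->
  [set x : A | x ** p = x] (c *: x + y).
Proof. by rewrite /= cstar_mulDl mulZx => -> ->. Qed.

Definition hs_sub : csub A := CSub hs_closed hs_zero hs_lin.
(* The left ideal [A p] with the inner product [<x, y> p = y^* x]. *)
Definition hspace : Type := carrier hs_sub.
HB.instance Definition _ := CompleteNormedModule.on hspace.

Lemma pcoef_ex a : exists c : R[i], p ** a ** p = c *: (p : A).
Proof. by case: (mp_min p). Qed.

Definition hinner (x y : hspace) : R[i] := sval (cid (pcoef_ex ((sval y)^# ** sval x))).

Lemma hs_mul (x : hspace) : sval x ** p = sval x.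
Proof. exact: svalP x. Qed.

Lemma hs_adj_mul (x : hspace) : p ** (sval x)^# = (sval x)^#.
Proof. by rewrite -{1}padj -cstar_adjM hs_mul. Qed.

Lemma hinnerE x y : (sval y)^# ** sval x = hinner x y *: (p : A).
Proof.
rewrite /hinner; case: cid => c /= <-.
by rewrite cstar_mulA hs_adj_mul -cstar_mulA hs_mul.
Qed.

Lemma hinner_eq x y (c : R[i]) : (sval y)^# ** sval x = c *: (p : A) -> hinner x y = c.
Proof. by rewrite hinnerE => /(scale_minproj_inj (mp_min p)). Qed.

Lemma hinner_ge0 x : 0 <= hinner x x.
Proof. exact: (minproj_adj_mul (mp_min p) (hs_mul x) (hinnerE x x)). Qed.

Lemma hinner_norm x : hinner x x = `|x| ^+ 2.
Proof.
have -> : `|x| ^+ 2 = `|(sval x)^# ** sval x| by rewrite cstar_norm.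
by rewrite hinnerE normrZ (nrE (p : A)) (nr_minproj (mp_min p)) mulr1 ger0_norm// hinner_ge0.
Qed.

Fact hinner_herm (x y : hspace) : hinner x y = (-1) ^+ false * Num.conj (hinner y x).
Proof.
rewrite expr0 mul1r; apply: hinner_eq; rewrite -padj -cstar_adjZ -hinnerE.
by rewrite cstar_adjM cstar_adjK.
Qed.

Fact hinner_zl y : zmod_morphism (hinner ^~ y).
Proof. by move=> x x' /=; apply: hinner_eq; rewrite /= mulxB !hinnerE scalerBl. Qed.

Fact hinner_zr x : zmod_morphism (hinner x).
Proof.
move=> y y'; rewrite hinner_herm hinner_zl expr0 mul1r rmorphB.
by congr (_ - _); rewrite [RHS]hinner_herm expr0 mul1r.
Qed.

Fact hinner_scl y : scalable_for *%R (hinner ^~ y).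
Proof. by move=> c x /=; apply: hinner_eq; rewrite /= mulxZ hinnerE scalerA. Qed.

Fact hinner_scr x : scalable_for (Num.conj \; *%R) (hinner x).
Proof.
move=> c y; rewrite hinner_herm hinner_scl expr0 mul1r rmorphM /=.
by congr (_ * _); rewrite [RHS]hinner_herm expr0 mul1r.
Qed.

HB.instance Definition _ := isBilinear.Build R[i] hspace hspace R[i] *%R (Num.conj \; *%R) hinner
   hinner_zl hinner_zr hinner_scl hinner_scr.

HB.instance Definition _ := isHermitianSesquilinear.Build R[i] hspace false Num.conj hinner hinner_herm.

Fact hinner_dot (u : hspace) : u != 0 -> 0 < hinner u u.
Proof. by move=> u0; rewrite hinner_norm exprn_gt0// normr_gt0. Qed.

HB.instance Definition _ := isDotProduct.Build R[i] hspace hinner hinner_dot.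

HB.instance Definition _ := isHilbert.Build R hspace hinner_norm.

End HilbertSpace.

(** * Elementary ideals *)

Section TotallyBounded.
Variables (R : realType) (V : completeNormedModType R[i]).
Implicit Types (S : set V).

Definition tb S := forall e : R, 0 < e -> exists ys : seq V,
  forall x, S x -> exists2 y, y \in ys & nr (x - y) < e.

(** An ultrafilter that contains a finite union of balls contains one of them, so it is Cauchy. *)
Lemma tb_precompact S : tb S -> precompact S.
Proof.
move=> tS; rewrite precompactE compact_ultra => F FU FS.
have /cauchy_cvg/cvg_ex[l Fl] : cauchy F.
  apply: cauchy_exP => e e0.
  have eE : e = (complex.Re e)%:C by rewrite RRe_real// gtr0_real.
  have {}e0 : 0 < complex.Re e by rewrite -gt0c -eE.
  have e20 : 0 < complex.Re e / 2 by rewrite divr_gt0.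
  have [ys hys] := tS _ e20.
  have {FS} : F [set x | exists2 y, y \in ys & ball y e x].
    apply: filterS FS => x /closureP/(_ _ e20)[z Sz xz].
    have [y yys zy] := hys z Sz; exists y => //.
    rewrite -ball_normE /ball_/= nrE eE ltcR nrBC.
    by apply: le_lt_trans (nr_dist _ z _) _; rewrite (splitr (complex.Re e)) ltrD.
  elim: ys {hys} => [|y ys IH] h.
    by have [x []] := filter_ex h.
  have [hy|hy] := in_ultra_setVsetC (ball y e) FU; first by exists y.
  apply: IH; apply: filterS (filterI h hy) => x /= [[z + zx] nyx].
  by rewrite inE => /predU1P[zy|zys]; [subst z|exists z].
exists l; split=> //.
apply: (@closed_closure _ S) => B Bl.
exact: filter_ex (filterI FS (Fl _ Bl)).
Qed.

Lemma precompact_tb S (e : R) : precompact S -> 0 < e -> exists2 ys : seq V,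
  (forall y, y \in ys -> S y) & forall x, S x -> exists2 y, y \in ys & nr (x - y) < e.
Proof.
rewrite precompactE compact_cover => cS e0.
have [||D DS SD] := cS V S (fun x => ball x e%:C).
- by move=> x _; apply: ball_open; rewrite gt0c.
- move=> x /closureP/(_ _ e0)[y Sy xy]; exists y => //.
  by rewrite -ball_normE /ball_/= nrE ltcR nrBC.
exists (finmap.enum_fset D) => [y yD|x Sx]; first by apply: set_mem; exact: DS.
have [y yD] := SD x (subset_closure Sx).
rewrite -ball_normE /ball_/= nrE ltcR nrBC => xy.
by exists y.
Qed.

End TotallyBounded.

(** * The Riesz representation theorem *)

Section Riesz.
Variables (R : realType) (H : hilbertType R).
Implicit Types (x y v w : H).

Lemma conj_opp (c : R[i]) : Num.conj (- c) = - Num.conj c.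
Proof. exact: rmorphN. Qed.

Lemma conj_div (c d : R[i]) : Num.conj (c / d) = Num.conj c / Num.conj d.
Proof. by rewrite rmorphM fmorphV. Qed.

Lemma innerDl x y v : inner (x + y) v = inner x v + inner y v.
Proof. exact: linearDl. Qed.

Lemma innerZl (c : R[i]) x v : inner (c *: x) v = c * inner x v.
Proof. exact: linearZl_LR. Qed.

Lemma innerC x y : inner x y = Num.conj (inner y x).
Proof. by rewrite (@hermitian_subproof _ _ _ _ inner) expr0 mul1r. Qed.

Lemma innerDr x y v : inner v (x + y) = inner v x + inner v y.
Proof. by rewrite innerC innerDl rmorphD; congr (_ + _); exact/esym/innerC. Qed.

Lemma innerZr (c : R[i]) x v : inner v (c *: x) = Num.conj c * inner v x.
Proof. by rewrite innerC innerZl rmorphM; congr (_ * _); exact/esym/innerC. Qed.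

Lemma innerNl x v : inner (- x) v = - inner x v.
Proof. by rewrite -scaleN1r innerZl mulN1r. Qed.

Lemma innerNr x v : inner v (- x) = - inner v x.
Proof. by rewrite innerC innerNl rmorphN; congr (- _); exact/esym/innerC. Qed.

Lemma parallelogram x y : nr (x + y) ^+ 2 + nr (x - y) ^+ 2 = (nr x ^+ 2 + nr y ^+ 2) *+ 2.
Proof.
apply: (@complexI R); rewrite rmorphMn !rmorphD !rmorphXn /= -!nrE -!inner_norm.
by rewrite !innerDl !innerDr !innerNl !innerNr; ring.
Qed.

(** The competitor with [c = - <v, y> / <y, y>] lowers [|v|^2] by [|<v, y>|^2 / <y, y>]. *)
Lemma nearest_orth v y : (forall c : R[i], nr v <= nr (v + c *: y)) -> inner y v = 0.
Proof.
move=> h; have [->|y0] := eqVneq y 0.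
  by rewrite -[0](scale0r (0 : H)) innerZl mul0r.
have Y0 : inner y y != 0 by rewrite inner_norm sqrf_eq0 normr_eq0.
have Yr : Num.conj (inner y y) = inner y y by rewrite -innerC.
pose al := inner v y; pose k := - (al / inner y y).
have hk : `|v| ^+ 2 <= `|v + k *: y| ^+ 2.
  by rewrite lerXn2r ?nnegrE ?normr_ge0// !nrE lecR h.
have e1 : inner (v + k *: y) (v + k *: y) = inner v v - al * Num.conj al / inner y y.
  rewrite !innerDl !innerDr !innerZl !innerZr (innerC y v) -/al /k.
  rewrite conj_opp conj_div Yr; field; exact: Y0.
have : `|al| ^+ 2 / inner y y <= 0.
  by rewrite normCK -subr_ge0 sub0r -(lerD2l (inner v v)) addr0 -e1 !inner_norm.
rewrite pmulr_lle0; last by rewrite invr_gt0 inner_norm exprn_gt0// normr_gt0.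
move=> hal; have : `|al| ^+ 2 == 0 by rewrite eq_le hal exprn_ge0.
rewrite sqrf_eq0 normr_eq0 => /eqP al0.
by rewrite innerC -/al al0 rmorph0.
Qed.

(** The vector of least norm on the hyperplane [f = 1] is orthogonal to the kernel of [f]; it exists
    because a minimizing sequence is Cauchy by the parallelogram law. *)
Lemma riesz (f : H -> R[i]) (L : R) : (forall (c : R[i]) x y, f (c *: x + y) = c * f x + f y) ->
  (forall x, complex.Re `|f x| <= L * nr x) -> exists w, forall x, f x = inner x w.
Proof.
move=> flin fL.
have [f0|/existsNP[x0 /eqP fx0]] := pselect (forall x, f x = 0).
  by exists 0 => x; rewrite f0 -[0 in RHS](scale0r (0 : H)) innerZr rmorph0 mul0r.
have fN0 : f 0 = 0.
  by have := flin 1 0 0; rewrite scale1r mul1r addr0 -[X in X = _]addr0 => /addrI.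
have fD x y : f (x + y) = f x + f y by rewrite -[x]scale1r flin mul1r scale1r.
have fZ c x : f (c *: x) = c * f x by rewrite -[c *: x]addr0 flin fN0 addr0.
have fN x : f (- x) = - f x by rewrite -scaleN1r fZ mulN1r.
pose E : set R := [set r | exists2 x, f x = 1 & r = nr x].
have E0 : E (nr ((f x0)^-1 *: x0)).
  by exists ((f x0)^-1 *: x0) => //; rewrite fZ mulVf.
have Elb : lbound E 0 by move=> _ [x _ ->]; exact: nr_ge0.
have hE : has_inf E by split; [exists (nr ((f x0)^-1 *: x0))|exists 0].
pose d := inf E.
have d0 : 0 <= d by apply: lb_le_inf => //; exists (nr ((f x0)^-1 *: x0)).
have dle x : f x = 1 -> d <= nr x.
  by move=> fx; apply: ge_inf; [exists 0|exists x].
have /choice[v hv] : forall n : nat, exists x, f x = 1 /\ nr x < d + n.+1%:R^-1.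
  move=> n; have n0 : 0 < (n.+1%:R^-1 : R) by rewrite invr_gt0 ltr0n.
  by have [_ [x fx ->] hx] := inf_adherent n0 hE; exists x.
have [l vl] : exists l, nlim v l.
  apply: nlim_cauchy => e e0.
  (* The parallelogram law gives [|v_m - v_n|^2 <= 4 (d + de)^2 - 4 d^2 <= 4 de (2 d + 1) <= e^2 /
     2], where [de <= 1] is used. *)
  pose de := Num.min 1 (e ^+ 2 / ((d *+ 2 + 1) * 8)).
  have D0 : 0 < d *+ 2 + 1 by rewrite ltr_wpDl// mulrn_wge0.
  have de0 : 0 < de by rewrite lt_min ltr01 divr_gt0 ?exprn_gt0// mulr_gt0.
  have [N hN] := natSinv_small de0.
  exists N => m n Nm Nn.
  have [fm hm] := hv m; have [fn hn] := hv n.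
  have mid : d <= nr (2^-1%:C *: (v m + v n)).
    apply: dle; rewrite fZ fD fm fn -[1 + 1](rmorphD (real_complex R) 1 1) -rmorphM.
    by rewrite mulVf// pnatr_eq0.
  have {}mid : d *+ 2 <= nr (v m + v n).
    by move: mid; rewrite nrZ_ge0 ?invr_ge0 ?ler0n// ler_pdivlMl// mulr_natl.
  have par := parallelogram (v m) (v n).
  have hm' : nr (v m) <= d + de by rewrite (le_trans (ltW hm))// lerD2l (ltW (hN _ Nm)).
  have hn' : nr (v n) <= d + de by rewrite (le_trans (ltW hn))// lerD2l (ltW (hN _ Nn)).
  have qm : nr (v m) ^+ 2 <= (d + de) ^+ 2 by rewrite lerXn2r// nnegrE ?nr_ge0// addr_ge0// ltW.
  have qn : nr (v n) ^+ 2 <= (d + de) ^+ 2 by rewrite lerXn2r// nnegrE ?nr_ge0// addr_ge0// ltW.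
  have qmid : (d *+ 2) ^+ 2 <= nr (v m + v n) ^+ 2.
    by rewrite lerXn2r// nnegrE ?nr_ge0// mulrn_wge0.
  rewrite -(ltr_pXn2r (n := 2)) ?nnegrE ?nr_ge0 ?(ltW e0)//.
  have de1 : de <= 1 by rewrite ge_min lexx.
  have de2 : de * ((d *+ 2 + 1) * 8) <= e ^+ 2.
    by rewrite -ler_pdivlMr ?mulr_gt0// ge_min lexx orbT.
  move: (nr (v m) ^+ 2) (nr (v n) ^+ 2) (nr (v m + v n) ^+ 2) (nr (v m - v n) ^+ 2) (e ^+ 2)
    (exprn_gt0 2 e0) par qm qn qmid de2 => a b c g e2 e20 par qm qn qmid de2.
  have dd : de ^+ 2 <= de by rewrite expr2 ler_piMl// ltW.
  have ddd : 0 <= de * d by rewrite mulr_ge0// ltW.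
  move: par qm qn qmid de2; rewrite !mulr2n !expr2 in dd *.
  by nra.
have fl : f l = 1.
  apply/eqP; rewrite -subr_eq0 -normr_eq0; apply/eqP.
  have hz : complex.Re `|f l - 1| = 0.
    apply/le_anti/andP; split; last by have : 0 <= `|f l - 1| by []; rewrite lecE => /andP[].
    apply/ler_addgt0Pr => e e0; rewrite add0r.
    have M0 : 0 < `|L| + 1 by rewrite ltr_wpDl.
    have [N /(_ N (leqnn _)) hN] := vl _ (divr_gt0 e0 M0).
    have -> : f l - 1 = f (l - v N).
      by rewrite fD fN (hv N).1.
    apply: le_trans (fL _) _; rewrite nrBC; move: hN; rewrite ltr_pdivlMr// => /ltW.
    apply: le_trans; rewrite mulrC ler_wpM2l ?nr_ge0//.
    by rewrite (le_trans (ler_norm _))// lerDl.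
  by rewrite -[LHS]RRe_real ?hz// ger0_real.
have nl : nr l <= d.
  apply/ler_addgt0Pr => e e0; have e20 : 0 < e / 2 by rewrite divr_gt0.
  have [N hN] := vl _ e20; have [N' hN'] := natSinv_small e20.
  have := hN _ (leq_maxl N N'); have := hN' _ (leq_maxr N N').
  have [_] := hv (maxn N N'); have := nr_dist l (v (maxn N N')) 0.
  rewrite !subr0 nrBC; move: (_ ^-1) => q; lra.
have key y : f y = 0 -> inner y l = 0.
  move=> fy; apply: nearest_orth => c; apply: le_trans nl _; apply: dle.
  by rewrite addrC flin fy mulr0 add0r.
have l0 : l != 0 by apply/eqP => l0; move: fl; rewrite l0 fN0 => /eqP; rewrite eq_sym oner_eq0.
have ll : inner l l != 0 by rewrite inner_norm sqrf_eq0 normr_eq0.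
exists ((inner l l)^-1 *: l) => x.
have fk : f (x - f x *: l) = 0.
  by rewrite addrC -scaleNr flin fl mulr1 addNr.
have : inner x l = f x * inner l l.
  by apply/subr0_eq; rewrite -(key _ fk) innerDl innerNl innerZl.
rewrite innerZr -[_^-1]mul1r conj_div rmorph1 -innerC mul1r => ->.
by rewrite mulrC mulfK.
Qed.

End Riesz.

Section DiskNet.
Variable R : realType.

Lemma real_net (e : R) : 0 < e -> exists xs : seq R,
  forall x, `|x| <= 1 -> exists2 y, y \in xs & `|x - y| < e.
Proof.
move=> e0; have [N /(_ N (leqnn _)) hN] := natSinv_small e0.
exists [seq k%:R / N.+1%:R - 1 | k <- iota 0 (N.+1 * 2).+1] => x.
rewrite ler_norml => /andP[x0 x1].
pose s := (x + 1) * N.+1%:R.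
have s0 : 0 <= s by rewrite mulr_ge0 ?ler0n//; lra.
have s2 : s <= (N.+1 * 2)%:R by rewrite natrM mulrC /s ler_wpM2r ?ler0n//; lra.
have /andP[k0 k1] := truncn_itv s0.
exists ((Num.trunc s)%:R / N.+1%:R - 1).
  apply/mapP; exists (Num.trunc s) => //; rewrite mem_iota add0n ltnS /=.
  by rewrite -(ler_nat R) (le_trans k0).
have N0 : 0 < (N.+1%:R : R) by rewrite ltr0n.
have xs : x = s / N.+1%:R - 1 by rewrite /s mulfK ?gt_eqF// addrK.
have N1 : 0 <= (N.+1%:R^-1 : R) by rewrite invr_ge0 ler0n.
rewrite {1}xs opprB addrA subrK -mulrBl normrM (ger0_norm N1).
apply: le_lt_trans hN; rewrite ler_piMl ?invr_ge0 ?ler0n// ler_norml.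
rewrite -natr1 in k1.
by move: (_%:R) k0 k1 => q k0 k1; apply/andP; split; lra.
Qed.

Lemma Re_norm_le (x y : R) : complex.Re `|x%:C + 'i%C * y%:C| <= `|x| + `|y|.
Proof.
have -> : x%:C + 'i%C * y%:C = Complex x y by rewrite [RHS]complexE.
rewrite normc_def /= -[leRHS]ger0_norm ?addr_ge0// -sqrtr_sqr ler_sqrt ?sqr_ge0//.
rewrite -[x ^+ 2]real_normK ?num_real// -[y ^+ 2]real_normK ?num_real//.
by have := normr_ge0 x; have := normr_ge0 y; nra.
Qed.

Lemma disk_net (e : R) : 0 < e -> exists cs : seq R[i], forall c : R[i],
  complex.Re `|c| <= 1 -> exists2 d, d \in cs & complex.Re `|c - d| < e.
Proof.
move=> e0; have [xs hxs] := real_net (divr_gt0 e0 (ltr0Sn R 1)).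
exists [seq x%:C + 'i%C * y%:C | x <- xs, y <- xs] => c nc.
have hc : complex.Re c ^+ 2 + complex.Im c ^+ 2 <= 1.
  rewrite -[leLHS]sqr_sqrtr ?addr_ge0 ?sqr_ge0//.
  by move: nc; rewrite normc_def /= => h; rewrite exprn_ile1// sqrtr_ge0.
have [|x xxs hx] := hxs (complex.Re c).
  rewrite -(ler_pXn2r (n := 2)) ?nnegrE// expr1n real_normK ?num_real//.
  by have := sqr_ge0 (complex.Im c); lra.
have [|y yxs hy] := hxs (complex.Im c).
  rewrite -(ler_pXn2r (n := 2)) ?nnegrE// expr1n real_normK ?num_real//.
  by have := sqr_ge0 (complex.Re c); lra.
exists (x%:C + 'i%C * y%:C); first by apply: allpairs_f.
rewrite [c]complexE opprD addrACA -mulrBr -!rmorphB.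
by apply: le_lt_trans (Re_norm_le _ _) _; rewrite (splitr e) ltrD.
Qed.

End DiskNet.

(** * The ideal of a minimal projection as compact operators *)

Section ProjectionIdeal.
Variables (R : realType) (A : cstarAlgType R) (p : A).
Hypothesis mp : minproj p.
Implicit Types (t u v x y : A).

Let p0 : p <> 0. Proof. by case: mp. Qed.
Let pa : p^# = p. Proof. by case: mp. Qed.
Let pp : p ** p = p. Proof. by case: mp. Qed.

Local Notation I := (gideal p).

(** [t] kills [p] and all [a p], hence the whole ideal and in particular [t^#]. *)
Lemma projection_faithful t : I t -> (forall v, v ** p = v -> t ** v = 0) -> t = 0.
Proof.
move=> It h; apply: mul_adj_eq0.
apply: (@annihilator_gideal _ _ t p _ _ _ (gideal_star pa It)) => [a|].
  by rewrite -cstar_mulA; apply: h; rewrite -cstar_mulA pp.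
exact: h.
Qed.

Lemma projection_norm t (M : R) : I t -> 0 <= M ->
  (forall v, v ** p = v -> nr v <= 1 -> nr (t ** v) <= M) -> nr t <= M.
Proof.
move=> It M0 h; apply: (norm_test (C := I) (Z := [set v | v ** p = v])) It M0 h.
- exact/cideal_sub/gideal_cideal.
- by move=> x y Ix Iy; apply: (cidealMl _ (gideal_cideal p)).
- exact: gideal_star.
- by move=> c z _ /= zp; rewrite -cstar_mulA zp.
- by move=> c z /= zp; rewrite mulZx zp.
- exact: projection_faithful.
Qed.

(** Compactness of left multiplication by [t] on the Hilbert space [A p], as total boundedness of
    the image of the unit ball; the net points are taken anywhere in [A]. *)
Definition tbop t := forall e : R, 0 < e -> exists ys : seq A,
  forall v, v ** p = v -> nr v <= 1 -> exists2 y, y \in ys & nr (t ** v - y) < e.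

Lemma tbop_cideal : cideal tbop.
Proof.
have tbD t u : tbop t -> tbop u -> tbop (t + u).
  move=> ht hu e e0; have e20 := divr_gt0 e0 (ltr0Sn R 1).
  have [ys hys] := ht _ e20; have [zs hzs] := hu _ e20.
  exists [seq y + z | y <- ys, z <- zs] => v vp nv.
  have [y yys hy] := hys v vp nv; have [z zzs hz] := hzs v vp nv.
  exists (y + z); first exact: allpairs_f.
  rewrite cstar_mulDl opprD addrACA; apply: le_lt_trans (nrD _ _) _.
  by rewrite (splitr e) ltrD.
have tb_map t (f : A -> A) u (M : R) : (forall v y, v ** p = v ->
    nr (u ** v - f y) <= M * nr (t ** v - y)) -> tbop t -> tbop u.
  move=> hf ht e e0; have M0 : 0 < `|M| + 1 by rewrite ltr_wpDl.
  have [ys hys] := ht _ (divr_gt0 e0 M0); exists (map f ys) => v vp nv.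
  have [y yys hy] := hys v vp nv; exists (f y); first exact: map_f.
  apply: le_lt_trans (hf v y vp) _; move: hy; rewrite ltr_pdivlMr//.
  apply: le_lt_trans; rewrite mulrC ler_wpM2l ?nr_ge0//.
  by rewrite (le_trans (ler_norm _))// lerDl.
apply/cidealP; split; last first.
  move=> b t ht; split.
    apply: tb_map (cstar_mul b) _ (nr b) _ ht => v y vp.
    by rewrite -cstar_mulA -mulxB nrM.
  move=> e e0; have M0 : 0 < nr b + 1 by rewrite ltr_wpDl// nr_ge0.
  have [ys hys] := ht _ (divr_gt0 e0 M0).
  exists [seq (nr b + 1)%:C *: y | y <- ys] => v vp nv.
  pose v' := (nr b + 1)^-1%:C *: (b ** v).
  have [||y yys hy] := hys v'.
  - by rewrite mulZx -cstar_mulA vp.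
  - rewrite nrZ_ge0 ?invr_ge0 ?(ltW M0)// ler_pdivrMl// mulr1 (le_trans (nrM _ _))//.
    by rewrite (le_trans (ler_wpM2l (nr_ge0 _) nv))// mulr1 lerDl.
  exists ((nr b + 1)%:C *: y); first exact: map_f.
  have -> : t ** b ** v - (nr b + 1)%:C *: y = (nr b + 1)%:C *: (t ** v' - y).
    rewrite scalerBr /v' mulxZ scalerA -rmorphM mulfV ?gt_eqF// scale1r.
    by rewrite cstar_mulA.
  by rewrite nrZ_ge0 ?(ltW M0)// mulrC -ltr_pdivlMr.
split.
- apply/closedP => t h e e0; have e20 := divr_gt0 e0 (ltr0Sn R 1).
  have [s hs ts] := h _ e20; have [ys hys] := hs _ e20; exists ys => v vp nv.
  have [y yys hy] := hys v vp nv; exists y => //.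
  apply: le_lt_trans (nr_dist _ (s ** v) _) _; rewrite (splitr e) ltrD//.
  rewrite -mulBx; apply: le_lt_trans (nrM _ _) _; apply: le_lt_trans ts.
  by rewrite ler_piMr// nr_ge0.
- by move=> e e0; exists [:: 0] => v vp nv; exists 0; rewrite ?inE// mul0x subrr nr0.
- move=> c t u ht hu; apply: tbD => //.
  apply: tb_map (fun y => c *: y) _ (complex.Re `|c|) _ ht => v y vp.
  by rewrite mulZx -scalerBr nrZc.
Qed.

(** [p v] is a multiple of [p], so a finite net of the unit disk is enough. *)
Lemma tbop_projection : tbop p.
Proof.
move=> e e0; have [cs hcs] := disk_net e0.
exists [seq c *: p | c <- cs] => v vp nv.
have [_ _ _ /(_ v)[c hc]] := mp.
have pv : p ** v = c *: p by rewrite -vp cstar_mulA.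
have nc : complex.Re `|c| <= 1.
  rewrite -[X in X <= _]mulr1 -(nr_minproj mp) -nrZc -pv.
  by rewrite (le_trans (nrM _ _))// (nr_minproj mp) mul1r.
have [d dcs cd] := hcs c nc; exists (d *: p); first exact: map_f.
by rewrite pv -scalerBl nrZc (nr_minproj mp) mulr1.
Qed.

Lemma gideal_tbop : I `<=` tbop.
Proof. exact: gideal_min tbop_cideal tbop_projection. Qed.

End ProjectionIdeal.

Section ElementaryIdeal.
Variables (R : realType) (A : cstarAlgType R) (q : minprojType A) (S : cstarsub A).
Local Notation p := (mp_val q).
Hypothesis hS : cs_set S = gideal p.
Let mp : minproj p := mp_min q.
Let pa : p^# = p. Proof. by case: mp. Qed.
Let pp : p ** p = p. Proof. by case: mp. Qed.
Local Notation H := (hspace q).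
Local Notation I := (gideal p).
Let cI : cideal I := gideal_cideal p.

Lemma calg_gideal (a : calg S) : I (sval a).
Proof. by rewrite -hS; exact: svalP a. Qed.

Lemma lact_subproof (a : A) (v : H) : (a ** sval v) ** p = a ** sval v.
Proof. by rewrite -cstar_mulA hs_mul. Qed.

Definition hvec (x : A) : H := exist _ (x ** p) (etrans (esym (cstar_mulA x p p)) (congr1 (cstar_mul x) pp)).

Definition lact (a : A) (v : H) : H := exist _ (a ** sval v) (lact_subproof a v).

Lemma norm_le1 (v : H) : (`|v| <= 1) = (nr (sval v) <= 1).
Proof. by rewrite (nrE v) (lecR _ 1). Qed.

Lemma lact_compact (a : A) : I a -> compact_operators H (lact a).
Proof.
move=> Ia; split.
  by move=> c u v; apply: carrier_inj; rewrite /= cstar_mulDr mulxZ.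
apply: tb_precompact => e e0.
(* Right multiplication by [p], which is [hvec], moves the net points into [A p] without increasing
   distances. *)
have [ys hys] := gideal_tbop mp Ia e0.
exists (map hvec ys) => x [v nv0 <-]; have nv : nr (sval v) <= 1 by rewrite -norm_le1.
have [y yys hy] := hys (sval v) (hs_mul v) nv.
exists (hvec y); first exact: map_f.
apply: le_lt_trans hy; rewrite nr_carrier /=.
rewrite -(lact_subproof a v) -mulBx (le_trans (nrM _ _))//.
by rewrite (nr_minproj mp) mulr1 (lact_subproof a v).
Qed.

(** The last clause says that [e f] is left multiplication by an element of the ideal, for every
    bounded [f]. It is carried along with [e], so one induction in [finite_rank_net] builds both. *)
Definition finite_rank_proj (e : A) := [/\ I e, e^# = e, e ** e = e &
  forall (f : H -> H) (L : R), linear f -> (forall v, nr (f v) <= L * nr v) ->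
    exists2 a, I a & forall v : H, a ** sval v = e ** sval (f v)].

Lemma finite_rank_proj0 : finite_rank_proj 0.
Proof.
have [_ I0 _] := cideal_sub cI; split=> //; rewrite ?adj0 ?mulx0//.
by move=> f L _ _; exists 0 => // v; rewrite !mul0x.
Qed.

(** Riesz provides [w] with [<f v, u> = <v, w>], and then [u u^# f(v) = u w^# v]. *)
Lemma finite_rank_projD e (u : A) : finite_rank_proj e -> u ** p = u -> u^# ** u = p ->
  e ** u = 0 -> finite_rank_proj (e + u ** u^#).
Proof.
move=> [Ie ea ee he] up uu eu.
have Ip : I p by exact: gideal_self.
have Iu : I u by rewrite -up; exact: (cidealMl _ cI).
have Ius : I (u ** u^#) by exact: (cidealMr _ cI).
have ue : u^# ** e = 0 by rewrite -ea -cstar_adjM eu adj0.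
split.
- exact: (csubD (cideal_sub cI)).
- by rewrite cstar_adjD ea cstar_adjM cstar_adjK.
- rewrite cstar_mulDl !cstar_mulDr ee cstar_mulA eu mul0x addr0.
  rewrite -cstar_mulA ue mulx0 add0r cstar_mulA -(cstar_mulA u) uu up.
  by [].
move=> f L fl fL; have [a Ia ha] := he f L fl fL.
pose hu : H := exist _ u up.
have [w hw] : exists w : H, forall v : H, inner (f v) hu = inner v w.
  apply: (riesz (L := L * nr u)) => [c x y|v]; first by rewrite fl innerDl innerZl.
  have := hinnerE (f v) hu => /(congr1 (@nr _ _)).
  rewrite nrZc (nr_minproj mp) mulr1 => <-.
  rewrite (le_trans (nrM _ _))// nr_adj mulrC mulrAC ler_wpM2r ?nr_ge0//.
  exact: fL.
exists (a + u ** (sval w)^#).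
  by apply: (csubD (cideal_sub cI)) => //; exact: (cidealMr _ cI).
move=> v; rewrite !cstar_mulDl ha; congr (_ + _).
rewrite -!cstar_mulA (hinnerE v w : _ = (inner v w : R[i]) *: p) -hw.
by rewrite (hinnerE (f v) hu : u^# ** _ = (inner (f v) hu : R[i]) *: p).
Qed.

(** Gram-Schmidt: the new unit vector is the normalized [y - e y], skipped when this is 0. *)
Lemma finite_rank_net (ys : seq H) : exists2 e, finite_rank_proj e &
  forall y, y \in ys -> e ** sval y = sval y.
Proof.
elim: ys => [|y ys [e fe he]]; first by exists 0; [exact: finite_rank_proj0|].
pose y' := sval y - e ** sval y.
have [Ie ea ee _] := fe.
have y'p : y' ** p = y' by rewrite mulBx -cstar_mulA !hs_mul.
have ey' : e ** y' = 0 by rewrite mulxB cstar_mulA ee subrr.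
have [y'0|/eqP y'0] := eqVneq y' 0.
  exists e => // z; rewrite inE => /predU1P[->|/he//].
  by apply/esym/subr0_eq.
have n0 := nr_gt0 y'0; pose u := (nr y')^-1%:C *: y'.
have up : u ** p = u by rewrite mulZx y'p.
have eu : e ** u = 0 by rewrite mulxZ ey' scaler0.
have uu : u^# ** u = p.
  pose h' : H := exist _ y' y'p.
  have hE : y'^# ** y' = (nr y' ^+ 2)%:C *: p.
    by rewrite (hinnerE h' h') hinner_norm (nrE h') rmorphXn.
  rewrite adjZr mulZx mulxZ hE !scalerA -!rmorphM expr2.
  by rewrite (_ : _ * _ = 1) ?scale1r//; field; rewrite gt_eqF.
exists (e + u ** u^#); first exact: finite_rank_projD.
have uy' : u ** u^# ** y' = y'.
  have -> : y' = (nr y')%:C *: u by rewrite scalerA -rmorphM mulfV ?gt_eqF// scale1r.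
  by rewrite mulxZ -cstar_mulA uu up.
have ue : u^# ** e = 0 by rewrite -ea -cstar_adjM eu adj0.
move=> z; rewrite inE cstar_mulDl => /predU1P[->|/he ez]; last first.
  by rewrite ez -[in X in _ + X]ez cstar_mulA -(cstar_mulA u) ue mulx0 mul0x addr0.
have yE : sval y = y' + e ** sval y by rewrite subrK.
rewrite [in X in _ + X]yE cstar_mulDr uy' cstar_mulA -(cstar_mulA u) ue mulx0 mul0x addr0.
by rewrite addrC -yE.
Qed.

Lemma compact_bounded (f : H -> H) : compact_operators H f ->
  exists L : R, forall v, nr (f v) <= L * nr v.
Proof.
move=> [fl fc]; have [ys _ hys] := precompact_tb fc (ltr01 : 0 < 1 :> R).
pose L := \sum_(y <- ys) nr y + 1; exists L => v.
have hL w : nr w <= 1 -> nr (f w) <= L.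
  move=> nw; have [|y yys hy] := hys (f w); first by exists w => //=; rewrite norm_le1.
  have -> : f w = (f w - y) + y by rewrite subrK.
  rewrite (le_trans (nrD _ _))// addrC lerD ?(ltW hy)//.
  by rewrite (big_rem y)//= lerDl sumr_ge0// => i _; exact: nr_ge0.
have f0 : f 0 = 0.
  by have := fl 1 0 0; rewrite !scale1r addr0 -[X in X = _]addr0 => /addrI.
have [->|/eqP/nr_gt0 v0] := eqVneq v 0; first by rewrite f0 !nr0 mulr0.
have := hL ((nr v)^-1%:C *: v); rewrite nrZ_ge0 ?invr_ge0 ?(ltW v0)// mulVf ?gt_eqF// => /(_ (lexx _)).
rewrite -[_ *: v]addr0 fl f0 addr0 nrZ_ge0 ?invr_ge0 ?(ltW v0)//.
by rewrite ler_pdivrMl// mulrC.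
Qed.

(** A finite-rank projection [e] that fixes a net of the image of the unit ball makes [e f] close to
    [f] in norm. The representing elements converge, since on the ideal the norm is the operator
    norm on [A p] ([projection_norm]). *)
Lemma compact_lact (f : H -> H) : compact_operators H f ->
  exists2 a, I a & forall v : H, a ** sval v = sval (f v).
Proof.
move=> cf; have [fl fc] := cf; have [L fL] := compact_bounded cf.
have /choice[a ha] : forall n : nat, exists a, I a /\
    forall v : H, nr v <= 1 -> nr (a ** sval v - sval (f v)) <= n.+1%:R^-1 *+ 2.
  move=> n; have n0 : 0 < (n.+1%:R^-1 : R) by rewrite invr_gt0 ltr0n.
  have [ys _ hys] := precompact_tb fc n0.
  have [e [Ie ea ee he] ey] := finite_rank_net ys.
  have [a Ia ha] := he f L fl fL; exists a; split=> // v nv.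
  have [|y yys hy] := hys (f v); first by exists v => //=; rewrite norm_le1.
  have ne : nr e <= 1.
    have := nr_cstar e; rewrite ea ee => h.
    have [->|/eqP/nr_gt0 e0] := eqVneq e 0; first by rewrite nr0.
    by rewrite -(ler_pM2l e0) mulr1 -expr2 -h.
  have hy' : nr (sval (f v) - sval y) < n.+1%:R^-1 by exact: hy.
  have -> : a ** sval v - sval (f v) =
      e ** (sval (f v) - sval y) - (sval (f v) - sval y).
    by rewrite ha mulxB (ey y yys) opprB addrA subrK.
  rewrite (le_trans (nrB _ _))// mulr2n lerD ?(ltW hy')//.
  by rewrite (le_trans (nrM _ _))// (le_trans _ (ltW hy'))// ler_piMl ?nr_ge0.
have [l al] : exists l, nlim a l.
  (* With [1 / (n + 1) < e / 8] the errors [2 / (m + 1)] and [2 / (n + 1)] add up to at most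
     [e / 2]. *)
  apply: nlim_cauchy => e e0; have [N hN] := natSinv_small (divr_gt0 e0 (ltr0Sn R 7)).
  exists N => m n Nm Nn; have [Im hm] := ha m; have [In hn] := ha n.
  have e2 : e / 2 < e by lra.
  apply: le_lt_trans e2; apply: (projection_norm mp).
  - exact: (csubB (cideal_sub cI)).
  - by rewrite divr_ge0// ltW.
  move=> v vp nv; pose hv : H := exist _ v vp.
  have := hm hv nv; have := hn hv nv => /= h1 h2.
  rewrite mulBx; apply: le_trans (nr_dist _ (sval (f hv)) _) _.
  rewrite [X in _ + X]nrBC; have := hN _ Nm; have := hN _ Nn.
  rewrite mulr2n in h1; rewrite mulr2n in h2; move: h1 h2.
  move: (m.+1%:R^-1 : R) (n.+1%:R^-1 : R) => r s; lra.
have Il : I l.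
  have [clI _ _] := cideal_sub cI; apply: (nlim_closed clI _ al) => n.
  by have [] := ha n.
exists l => // v.
have fE (w : H) : nr w <= 1 -> l ** sval w = sval (f w).
  move=> nw; apply: (nlim_uniq (u := fun n => a n ** sval w)).
    apply: (nlim_map (f := cstar_mul^~ (sval w)) (M := nr w)) al => x y.
    by rewrite -mulBx mulrC nrM.
  move=> e e0; have [N hN] := natSinv_small (divr_gt0 e0 (ltr0Sn R 1)).
  exists N => n /hN hn; have [_ /(_ w nw) h] := ha n.
  apply: le_lt_trans h _; rewrite mulr2n; move: (_^-1) hn => r; lra.
have f0 : f 0 = 0.
  by have := fl 1 0 0; rewrite !scale1r addr0 -[X in X = _]addr0 => /addrI.
have [->|/eqP/nr_gt0 v0] := eqVneq v 0; first by rewrite f0 /= mulx0.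
have := fE ((nr v)^-1%:C *: v); rewrite nrZ_ge0 ?invr_ge0 ?(ltW v0)// mulVf ?gt_eqF// => /(_ (lexx _)).
rewrite -[X in f X]addr0 fl f0 addr0 /= mulxZ => /(congr1 (fun z => (nr v)%:C *: z)).
by rewrite !scalerA -!rmorphM mulfV ?gt_eqF// !scale1r.
Qed.

Lemma elementary_gideal : elementary (calg S).
Proof.
exists H, (fun a => lact (sval a)); split.
- by move=> c a b v; apply: carrier_inj; rewrite /= cstar_mulDl mulZx.
- by move=> a b v; apply: carrier_inj; rewrite /= cstar_mulA.
- move=> a v w; apply: (hinner_eq (x := lact _ v)).
  rewrite -[RHS](hinnerE v (lact (sval a) w)) /=.
  by rewrite cstar_adjM cstar_mulA.
- move=> a b ab; apply/carrier_inj/subr0_eq/(projection_faithful mp).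
    by apply: (csubB (cideal_sub cI)); exact: calg_gideal.
  move=> v vp; rewrite mulBx.
  have /(congr1 (fun f => sval (f (exist _ v vp : H)))) /= -> := ab.
  by rewrite subrr.
- apply/seteqP; split=> [_ [a _ <-]|f cf]; first by apply: lact_compact; exact: calg_gideal.
  have [a Ia ha] := compact_lact cf.
  have Sa : cs_set S a by rewrite hS.
  exists (exist _ a Sa) => //; apply/funext => v; apply: carrier_inj; exact: ha.
Qed.

End ElementaryIdeal.

(** * Dual ideals *)

Section Vanishing.
Variables (R : realType) (X : choiceType).
Implicit Types (f g h : X -> R).

Definition vanishing f := forall e : R, 0 < e -> finite_set [set i | e <= f i].

Lemma vanishing_le f g (M : R) : 0 <= M -> (forall i, 0 <= g i) ->
  (forall i, f i <= M * g i) -> vanishing g -> vanishing f.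
Proof.
move=> M0 g0 fg vg e e0; have M1 : 0 < M + 1 by rewrite ltr_wpDl.
apply: sub_finite_set (vg (e / (M + 1)) (divr_gt0 e0 M1)) => i /= ef.
by rewrite ler_pdivrMr// (le_trans ef)// (le_trans (fg i))// mulrC ler_wpM2l// lerDl.
Qed.

Lemma vanishing_leD f g h : (forall i, f i <= g i + h i) ->
  vanishing g -> vanishing h -> vanishing f.
Proof.
move=> fgh vg vh e e0; have e20 : 0 < e / 2 by rewrite divr_gt0.
apply: (@sub_finite_set _ _ ([set i | e / 2 <= g i] `|` [set i | e / 2 <= h i])).
  move=> i /= ef; have [|gi] := leP (e / 2) (g i); first by left.
  by right; have := fgh i; lra.
by rewrite finite_setU; split; [exact: vg|exact: vh].
Qed.

End Vanishing.

Section OrthogonalFamily.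
Variables (R : realType) (A : cstarAlgType R) (X : choiceType) (F : X -> set A).
Variable (P : set A).
Hypothesis cF : forall i, cideal (F i).
Hypothesis sF : forall i, star_closed (F i).
Hypothesis oF : forall i j x y, i <> j -> F i x -> F j y -> x ** y = 0.
Hypothesis FS : forall i, F i `<=` smallest (@cideal R A) P.
Hypothesis PF : forall p, P p -> exists i, F i p.
Implicit Types (x y z : A) (i j : X).

Local Notation S := (smallest (@cideal R A) P).
Let cS : cideal S. Proof. exact: smallest_cideal. Qed.

Lemma family_star : star_closed S.
Proof.
move=> x; have := smallest_cideal_min (star_preimage_cideal cS).
by apply=> p /PF[i Fp] /=; apply: (FS (i := i)); exact: sF.
Qed.

(** The right-hand side is a closed ideal, and each generator lies in [F i] or in an [F j]
    orthogonal to it. *)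
Lemma family_split i : S `<=` sum_set (F i) (perp (F i)).
Proof.
have [_ F0 _] := cideal_sub (cF i).
apply: smallest_cideal_min => [|p /PF[j Fp]].
  apply: sum_set_cideal => //; [exact: perp_cideal|exact: perp_star|].
  by move=> x y Fx py; apply: perp_right py Fx.
have [ji|/eqP ji] := eqVneq j i.
  by exists p, 0; rewrite addr0 -ji; split=> // y _; rewrite mul0x.
exists 0, p; rewrite add0r; split=> // y Fy; exact: oF ji Fp Fy.
Qed.

(** The component of [x] in [F i], unique because [F i] meets [perp (F i)] only in 0. The default 0
    makes [coord_mem] hold for every [x]. *)
Definition coord i x : A := xget 0 [set a | F i a /\ perp (F i) (x - a)].

Lemma coord_mem i x : F i (coord i x).
Proof. by rewrite /coord; case: xgetP => [a _ []|_] //; have [] := cideal_sub (cF i). Qed.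

Lemma coord_perp i x : S x -> perp (F i) (x - coord i x).
Proof.
move=> /(@family_split i)[a [b [Fa pb xab]]].
have [] // : [set a | F i a /\ perp (F i) (x - a)] (coord i x).
by apply: (xgetPex 0); exists a; split=> //; rewrite xab [a + b]addrC addrK.
Qed.

Lemma coord_eq i x a : F i a -> perp (F i) (x - a) -> coord i x = a.
Proof.
move=> Fa pa; apply/subr0_eq.
have [Fc pc] : [set a | F i a /\ perp (F i) (x - a)] (coord i x).
  by apply: (xgetPex 0); exists a.
apply: (perp_disjoint (J := F i)) => //.
  exact: (csubB (cideal_sub (cF i))).
have -> : coord i x - a = (x - a) - (x - coord i x) by rewrite opprB [RHS]addrC addrA subrK.
exact: (csubB (cideal_sub (perp_cideal (cF i))) pa pc).
Qed.

Lemma coord_lin i (c : R[i]) x y : S x -> S y ->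
  coord i (c *: x + y) = c *: coord i x + coord i y.
Proof.
move=> Sx Sy; have [_ _ lF] := cideal_sub (cF i).
have [_ _ lP] := cideal_sub (perp_cideal (cF i)).
apply: coord_eq; first by apply: lF; exact: coord_mem.
by rewrite opprD addrACA -scalerBr; exact: lP (coord_perp Sx) (coord_perp Sy).
Qed.

Lemma coordB i x y : S x -> S y -> coord i (x - y) = coord i x - coord i y.
Proof. by move=> Sx Sy; rewrite addrC -scaleN1r coord_lin// scaleN1r addrC. Qed.

Lemma coordD i x y : S x -> S y -> coord i (x + y) = coord i x + coord i y.
Proof. by move=> Sx Sy; rewrite -[x]scale1r coord_lin// !scale1r. Qed.

Lemma coordMl i b x : S x -> coord i (b ** x) = b ** coord i x.
Proof.
move=> Sx; apply: coord_eq; first exact: (cidealMl _ (cF i) (coord_mem i x)).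
by rewrite -mulxB; exact: (cidealMl _ (perp_cideal (cF i)) (coord_perp Sx)).
Qed.

Lemma coordMr i b x : S x -> coord i (x ** b) = coord i x ** b.
Proof.
move=> Sx; apply: coord_eq; first exact: (cidealMr _ (cF i) (coord_mem i x)).
by rewrite -mulBx; exact: (cidealMr _ (perp_cideal (cF i)) (coord_perp Sx)).
Qed.

Lemma coord_act i x z : S x -> F i z -> x ** z = coord i x ** z.
Proof.
by move=> Sx Fz; apply/subr0_eq; rewrite -mulBx; exact: (coord_perp (i := i) Sx).
Qed.

Lemma coordM i x y : S x -> S y -> coord i (x ** y) = coord i x ** coord i y.
Proof. by move=> Sx Sy; rewrite coordMl// -coord_act//; exact: coord_mem. Qed.

Lemma coord_adj i x : S x -> coord i x^# = (coord i x)^#.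
Proof.
move=> Sx; apply: coord_eq; first exact/sF/coord_mem.
by rewrite -adjB; exact: (perp_star (cF i) (@sF i) (coord_perp Sx)).
Qed.

Lemma coord_le i x : S x -> nr (coord i x) <= nr x.
Proof.
move=> Sx; have := coord_perp (i := i) Sx; move: (coord_mem i x).
rewrite -[in X in _ -> _ -> _ <= X](subrK (coord i x) x) [X in _ -> _ -> _ <= nr X]addrC.
apply: nr_orth_sum (@sF i) (perp_star (cF i) (@sF i)) _ => y z Fy pz.
exact: perp_right pz Fy.
Qed.

Lemma coord_id i x : F i x -> coord i x = x.
Proof. by move=> Fx; apply: coord_eq => //; rewrite subrr => y _; rewrite mul0x. Qed.

Lemma coord_other i j x : j <> i -> F j x -> coord i x = 0.
Proof.
move=> ji Fx; apply: coord_eq; first by have [] := cideal_sub (cF i).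
by rewrite subr0 => y; exact: oF ji Fx.
Qed.

Lemma family_faithful x : S x -> (forall i z, F i z -> x ** z = 0) -> x = 0.
Proof.
move=> Sx xF; apply: mul_adj_eq0; apply: annihilator_smallest (family_star Sx).
- by move=> q /PF[j]; exact: xF.
- by move=> a q /PF[i Fq]; rewrite -cstar_mulA; apply: (xF i); apply: (cidealMl _ (cF i)).
Qed.

Lemma coord_inj x y : S x -> S y -> (forall i, coord i x = coord i y) -> x = y.
Proof.
move=> Sx Sy xy; apply/subr0_eq; apply: family_faithful => [|i z Fz].
  exact: (csubB (cideal_sub cS)).
by rewrite mulBx (coord_act Sx Fz) (coord_act Sy Fz) xy subrr.
Qed.

(** The elements of the [F i] together test the norm ([norm_test]), and on [F i] the element [x]
    acts as its coordinate. With [coord_le], the norm is the supremum of those of the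
    coordinates. *)
Lemma coord_norm (e : R) x : S x -> 0 <= e -> (forall i, nr (coord i x) <= e) -> nr x <= e.
Proof.
move=> Sx e0 xe; have Sx' := Sx; apply: (norm_test (C := S) (Z := \bigcup_i F i)) Sx e0 _.
- exact: cideal_sub.
- by move=> y z _ Sz; apply: (cidealMl _ cS).
- exact: family_star.
- by move=> c z _ [i _ Fz]; exists i => //; apply: (cidealMl _ (cF i)).
- by move=> c z [i _ Fz]; exists i => //; apply: csubZ Fz; exact: cideal_sub.
- move=> c Sc h; apply: family_faithful => // i z Fz.
  by apply: h; exists i.
- move=> z [i _ Fz] z1; rewrite (coord_act Sx' Fz) (le_trans (nrM _ _))//.
  by rewrite -[leRHS]mulr1 ler_pM ?nr_ge0.
Qed.

(** The elements with vanishing coordinates form a closed ideal, and each generator has at most one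
    nonzero coordinate. *)
Lemma coord_vanishing x : S x -> vanishing (fun i => nr (coord i x)).
Proof.
move=> Sx; have [clS S0 lS] := cideal_sub cS.
pose W := [set x | S x /\ vanishing (fun i => nr (coord i x))].
suff: W x by case.
move: x Sx; apply: smallest_cideal_min; last first.
  move=> p Pp; have [j Fp] := PF Pp; split=> [|e e0]; first exact: FS Fp.
  apply: (@sub_finite_set _ _ [set j]) => // i /= h.
  have [->//|/eqP ij] := eqVneq i j; move: h.
  by rewrite (coord_other (j := j)) ?nr0 ?leNgt ?e0//; apply: nesym.
apply/cidealP; split; last first.
  move=> b x [Sx vx]; split; split.
  - exact: (cidealMl _ cS).
  - apply: (vanishing_le (M := nr b)) vx => [|i|i]; rewrite ?nr_ge0// coordMl//.
    exact: nrM.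
  - exact: (cidealMr _ cS).
  - apply: (vanishing_le (M := nr b)) vx => [|i|i]; rewrite ?nr_ge0// coordMr//.
    by rewrite mulrC nrM.
split.
- apply/closedP => x h; have Sx : S x.
    by move/closedP: clS; apply=> e /h[y [Sy _] xy]; exists y.
  split=> // e e0; have e20 : 0 < e / 2 by rewrite divr_gt0.
  have [y [Sy vy] xy] := h _ e20.
  apply: sub_finite_set (vy _ e20) => i /= ex.
  have := coord_le i (csubB (cideal_sub cS) Sx Sy); rewrite coordB//.
  have := nrD (coord i x - coord i y) (coord i y); rewrite subrK; lra.
- split=> // e e0; apply: (@sub_finite_set _ _ set0) => // i /=.
  rewrite (coord_id (i := i)); last by have [] := cideal_sub (cF i).
  by rewrite nr0 leNgt e0.
- move=> c x y [Sx vx] [Sy vy]; split; first exact: lS.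
  apply: (@vanishing_leD _ _ _ (fun i => complex.Re `|c| * nr (coord i x))) vy.
    by move=> i; rewrite coord_lin// (le_trans (nrD _ _))// nrZc.
  apply: vanishing_le vx => [|i|i]; last exact: lexx.
    by rewrite -ler0c RRe_real ?ger0_real.
  exact: nr_ge0.
Qed.

Lemma coord_list (z : X -> A) (s : seq X) : (forall i, F i (z i)) ->
  exists2 y, S y & forall i, coord i y = if i \in s then z i else 0.
Proof.
move=> Fz; elim: s => [|j s [y Sy hy]].
  have [_ S0 _] := cideal_sub cS; exists 0 => // i.
  by rewrite coord_id//; have [] := cideal_sub (cF i).
have [js|js] := boolP (j \in s).
  by exists y => // i; rewrite hy inE; case: eqVneq => [->|]//; rewrite js.
have Sz : S (z j) := FS (Fz j).
exists (z j + y); first exact: (csubD (cideal_sub cS)).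
move=> i; rewrite coordD// hy inE; case: eqVneq => [->|/eqP ij] /=.
  by rewrite (negPf js) addr0 coord_id.
by rewrite (coord_other (j := j)) ?add0r//; exact: nesym.
Qed.

(** Truncate [z] to the finitely many [i] with [|z i| >= 1 / (n + 1)]; the resulting finite sums are
    Cauchy by [coord_norm]. *)
Lemma coord_surj (z : X -> A) : (forall i, F i (z i)) -> vanishing (fun i => nr (z i)) ->
  exists2 x, S x & forall i, coord i x = z i.
Proof.
move=> Fz vz; have cSs := cideal_sub cS.
have /choice[y hy] : forall n : nat, exists y,
    S y /\ forall i, nr (coord i y - z i) <= n.+1%:R^-1.
  move=> n; have n0 : 0 < (n.+1%:R^-1 : R) by rewrite invr_gt0 ltr0n.
  have /finite_seqP[s hs] := vz _ n0; have [y Sy hy] := coord_list s Fz.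
  exists y; split=> // i; rewrite hy; case: ifPn => [_|/negP si].
    by rewrite subrr nr0 ltW.
  rewrite sub0r nrN leNgt; apply/negP => /ltW zi.
  by apply: si; have : [set i | n.+1%:R^-1 <= nr (z i)] i by []; rewrite hs.
have [x yx] : exists x, nlim y x.
  apply: nlim_cauchy => e e0; have [N hN] := natSinv_small (divr_gt0 e0 (ltr0Sn R 1)).
  exists N => m n /hN hm /hN hn; have [Sm ym] := hy m; have [Sn yn] := hy n.
  apply: le_lt_trans (_ : m.+1%:R^-1 + n.+1%:R^-1 < e); last by rewrite (splitr e) ltrD.
  apply: coord_norm => [||i]; first exact: (csubB cSs Sm Sn).
    by rewrite addr_ge0 ?invr_ge0 ?ler0n.
  rewrite coordB// (le_trans (nr_dist _ (z i) _))// lerD// nrBC.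
  exact: yn.
have Sx : S x by have [clS _ _] := cSs; apply: (nlim_closed clS _ yx) => n; have [] := hy n.
exists x => // i; apply/subr0_eq/nr_small => e e0.
have e20 : 0 < e / 2 by rewrite divr_gt0.
have [N hN] := yx _ e20; have [N' hN'] := natSinv_small e20.
have := hN _ (leq_maxl N N'); have := hN' _ (leq_maxr N N').
move: (maxn N N') => n h1 h2; have [Sy /(_ i) yz] := hy n.
have := coord_le i (csubB cSs Sx Sy); rewrite coordB// (nrBC x).
have := nr_dist (coord i x) (coord i (y n)) (z i).
move: (n.+1%:R^-1 : R) h1 yz => r; lra.
Qed.

End OrthogonalFamily.

(** * Ideals generated by minimal projections *)

Section DualIdeal.
Variables (R : realType) (A : cstarAlgType R).

(** For [v = p a q], minimality of [q] gives [v^# v = c q] with [c] nonzero, and [v^# v] is in the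
    ideal of [p]. *)
Lemma minproj_gideal_mem (p q a : A) : minproj p -> minproj q ->
  p ** a ** q <> 0 -> gideal p q.
Proof.
move=> [_ pa pp _] [_ qa qq hq] v0; have cp := gideal_cideal p.
have [c hc] := hq (a^# ** p ** a).
have vE : (p ** a ** q)^# ** (p ** a ** q) = c *: q.
  by rewrite -hc !cstar_adjM pa qa !cstar_mulA -(cstar_mulA _ p p) pp.
have [c0|/eqP c0] := eqVneq c 0.
  by case: v0; apply: adj_mul_eq0; rewrite vE c0 scale0r.
have -> : q = c^-1 *: (c *: q) by rewrite scalerA mulVf ?scale1r//; exact/eqP.
rewrite -vE; apply: (csubZ _ (cideal_sub cp)).
by apply: (cidealMl _ cp); apply: (cidealMr _ cp); apply: (cidealMr _ cp); exact: gideal_self.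
Qed.

(** A nonzero [p a q] would put each projection into the ideal of the other. So [p A q = 0], and
    [annihilator_gideal] carries this from [p] and [q] to their ideals. *)
Lemma gideal_orth (p q x y : A) : minproj p -> minproj q -> gideal p <> gideal q ->
  gideal p x -> gideal q y -> x ** y = 0.
Proof.
move=> mp mq pq px qy; have [_ pa pp _] := mp; have [_ qa _ _] := mq.
have paq a : p ** a ** q = 0.
  apply: contrapT => v0; apply: pq; apply/seteqP; split.
    apply: gideal_min; first exact: gideal_cideal.
    apply: (minproj_gideal_mem (a := a^#) mq mp) => w0; apply: v0.
    have wE : (p ** a ** q)^# = q ** a^# ** p by rewrite !cstar_adjM pa qa cstar_mulA.
    by rewrite -[LHS]cstar_adjK wE w0 adj0.
  apply: gideal_min; first exact: gideal_cideal.
  exact: minproj_gideal_mem mp mq v0.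
have pay a : p ** a ** y = 0.
  apply: annihilator_gideal qy => [b|]; last exact: paq.
  by rewrite -(cstar_mulA p); exact: paq.
rewrite -[LHS]cstar_adjK cstar_adjM (annihilator_gideal (q := p)) ?adj0//.
- move=> a; have -> : y^# ** a ** p = (p ** a^# ** y)^#.
    by rewrite !cstar_adjM cstar_adjK pa cstar_mulA.
  by rewrite pay adj0.
- have -> : y^# ** p = (p ** p ** y)^# by rewrite pp cstar_adjM pa.
  by rewrite pay adj0.
- exact: (gideal_star pa).
Qed.

Section MinprojAlgebra.
Variable q : minprojType A.
Local Notation p := (mp_val q).

Let cp : cideal (gideal p). Proof. exact: gideal_cideal. Qed.
Let sp : closed_subspace (gideal p). Proof. exact: cideal_sub. Qed.

Fact gideal_closed : closed (gideal p). Proof. by case: sp. Qed.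
Fact gideal0 : gideal p 0. Proof. by case: sp. Qed.
Fact gideal_lin (c : R[i]) x y : gideal p x -> gideal p y -> gideal p (c *: x + y).
Proof. by case: sp => _ _; exact. Qed.

Definition gideal_csub : csub A := CSub gideal_closed gideal0 gideal_lin.

Fact gideal_mul x y : gideal p x -> gideal p y -> gideal p (x ** y).
Proof. by move=> _; exact: cidealMl cp. Qed.
Fact gideal_adj x : gideal p x -> gideal p x^#.
Proof. by have [_ pa _ _] := mp_min q; exact: gideal_star. Qed.

Definition gideal_alg : cstarsub A := CStarSub (ca_csub := gideal_csub) gideal_mul gideal_adj.

End MinprojAlgebra.

Lemma dual_smallest_cideal (P : set A) : P `<=` @minproj R A ->
  dual_cstar_algebra (smallest (@cideal R A) P).
Proof.
(* The indices are ideals, not projections, because different projections may generate the same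
   ideal; [{classic _}] supplies the choice structure. *)
move=> Pm; pose X := {classic {I : set A | exists2 p, P p & I = gideal p}}.
have /choice[g hg] : forall i : X, exists q : minprojType A,
    P (mp_val q) /\ sval i = gideal (mp_val q).
  by move=> [I [p Pp Ip]]; exists (MinProj (Pm _ Pp)).
pose F (i : X) : set A := gideal (mp_val (g i)).
pose S := smallest (@cideal R A) P.
have cF i : cideal (F i) by exact: gideal_cideal.
have sF i : star_closed (F i).
  by have [_ pa _ _] := mp_min (g i); exact: gideal_star.
have oF i j x y : i <> j -> F i x -> F j y -> x ** y = 0.
  move=> ij; apply: gideal_orth; [exact: mp_min|exact: mp_min|].
  have [[_ gi] [_ gj]] := (hg i, hg j).
  by rewrite -gi -gj => /eq_sig_hprop => /(_ (fun=> @Prop_irrelevance _)).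
have FS i : F i `<=` S.
  apply: gideal_min; first exact: smallest_cideal.
  by have [Pg _] := hg i => I [_]; exact.
have PF p : P p -> exists i, F i p.
  move=> Pp; exists (exist _ (gideal p) (ex_intro2 _ _ p Pp erefl)).
  by rewrite /F -(hg _).2; exact: gideal_self.
pose phi (x : A) (i : X) : calg (gideal_alg (g i)) := exist _ (coord F i x) (coord_mem cF i x).
exists X, (fun i => calg (gideal_alg (g i))), phi; split.
- by move=> i; exact: elementary_gideal.
- move=> i; split=> [c x y Sx Sy|x y Sx Sy|x Sx]; apply: carrier_inj => /=.
  + exact: (coord_lin cF sF oF PF).
  + exact: (coordM cF sF oF PF).
  + exact: (coord_adj cF sF oF PF).
- move=> x y Sx Sy xy; apply: (coord_inj cF sF oF FS PF) => // i.
  by have /(congr1 sval) := congr1 (fun f => f i) xy.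
- apply/seteqP; split=> [_ [x Sx <-] e e0|z hz].
    have eE : e = (complex.Re e)%:C by rewrite RRe_real// gtr0_real.
    have := coord_vanishing cF sF oF FS PF Sx; rewrite eE gt0c in e0 * => /(_ _ e0).
    by apply: sub_finite_set => i /=; rewrite nrE lecR.
  have [x Sx hx] : exists2 x, S x & forall i, coord F i x = sval (z i).
    apply: (coord_surj cF sF oF FS PF) => [i|e e0]; first exact: svalP (z i).
    have := hz e%:C; rewrite gt0c => /(_ e0).
    by apply: sub_finite_set => i /=; rewrite nrE lecR.
  exists x => //; apply: functional_extensionality_dep => i.
  by apply: carrier_inj; exact: hx.
Qed.

End DualIdeal.

Theorem theorem4p8 (R : realType) (A : cstarAlgType R) (T : A -> A -> A)
  (hT : quasi_centralizer (pedersen_ideal [set: A]) T) :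
  exists A0 A1 : set A,
    [/\ direct_sum_decomposition A0 A1,
        dual_cstar_algebra A1 &
        locally_bounded A0 T].
Proof.
exists (tideal T), (tperp T); split.
- exact: tideal_decomposition hT.
- by rewrite (tperp_tsoc hT); apply: dual_smallest_cideal => p [].
- exact: tideal_locally_bounded hT.
Qed.
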